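(* Let $\Lambda,\Lambda^*,G_\Lambda,g_\lambda,h_{\lambda^*},\eta_0,E_\pm$ be as follows: $\Lambda$ is a sequence of distinct real numbers such that some entire function $G_\Lambda$ vanishes on $\Lambda$ and satisfies $G_\Lambda(x+iy)\ll_\eta e^{cx^2}$ for some $c>0$ in every strip $|y|\le\eta$; $\Lambda^*\subset\mathbb{R}$ is locally finite; $g_\lambda:\mathbb{R}\to\mathbb{C}$ ($\lambda\in\Lambda$), $h_{\lambda^*}:\mathbb{R}\to\mathbb{C}$ ($\lambda^*\in\Lambda^*$) satisfy: (a) there is $\eta_0>0$ such that for every real $x$ the series $E_\pm(x,z):=2\pi i\sum'_{\mp\lambda^*\ge0}h_{\lambda^*}(x)e^{-2\pi i\lambda^*z}$ converge absolutely for $\pm\operatorname{Im} z\ge\eta_0$; (b) for every $\varepsilon>0$ and $x\in\mathbb{R}$, $g_\lambda(x)e^{-\varepsilon\lambda^2}\to0$ as $|\lambda|\to\infty$; (c) for every $\varepsilon>0$ and $z$ with $|\operatorname{Im} z|\ge\eta_0$, $f_{\varepsilon,z}(x):=e^{-\varepsilon x^2}/(z-x)$ satisfies $f_{\varepsilon,z}(x)=\sum_{\lambda\in\Lambda}f_{\varepsilon,z}(\lambda)g_\lambda(x)+\sum_{\lambda^*\in\Lambda^*}\widehat{f_{\varepsilon,z}}(\lambda^* )h_{\lambda^*}(x)$ for all real $x$. Assume in addition: (d) there is $\nu_0>0$ such that the series $E^*_\pm(x,w):=2\pi i\sum'_{\pm\lambda\ge0}g_\lambda(x)e^{2\pi i\lambda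 w}$ converge absolutely for $\pm\operatorname{Im} w\ge\nu_0$; (e) $E_\pm(x,t_n+i\eta)\ll e^{c|t_n|}$ for some $c>0$, uniformly for $|\eta|\le\eta_0$, along suitable sequences $(t_n)_{n\ge1}$ tending to $+\infty$ and to $-\infty$. Then, with $z\mapsto E_-(x,z)$ understood as its meromorphic continuation, \[ E^*_+(x,w)=-2\pi i e^{2\pi i xw}H(x)+\sum_{\lambda^*\ge0}{}'\,h_{\lambda^*}(x)\frac{e^{-2\pi\eta_0(w-\lambda^* )}}{w-\lambda^*}+\sum_{\lambda^*\le0}{}'\,h_{\lambda^*}(x)\frac{e^{2\pi\eta_0(w-\lambda^* )}}{w-\lambda^*}+\Phi(x,w), \] \[ E^*_-(x,w)=-2\pi i e^{2\pi i xw}-E^*_+(x,w). \]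
   Context: The Fourier transform is $\widehat{f}(\xi)=\int_{\mathbb{R}}f(x)e^{-2\pi i x\xi}dx$. A prime on a summation sign means that a possible term indexed by $0$ is divided by $2$. $H$ denotes the Heaviside step function. $\Phi(x,w):=\int_{-i\eta_0}^{i\eta_0}e^{2\pi i zw}E_-(x,z)\,dz$ (integral along the segment, in the principal value sense if $z\mapsto E_-(x,z)$ has a simple pole at $0$); here $E_-(x,\cdot)$ denotes the meromorphic continuation of the series $E_-$ to $\mathbb{C}$, which exists under (a)–(c). The right-hand side of the first identity defines a meromorphic function of $w\in\mathbb{C}$, and the identities are to be read as equalities of meromorphic functions extending the series $E^*_\pm$.
   Formalization: Signs corrected, as the printed identities fail: both terms −2πi e^{2πixw} become +2πi e^{2πixw}, and the exponents become e^{2πη₀(w−λ* )} for λ*≥0 and e^{−2πη₀(w−λ* )} for λ*≤0; H(0)=1/2 is used. *)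

(* Defs.v *)
(* Stdlib reals with Coquelicot; C is Coquelicot's type of complex numbers. *)
From Stdlib Require Export Reals List.
From Coquelicot Require Export Coquelicot.
Export ListNotations.
Open Scope R_scope.

Definition cexp (z : C) : C :=
  (exp (Re z) * cos (Im z), exp (Re z) * sin (Im z)).

Definition twopii : C := (2 * PI * Ci)%C.

(** * Sums over sets of real numbers *)

Definition finite_part (A : R -> Prop) (l : list R) : Prop :=
  NoDup l /\ forall t, In t l -> A t.

Definition fin_sum (f : R -> C) (l : list R) : C :=
  fold_right (fun t s => (f t + s)%C) (RtoC 0) l.

Definition fin_sum_mod (f : R -> C) (l : list R) : R :=
  fold_right (fun t s => Cmod (f t) + s) 0 l.

Definition abs_summable (A : R -> Prop) (f : R -> C) : Prop :=
  exists M : R, forall l, finite_part A l -> fin_sum_mod f l <= M.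

(* Convergence along the finite subsets of A ordered by inclusion; for complex
   terms this is equivalent to absolute convergence, and no enumeration of A
   has to be chosen. *)
Definition is_usum (A : R -> Prop) (f : R -> C) (s : C) : Prop :=
  forall eps : R, 0 < eps ->
  exists l0, finite_part A l0 /\
    forall l, finite_part A l -> incl l0 l -> Cmod (fin_sum f l - s) < eps.

Definition usum (A : R -> Prop) (f : R -> C) : C :=
  iota (T := C_R_CompleteNormedModule) (is_usum A f).

Definition nonneg_part (A : R -> Prop) : R -> Prop := fun t => A t /\ 0 <= t.
Definition nonpos_part (A : R -> Prop) : R -> Prop := fun t => A t /\ t <= 0.

(* The primed sums: the term indexed by 0, if any, is halved. *)
Definition prime_term (a : R -> C) (t : R) : C :=
  if Req_EM_T t 0 then (a t / 2)%C else a t.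

Definition locally_finite (A : R -> Prop) : Prop :=
  forall a b : R, exists l : list R, forall t, A t -> a <= t <= b -> In t l.

(** * Holomorphic and meromorphic functions *)

Definition holomorphic_at (f : C -> C) (z0 : C) : Prop :=
  exists r : R, 0 < r /\
    forall z : C, Cmod (z - z0) < r -> @ex_derive C_AbsRing C_NormedModule f z.

Definition entire (f : C -> C) : Prop := forall z, holomorphic_at f z.

Definition pole_at (f : C -> C) (z0 : C) : Prop :=
  exists (n : nat) (phi : C -> C) (r : R),
    (0 < n)%nat /\ holomorphic_at phi z0 /\ phi z0 <> RtoC 0 /\ 0 < r /\
    forall z : C, 0 < Cmod (z - z0) < r -> f z = (phi z / (z - z0) ^ n)%C.

(* Meromorphic functions on C are total functions here: there are no removable
   singularities, and the value at a pole is unconstrained. *)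
Definition meromorphic (f : C -> C) : Prop :=
  forall z0, holomorphic_at f z0 \/ pole_at f z0.

Definition is_mero_ext (D : C -> Prop) (f F : C -> C) : Prop :=
  meromorphic F /\ forall z, D z -> F z = f z.

(** * Fourier transform, Heaviside function, principal values *)

Definition fourier (f : R -> C) (xi : R) : C :=
  RInt_gen (V := C_R_CompleteNormedModule)
    (fun x => (f x * cexp (- twopii * x * xi))%C)
    (Rbar_locally m_infty) (Rbar_locally p_infty).

(* Symmetric convention at 0: a singularity at 0 counts with weight 1/2, in
   agreement with the primed sums and with the principal value below. *)
Definition heaviside (x : R) : R :=
  if Rlt_dec x 0 then 0 else if Req_EM_T x 0 then 1 / 2 else 1.

Definition is_pv (f : R -> C) (a : R) (v : C) : Prop :=
  forall eps : R, 0 < eps ->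
  exists d : R, 0 < d /\
    forall delta : R, 0 < delta < d ->
    exists I1 I2 : C,
      @is_RInt C_R_NormedModule f (- a) (- delta) I1 /\
      @is_RInt C_R_NormedModule f delta a I2 /\
      Cmod (I1 + I2 - v) < eps.

(** * The objects attached to an interpolation formula *)

Definition f_eps (eps : R) (z : C) (x : R) : C :=
  (RtoC (exp (- eps * x ^ 2)) / (z - x))%C.

Definition E_term (h : R -> R -> C) (x : R) (z : C) : R -> C :=
  prime_term (fun l => h l x * cexp (- twopii * l * z))%C.

Definition E_plus (Ls : R -> Prop) (h : R -> R -> C) (x : R) (z : C) : C :=
  (twopii * usum (nonpos_part Ls) (E_term h x z))%C.

Definition E_minus (Ls : R -> Prop) (h : R -> R -> C) (x : R) (z : C) : C :=
  (twopii * usum (nonneg_part Ls) (E_term h x z))%C.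

Definition Estar_term (g : R -> R -> C) (x : R) (w : C) : R -> C :=
  prime_term (fun l => g l x * cexp (twopii * l * w))%C.

Definition Estar_plus (La : R -> Prop) (g : R -> R -> C) (x : R) (w : C) : C :=
  (twopii * usum (nonneg_part La) (Estar_term g x w))%C.

Definition Estar_minus (La : R -> Prop) (g : R -> R -> C) (x : R) (w : C) : C :=
  (twopii * usum (nonpos_part La) (Estar_term g x w))%C.

(* z = i y, dz = i dy.  The principal value is taken in all cases; it is the
   ordinary integral whenever F is regular at 0. *)
Definition Phi_integrand (F : C -> C) (w : C) (y : R) : C :=
  (Ci * cexp (twopii * (Ci * y) * w) * F (Ci * y))%C.

Definition ex_Phi (eta0 : R) (F : C -> C) (w : C) : Prop :=
  exists v : C, is_pv (Phi_integrand F w) eta0 v.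

Definition Phi (eta0 : R) (F : C -> C) (w : C) : C :=
  iota (T := C_R_CompleteNormedModule) (is_pv (Phi_integrand F w) eta0).

(* Terms of the two sums over the nodes l of the transform side.  The factor
   e^(2 pi eta0 (w - l)) goes with l >= 0 and its inverse with l <= 0, so that
   both sums are dominated by the series E_plus, E_minus at |Im z| = eta0. *)
Definition dual_term_nonneg (eta0 : R) (h : R -> R -> C) (x : R) (w : C) : R -> C :=
  prime_term (fun l => h l x * (cexp (2 * PI * eta0 * (w - l)) / (w - l)))%C.

Definition dual_term_nonpos (eta0 : R) (h : R -> R -> C) (x : R) (w : C) : R -> C :=
  prime_term (fun l => h l x * (cexp (- (2 * PI * eta0) * (w - l)) / (w - l)))%C.

(* Main.v *)
Require Import Defs.
From Stdlib Require Import Lra Lia Psatz Classical ClassicalEpsilon Permutation FunctionalExtensionality PropExtensionality.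

(* Fix x and put f(u) = e^(-u^2) / (z - u).  Shifting the line of integration in
   the Fourier transform of f up or down by 2 eta0, according to the sign of the
   frequency, turns (c) with eps = 1 into
     e^(-z^2) E_+(x,z) = sum_t rho(t) e^(-t^2) / (z - t) + (holomorphic in |Im z| < 3/2 eta0)
   for Im z >= eta0, and the same right-hand side equals - e^(-z^2) E_-(x,z) for
   Im z <= - eta0; here rho(t) = g_t(x) for t in La, minus 1 at t = x.  By the
   identity theorem E_+ and - E_- are one meromorphic function on the strip, with
   simple poles at real points t of residue rho(t).
   Integrate e^(2 pi i z w) E_+(x,z) around [0,T] x [-eta0,eta0], with a principal
   value on the side through 0, and let T tend to infinity along the sequence of
   (e), with Im w large.  The residues give E*_+ and the Heaviside term, the
   horizontal sides, integrated term by term, give the two dual sums, and the side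
   through 0 gives Phi.  The reflected rectangle gives E*_- for - Im w large; both
   cases are run at once with a sign sig = 1 or -1.  The right-hand side is
   meromorphic in w, so the identity theorem and continuity extend the formulas to
   |Im w| >= nu0. *)

(** The obstacle is that the continuations in [theorem3] are total functions whose values at poles
    are arbitrary, while (e) bounds their values on whole vertical segments. Functions are therefore
    compared on punctured neighbourhoods, and pointwise only where one of them is known to be
    continuous; boundedness on a segment through a real point forces the residue there to vanish, so
    the abscissas of (e) carry no genuine pole. The multiples of eta0 leave room on both sides: the
    lines at height +-2 eta0 stay outside the working strip |Im z| < 3/2 eta0, and the strip
    overlaps the half-planes of (a) in bands of positive height, where the identity theorem can
    start. The value f(x) in (c) acts as one more node, with coefficient -1. Since E_- has residue
    -rho(t), that node yields the term +2 pi i e^(2 pi i x w) H(x). Index 0 counts one half alike in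
    the primed sums, in [heaviside] and in the principal value, so neither 0 in La nor x = 0 needs a
    separate formula. Large |Im w| is needed because the far side of the rectangle is of order e^((c
    - 2 pi |Im w|) T). *)

(** * Elementary inequalities for the complex modulus *)

Lemma Cmod_minus_sym (a b : C) : Cmod (a - b) = Cmod (b - a).
Proof. rewrite <- (Cmod_opp (b - a)). f_equal. ring. Qed.

Lemma Cmod_triangle3 (a b c : C) : Cmod (a - c) <= Cmod (a - b) + Cmod (b - c).
Proof. replace (a - c)%C with ((a - b) + (b - c))%C by ring. apply Cmod_triangle. Qed.

Lemma Cmod_triangle_minus (a b : C) : Cmod (a - b) <= Cmod a + Cmod b.
Proof. unfold Cminus. rewrite <- (Cmod_opp b). apply Cmod_triangle. Qed.

Lemma Cmod_triangle_rev (a b : C) : Cmod a - Cmod b <= Cmod (a - b).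
Proof.
  assert (H := Cmod_triangle (a - b) b).
  replace (a - b + b)%C with a in H by ring. lra.
Qed.

Lemma im_le_Cmod (c : C) : Rabs (Im c) <= Cmod c.
Proof.
  apply Rle_trans with (2 := Rmax_Cmod c). apply Rmax_r.
Qed.

Lemma Cmod_le_Rabs (c : C) : Cmod c <= Rabs (Re c) + Rabs (Im c).
Proof.
  destruct c as [a b]; simpl.
  replace (a, b) with (RtoC a + Ci * RtoC b)%C
    by (apply injective_projections; simpl; ring).
  eapply Rle_trans. apply Cmod_triangle.
  rewrite Cmod_mult, Cmod_Ci, !Cmod_R. lra.
Qed.

Lemma Cmod_sq (c : C) : Cmod c * Cmod c = Re c * Re c + Im c * Im c.
Proof. assert (H := Cmod2_alt c). simpl in H. lra. Qed.

Lemma Cminus_neq_0 (a b : C) : a <> b -> (a - b)%C <> RtoC 0.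
Proof.
  intros H E. apply H. replace a with ((a - b) + b)%C by ring. rewrite E. ring.
Qed.

(** Equalities between limits, sums and integrals are proved through this criterion: the distance of
    the two sides is estimated by every positive e. *)
Lemma Cmod_lt_0_eq (a b : C) : (forall e, 0 < e -> Cmod (a - b) <= e) -> a = b.
Proof.
  intros H. destruct (Req_dec (Cmod (a - b)) 0) as [E|E].
  - apply Cmod_eq_0 in E. replace a with ((a - b) + b)%C by ring. rewrite E; ring.
  - assert (0 <= Cmod (a - b)) by apply Cmod_ge_0.
    specialize (H (Cmod (a - b) / 2)). lra.
Qed.

Lemma Cmod_self (z : C) : Cmod (z - z) = 0.
Proof. replace (z - z)%C with (RtoC 0) by ring. apply Cmod_0. Qed.

Lemma exp_le (a b : R) : a <= b -> exp a <= exp b.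
Proof. intros [H | ->]. left; apply exp_increasing, H. apply Rle_refl. Qed.

Ltac split_min H H1 H2 :=
  assert (H1 := Rlt_le_trans _ _ _ H (Rmin_l _ _));
  assert (H2 := Rlt_le_trans _ _ _ H (Rmin_r _ _)).

(** * Continuity and complex differentiability *)

Definition ccont (f : C -> C) (z : C) : Prop :=
  forall e : R, 0 < e -> exists d : R, 0 < d /\
    forall y, Cmod (y - z) < d -> Cmod (f y - f z) < e.

(** Little-o form of differentiability: the increment is compared with e |y - z|, so y = z is no
    exception and no quotient is formed. *)
Definition cdiff (f : C -> C) (z l : C) : Prop :=
  forall e : R, 0 < e -> exists d : R, 0 < d /\
    forall y, Cmod (y - z) < d -> Cmod (f y - f z - l * (y - z)) <= e * Cmod (y - z).

Definition cder (f : C -> C) (z : C) : Prop := exists l, cdiff f z l.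

(** Bridge to the filter-based derivative in which [holomorphic_at] is stated. Both notions use
    balls of the same modulus, so only the order of a product differs. *)
Lemma is_derive_cdiff (f : C -> C) (z l : C) :
  @is_derive C_AbsRing C_NormedModule f z l <-> cdiff f z l.
Proof.
  split.
  - intros [_ H] e He.
    destruct (H z (fun P HP => HP) (mkposreal e He)) as [d Hd].
    exists d. split. apply d.
    intros y Hy. specialize (Hd y Hy).
    change (Cmod ((f y - f z) - (y - z) * l) <= e * Cmod (y - z)) in Hd.
    replace (l * (y - z))%C with ((y - z) * l)%C by ring. exact Hd.
  - intros H. split.
    + apply (is_linear_scal_l (K := C_AbsRing) (V := C_NormedModule) l).
    + intros x Hx.
      assert (Ex : z = x).
      { apply (is_filter_lim_locally_unique (K := C_AbsRing)
          (V := AbsRing_NormedModule C_AbsRing) z x). exact Hx. }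
      subst x. intros [e He].
      destruct (H e He) as [d [Hd HH]].
      exists (mkposreal d Hd). intros y Hy.
      specialize (HH y Hy).
      change (Cmod ((f y - f z) - (y - z) * l) <= e * Cmod (y - z)).
      replace ((y - z) * l)%C with (l * (y - z))%C by ring. exact HH.
Qed.

Lemma ex_derive_cder (f : C -> C) (z : C) :
  @ex_derive C_AbsRing C_NormedModule f z <-> cder f z.
Proof.
  split; intros [l H]; exists l; apply is_derive_cdiff; exact H.
Qed.

Lemma cdiff_ccont f z l : cdiff f z l -> ccont f z.
Proof.
  intros H e He. destruct (H 1 Rlt_0_1) as [d [Hd HH]].
  assert (Hl := Cmod_ge_0 l).
  exists (Rmin d (e / (2 + Cmod l))). split.
  { apply Rmin_pos; trivial. apply Rdiv_lt_0_compat; lra. }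
  intros y Hy.
  assert (H1 : Cmod (y - z) < d) by (eapply Rlt_le_trans; [exact Hy|apply Rmin_l]).
  assert (H2 : Cmod (y - z) < e / (2 + Cmod l)) by (eapply Rlt_le_trans; [exact Hy|apply Rmin_r]).
  specialize (HH y H1).
  replace (f y - f z)%C with ((f y - f z - l * (y - z)) + l * (y - z))%C by ring.
  eapply Rle_lt_trans. apply Cmod_triangle. rewrite Cmod_mult.
  apply Rlt_div_r in H2; [|lra].
  nra.
Qed.

Lemma cder_ccont f z : cder f z -> ccont f z.
Proof. intros [l H]. eapply cdiff_ccont, H. Qed.

Lemma ccont_bounded f z : ccont f z ->
  exists d, 0 < d /\ forall y, Cmod (y - z) < d -> Cmod (f y) <= Cmod (f z) + 1.
Proof.
  intros H. destruct (H 1 Rlt_0_1) as [d [Hd HH]]. exists d. split; trivial.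
  intros y Hy. specialize (HH y Hy).
  assert (T := Cmod_triangle_rev (f y) (f z)). lra.
Qed.

Lemma cdiff_const (c z : C) : cdiff (fun _ => c) z 0.
Proof.
  intros e He. exists 1. split. lra. intros y _.
  replace (c - c - 0 * (y - z))%C with (RtoC 0) by ring. rewrite Cmod_0.
  apply Rmult_le_pos. lra. apply Cmod_ge_0.
Qed.

Lemma cdiff_id (z : C) : cdiff (fun z => z) z 1.
Proof.
  intros e He. exists 1. split. lra. intros y _.
  replace (y - z - 1 * (y - z))%C with (RtoC 0) by ring. rewrite Cmod_0.
  apply Rmult_le_pos. lra. apply Cmod_ge_0.
Qed.

Lemma cdiff_plus f g z a b : cdiff f z a -> cdiff g z b ->
  cdiff (fun z => f z + g z)%C z (a + b).
Proof.
  intros Hf Hg e He.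
  destruct (Hf (e / 2)) as [d1 [P1 H1]]. lra.
  destruct (Hg (e / 2)) as [d2 [P2 H2]]. lra.
  exists (Rmin d1 d2). split. apply Rmin_pos; trivial.
  intros y Hy.
  specialize (H1 y (Rlt_le_trans _ _ _ Hy (Rmin_l _ _))).
  specialize (H2 y (Rlt_le_trans _ _ _ Hy (Rmin_r _ _))).
  replace (f y + g y - (f z + g z) - (a + b) * (y - z))%C with
    ((f y - f z - a * (y - z)) + (g y - g z - b * (y - z)))%C by ring.
  eapply Rle_trans. apply Cmod_triangle. lra.
Qed.

Lemma cdiff_mult f g z a b : cdiff f z a -> cdiff g z b ->
  cdiff (fun z => f z * g z)%C z (a * g z + f z * b).
Proof.
  intros Hf Hg e He.
  assert (F0 := Cmod_ge_0 (f z)). assert (G0 := Cmod_ge_0 (g z)).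
  assert (A0 := Cmod_ge_0 a).
  destruct (Hf (e / 3 / (Cmod (g z) + 1))) as [d1 [P1 H1]].
  { apply Rdiv_lt_0_compat; lra. }
  destruct (Hg (e / 3 / (Cmod (f z) + 1))) as [d2 [P2 H2]].
  { apply Rdiv_lt_0_compat; lra. }
  destruct (cdiff_ccont _ _ _ Hg (Rmin (e / 3 / (Cmod a + 1)) 1)) as [d3 [P3 H3]].
  { apply Rmin_pos. apply Rdiv_lt_0_compat; lra. lra. }
  exists (Rmin d1 (Rmin d2 d3)). split. repeat apply Rmin_pos; trivial.
  intros y Hy.
  split_min Hy Y1 Y2.
  specialize (H1 y Y1).
  specialize (H2 y (Rlt_le_trans _ _ _ Y2 (Rmin_l _ _))).
  specialize (H3 y (Rlt_le_trans _ _ _ Y2 (Rmin_r _ _))).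
  replace (f y * g y - f z * g z - (a * g z + f z * b) * (y - z))%C with
    ((f y - f z - a * (y - z)) * g y + (a * (y - z) * (g y - g z)
      + f z * (g y - g z - b * (y - z))))%C by ring.
  eapply Rle_trans. apply Cmod_triangle.
  eapply Rle_trans. apply Rplus_le_compat_l. apply Cmod_triangle.
  rewrite !Cmod_mult.
  set (t := Cmod (y - z)) in *.
  assert (T0 : 0 <= t) by apply Cmod_ge_0.
  assert (GY : Cmod (g y) <= Cmod (g z) + 1).
  { assert (X := Cmod_triangle_rev (g y) (g z)).
    assert (X' := Rlt_le_trans _ _ _ H3 (Rmin_r _ _)). lra. }
  assert (GZ := Rlt_le_trans _ _ _ H3 (Rmin_l _ _)).
  assert (K1 : Cmod (f y - f z - a * (y - z)) * Cmod (g y) <= e / 3 * t).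
  { eapply Rle_trans. apply Rmult_le_compat; try apply Cmod_ge_0. exact H1. exact GY.
    right. field. lra. }
  assert (K2 : Cmod a * t * Cmod (g y - g z) <= e / 3 * t).
  { apply Rlt_div_r in GZ; [|lra]. assert (Q := Cmod_ge_0 (g y - g z)). nra. }
  assert (K3 : Cmod (f z) * Cmod (g y - g z - b * (y - z)) <= e / 3 * t).
  { eapply Rle_trans. apply Rmult_le_compat_l. exact F0. exact H2.
    replace (e / 3 / (Cmod (f z) + 1) * t) with ((e / 3 * t) / (Cmod (f z) + 1)) by (field; lra).
    replace (Cmod (f z) * (e / 3 * t / (Cmod (f z) + 1)))
      with ((e / 3 * t) * (Cmod (f z) / (Cmod (f z) + 1))) by (field; lra).
    rewrite <- (Rmult_1_r (e / 3 * t)) at 2.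
    apply Rmult_le_compat_l. nra. apply Rle_div_l; lra. }
  lra.
Qed.

Lemma cdiff_inv (z : C) : z <> 0 -> cdiff Cinv z (- / (z * z)).
Proof.
  intros Hz e He. assert (P := proj1 (Cmod_gt_0 z) Hz).
  set (m := Cmod z) in *.
  exists (Rmin (m / 2) (e * m * m * m / 2)). split.
  { apply Rmin_pos. lra. assert (0 < m * m) by nra. assert (0 < m * m * m) by nra. nra. }
  intros y Hy.
  split_min Hy Y1 Y2.
  assert (Hm : m / 2 < Cmod y).
  { assert (X := Cmod_triangle_rev z y). rewrite Cmod_minus_sym in X. fold m in X. lra. }
  assert (Hy0 : y <> 0) by (apply Cmod_gt_0; lra).
  replace (/ y - / z - - / (z * z) * (y - z))%C with ((y - z) * ((y - z) * / (y * z * z)))%C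
    by (field; auto).
  rewrite !Cmod_mult, Cmod_inv, !Cmod_mult by (repeat apply Cmult_neq_0; trivial).
  fold m. set (t := Cmod (y - z)) in *.
  assert (0 <= t) by apply Cmod_ge_0.
  rewrite Rmult_comm. apply Rmult_le_compat_r; trivial.
  apply Rle_div_l.
  { apply Rmult_lt_0_compat; [apply Rmult_lt_0_compat|]; lra. }
  apply Rle_trans with (e * m * m * m / 2). lra. nra.
Qed.

Lemma cdiff_comp f g z a b : cdiff g z b -> cdiff f (g z) a ->
  cdiff (fun z => f (g z)) z (a * b).
Proof.
  intros Hg Hf e He.
  assert (A0 := Cmod_ge_0 a). assert (B0 := Cmod_ge_0 b).
  destruct (Hf (e / 2 / (Cmod b + 1))) as [d1 [P1 H1]].
  { apply Rdiv_lt_0_compat; lra. }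
  destruct (Hg (Rmin 1 (e / 2 / (Cmod a + 1)))) as [d2 [P2 H2]].
  { apply Rmin_pos. lra. apply Rdiv_lt_0_compat; lra. }
  destruct (cdiff_ccont _ _ _ Hg d1 P1) as [d3 [P3 H3]].
  exists (Rmin d2 d3). split. apply Rmin_pos; trivial.
  intros y Hy.
  specialize (H2 y (Rlt_le_trans _ _ _ Hy (Rmin_l _ _))).
  specialize (H3 y (Rlt_le_trans _ _ _ Hy (Rmin_r _ _))).
  specialize (H1 (g y) H3).
  replace (f (g y) - f (g z) - a * b * (y - z))%C with
    ((f (g y) - f (g z) - a * (g y - g z)) + a * (g y - g z - b * (y - z)))%C by ring.
  eapply Rle_trans. apply Cmod_triangle. rewrite Cmod_mult.
  set (t := Cmod (y - z)) in *. assert (T0 : 0 <= t) by apply Cmod_ge_0.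
  assert (G1 : Cmod (g y - g z) <= (Cmod b + 1) * t).
  { replace (g y - g z)%C with ((g y - g z - b * (y - z)) + b * (y - z))%C by ring.
    eapply Rle_trans. apply Cmod_triangle. rewrite Cmod_mult. fold t.
    assert (Q := Rmin_l 1 (e / 2 / (Cmod a + 1))).
    assert (Rmin 1 (e / 2 / (Cmod a + 1)) * t <= 1 * t) by (apply Rmult_le_compat_r; lra).
    lra. }
  assert (K1 : Cmod (f (g y) - f (g z) - a * (g y - g z)) <= e / 2 * t).
  { eapply Rle_trans. exact H1.
    eapply Rle_trans. apply Rmult_le_compat_l. apply Rlt_le, Rdiv_lt_0_compat; lra. exact G1.
    right. field. lra. }
  assert (K2 : Cmod a * Cmod (g y - g z - b * (y - z)) <= e / 2 * t).
  { assert (Q := Rmin_r 1 (e / 2 / (Cmod a + 1))).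
    apply Rle_trans with ((Cmod a + 1) * (e / 2 / (Cmod a + 1) * t)).
    2: right; field; lra.
    apply Rmult_le_compat; try apply Cmod_ge_0; try lra.
    eapply Rle_trans. exact H2. apply Rmult_le_compat_r; lra. }
  lra.
Qed.

Lemma cdiff_local f g z l r : 0 < r -> (forall y, Cmod (y - z) < r -> f y = g y) ->
  cdiff f z l -> cdiff g z l.
Proof.
  intros Hr E H e He. destruct (H e He) as [d [Hd HH]].
  exists (Rmin d r). split. apply Rmin_pos; trivial. intros y Hy.
  rewrite <- !E. apply HH. eapply Rlt_le_trans; [exact Hy|apply Rmin_l].
  rewrite Cmod_self; lra.
  eapply Rlt_le_trans; [exact Hy|apply Rmin_r].
Qed.

Lemma cder_local f g z r : 0 < r -> (forall y, Cmod (y - z) < r -> f y = g y) ->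
  cder f z -> cder g z.
Proof. intros Hr E [l H]. exists l. eapply cdiff_local; eauto. Qed.

Lemma cder_ext f g z : (forall y, f y = g y) -> cder f z -> cder g z.
Proof. intros E. apply (cder_local f g z 1). lra. auto. Qed.

Lemma cder_const c z : cder (fun _ => c) z.
Proof. eexists. apply cdiff_const. Qed.
Lemma cder_id z : cder (fun z => z) z.
Proof. eexists. apply cdiff_id. Qed.
Lemma cder_plus f g z : cder f z -> cder g z -> cder (fun z => f z + g z)%C z.
Proof. intros [a A] [b B]. eexists. apply cdiff_plus; eassumption. Qed.
Lemma cder_mult f g z : cder f z -> cder g z -> cder (fun z => f z * g z)%C z.
Proof. intros [a A] [b B]. eexists. apply cdiff_mult; eassumption. Qed.
Lemma cder_opp f z : cder f z -> cder (fun z => - f z)%C z.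
Proof.
  intros H. apply cder_ext with (fun z => (- (1)) * f z)%C. intros; ring.
  apply cder_mult; trivial. apply cder_const.
Qed.
Lemma cder_minus f g z : cder f z -> cder g z -> cder (fun z => f z - g z)%C z.
Proof. intros A B. apply cder_plus; trivial. apply cder_opp; trivial. Qed.
Lemma cder_comp f g z : cder g z -> cder f (g z) -> cder (fun z => f (g z)) z.
Proof. intros [a A] [b B]. eexists. eapply cdiff_comp; eassumption. Qed.
Lemma cder_inv f z : cder f z -> f z <> 0 -> cder (fun z => / f z)%C z.
Proof.
  intros A B. apply (cder_comp Cinv f); trivial. eexists. apply cdiff_inv; trivial.
Qed.
Lemma cder_div f g z : cder f z -> cder g z -> g z <> 0 -> cder (fun z => f z / g z)%C z.
Proof. intros A B D. apply cder_mult; trivial. apply cder_inv; trivial. Qed.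
Lemma cder_pow f z n : cder f z -> cder (fun z => f z ^ n)%C z.
Proof.
  intros H. induction n.
  - apply cder_ext with (fun _ => RtoC 1). reflexivity. apply cder_const.
  - apply cder_ext with (fun z => f z * f z ^ n)%C. reflexivity. apply cder_mult; trivial.
Qed.

(** * The exponential *)

Lemma cexp_plus a b : cexp (a + b) = (cexp a * cexp b)%C.
Proof.
  unfold cexp. apply injective_projections; simpl; rewrite exp_plus, ?cos_plus, ?sin_plus; unfold Re, Im; ring.
Qed.

Lemma cexp_0 : cexp 0 = 1.
Proof.
  unfold cexp. simpl. rewrite exp_0, cos_0, sin_0. apply injective_projections; simpl; ring.
Qed.

Lemma Cmod_cexp z : Cmod (cexp z) = exp (Re z).
Proof.
  assert (H := Cmod_sq (cexp z)). unfold cexp in *. simpl in *.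
  set (m := Cmod _) in *. assert (0 <= m) by apply Cmod_ge_0.
  assert (P := exp_pos (Re z)).
  assert (S := sin2_cos2 (Im z)). unfold Rsqr in S. unfold Re, Im in *.
  assert (E : m * m = exp (fst z) * exp (fst z)).
  { rewrite H. transitivity (exp (fst z) * exp (fst z) * (sin (snd z) * sin (snd z) + cos (snd z) * cos (snd z))).
    ring. rewrite S. ring. }
  apply Rsqr_inj; trivial. lra.
Qed.

Lemma cexp_neq_0 z : cexp z <> 0.
Proof. apply Cmod_gt_0. rewrite Cmod_cexp. apply exp_pos. Qed.

Lemma cexp_real (t : R) : cexp t = exp t.
Proof.
  unfold cexp. simpl. rewrite cos_0, sin_0. apply injective_projections; simpl; ring.
Qed.

Lemma derivable_pt_lim_eps f x l : derivable_pt_lim f x l ->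
  forall e, 0 < e -> exists d, 0 < d /\ forall h, Rabs h < d ->
    Rabs (f (x + h) - f x - l * h) <= e * Rabs h.
Proof.
  intros H e He. destruct (H e He) as [[d Hd] HH]. exists d. split; trivial.
  intros h Hh. destruct (Req_dec h 0) as [->|N].
  - rewrite Rplus_0_r. replace (f x - f x - l * 0) with 0 by ring. rewrite Rabs_R0. lra.
  - specialize (HH h N Hh).
    replace (f (x + h) - f x - l * h) with (((f (x + h) - f x) / h - l) * h) by (field; trivial).
    rewrite Rabs_mult. apply Rmult_le_compat_r. apply Rabs_pos. lra.
Qed.

Lemma cdiff_cexp_0 : cdiff cexp 0 1.
Proof.
  intros e He.
  (* The two coordinates of the remainder cost at most 4 k t and 5 k t, with t the modulus of the
     increment; t < k turns the product of two first-order terms, at most 4 t^2, into 4 k t. *)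
  set (k := Rmin 1 (e / 16)).
  assert (K0 : 0 < k) by (apply Rmin_pos; lra).
  assert (K1 : k <= 1) by apply Rmin_l. assert (K2 : k <= e / 16) by apply Rmin_r.
  destruct (derivable_pt_lim_eps _ _ _ (derivable_pt_lim_exp 0) k K0) as [d1 [P1 H1]].
  destruct (derivable_pt_lim_eps _ _ _ (derivable_pt_lim_sin 0) k K0) as [d2 [P2 H2]].
  destruct (derivable_pt_lim_eps _ _ _ (derivable_pt_lim_cos 0) k K0) as [d3 [P3 H3]].
  exists (Rmin (Rmin 1 k) (Rmin d1 (Rmin d2 d3))). split. repeat apply Rmin_pos; lra.
  intros [a b] Hy. replace ((a, b) - 0)%C with (a, b) in *
    by (apply injective_projections; simpl; ring).
  rewrite cexp_0.
  assert (Ha := re_le_Cmod (a, b)). assert (Hb := im_le_Cmod (a, b)). simpl in Ha, Hb.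
  set (t := Cmod (a, b)) in *.
  assert (t < 1 /\ t < k /\ t < d1 /\ t < d2 /\ t < d3) as (T1 & Tk & T2 & T3 & T4).
  { repeat match goal with |- _ /\ _ => split end;
    (eapply Rlt_le_trans; [exact Hy|]).
    eapply Rle_trans; [apply Rmin_l|apply Rmin_l].
    eapply Rle_trans; [apply Rmin_l|apply Rmin_r].
    eapply Rle_trans; [apply Rmin_r|apply Rmin_l].
    eapply Rle_trans; [apply Rmin_r|]. eapply Rle_trans; [apply Rmin_r|apply Rmin_l].
    eapply Rle_trans; [apply Rmin_r|]. eapply Rle_trans; [apply Rmin_r|apply Rmin_r]. }
  specialize (H1 a ltac:(lra)). specialize (H2 b ltac:(lra)). specialize (H3 b ltac:(lra)).
  rewrite Rplus_0_l in H1, H2, H3. rewrite exp_0 in H1. rewrite sin_0, cos_0 in H2.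
  rewrite cos_0, sin_0 in H3.
  replace (Rabs (cos b - 1 - - 0 * b)) with (Rabs (cos b - 1)) in H3 by (f_equal; ring).
  replace (Rabs (sin b - 0 - 1 * b)) with (Rabs (sin b - b)) in H2 by (f_equal; ring).
  replace (Rabs (exp a - 1 - 1 * a)) with (Rabs (exp a - 1 - a)) in H1 by (f_equal; ring).
  assert (T0 : 0 <= t) by apply Cmod_ge_0.
  assert (KH2 : Rabs (sin b - b) <= k * t) by nra.
  assert (EA : Rabs (exp a - 1) <= 2 * t).
  { replace (exp a - 1) with ((exp a - 1 - a) + a) by ring.
    eapply Rle_trans. apply Rabs_triang. nra. }
  assert (EB : exp a <= 3).
  { assert (X := Rle_abs (exp a - 1)). lra. }
  assert (E0 := exp_pos a).
  eapply Rle_trans. apply Cmod_le_Rabs. unfold cexp. simpl.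
  assert (R1 : Rabs (exp a * cos b - 1 - a) <= 4 * k * t).
  { replace (exp a * cos b - 1 - a) with (exp a * (cos b - 1) + (exp a - 1 - a)) by ring.
    eapply Rle_trans. apply Rabs_triang. rewrite Rabs_mult, (Rabs_pos_eq (exp a)) by lra.
    assert (Q := Rabs_pos (cos b - 1)). nra. }
  assert (R2 : Rabs (exp a * sin b - b) <= 5 * k * t).
  { replace (exp a * sin b - b) with ((exp a - 1) * sin b + (sin b - b)) by ring.
    eapply Rle_trans. apply Rabs_triang. rewrite Rabs_mult.
    assert (Q : Rabs (sin b) <= 2 * t).
    { replace (sin b) with ((sin b - b) + b) by ring. eapply Rle_trans. apply Rabs_triang. nra. }
    assert (Q2 := Rabs_pos (sin b)). assert (Q3 := Rabs_pos (exp a - 1)).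
    assert (Rabs (exp a - 1) * Rabs (sin b) <= (2 * t) * (2 * t)) by (apply Rmult_le_compat; lra).
    assert (t * t <= k * t) by (apply Rmult_le_compat_r; lra). lra. }
  match goal with |- Rabs ?u + Rabs ?v <= _ =>
    replace u with (exp a * cos b - 1 - a) by ring;
    replace v with (exp a * sin b - b) by ring end.
  assert (9 * k * t <= e * t) by (apply Rmult_le_compat_r; lra). lra.
Qed.

Lemma cder_cexp f z : cder f z -> cder (fun z => cexp (f z)) z.
Proof.
  intros H. apply (cder_comp cexp f); trivial.
  apply cder_ext with (fun y => cexp (f z) * cexp (y - f z))%C.
  { intros y. rewrite <- cexp_plus. f_equal. ring. }
  apply cder_mult. apply cder_const.
  apply (cder_comp cexp (fun y => y - f z)%C).
  apply cder_minus. apply cder_id. apply cder_const.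
  replace (f z - f z)%C with (RtoC 0) by ring. eexists. apply cdiff_cexp_0.
Qed.

(** * Integrals of complex functions of a real variable *)

Definition rcont (f : R -> C) (t : R) : Prop :=
  forall e : R, 0 < e -> exists d : R, 0 < d /\
    forall s, Rabs (s - t) < d -> Cmod (f s - f t) < e.

(** Integration sees C as a real vector space ([C_R_NormedModule]), whereas the derivatives above
    see it as a module over itself. *)
Definition is_CI (f : R -> C) (a b : R) (v : C) : Prop := @is_RInt C_R_NormedModule f a b v.
Definition ex_CI (f : R -> C) (a b : R) : Prop := exists v, is_CI f a b v.
Definition CI (f : R -> C) (a b : R) : C := RInt (V := C_R_CompleteNormedModule) f a b.

Lemma norm_CR (z : C) : @norm _ C_R_NormedModule z = Cmod z.
Proof. symmetry. apply Cmod_norm. Qed.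

Lemma rcont_continuous f t : rcont f t -> @continuous R_UniformSpace C_R_NormedModule f t.
Proof.
  intros H P [[e He] HP].
  destruct (H e He) as [d [Hd HH]].
  exists (mkposreal d Hd). intros s Hs. apply HP.
  apply (norm_compat1 (V := C_R_NormedModule)). rewrite norm_CR. apply HH. exact Hs.
Qed.

Lemma is_CI_unique f a b v : is_CI f a b v -> CI f a b = v.
Proof. intros H. apply (is_RInt_unique (V := C_R_CompleteNormedModule)). exact H. Qed.

Lemma CI_correct f a b : ex_CI f a b -> is_CI f a b (CI f a b).
Proof. intros H. apply (RInt_correct (V := C_R_CompleteNormedModule)). exact H. Qed.

Lemma ex_CI_cont f a b : a <= b -> (forall t, a <= t <= b -> rcont f t) -> ex_CI f a b.
Proof.
  intros Hab H. apply (ex_RInt_continuous (V := C_R_CompleteNormedModule)).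
  intros t Ht. rewrite Rmin_left, Rmax_right in Ht by lra. apply rcont_continuous; auto.
Qed.

Lemma is_CI_plus f g a b u v : is_CI f a b u -> is_CI g a b v ->
  is_CI (fun t => f t + g t)%C a b (u + v).
Proof. intros; apply (is_RInt_plus (V := C_R_NormedModule)); trivial. Qed.

Lemma is_CI_minus f g a b u v : is_CI f a b u -> is_CI g a b v ->
  is_CI (fun t => f t - g t)%C a b (u - v).
Proof. intros; apply (is_RInt_minus (V := C_R_NormedModule)); trivial. Qed.

Lemma is_CI_ext f g a b v : a <= b -> (forall t, a < t < b -> f t = g t) ->
  is_CI f a b v -> is_CI g a b v.
Proof.
  intros Hab E. apply (is_RInt_ext (V := C_R_NormedModule)).
  rewrite Rmin_left, Rmax_right by lra. exact E.
Qed.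

Lemma is_CI_Chasles f a b c u v : is_CI f a b u -> is_CI f b c v -> is_CI f a c (u + v).
Proof. apply (is_RInt_Chasles (V := C_R_NormedModule)). Qed.

Lemma is_CI_swap f a b v : is_CI f a b v -> is_CI f b a (- v).
Proof. apply (is_RInt_swap (V := C_R_NormedModule)). Qed.

(** Complex scalars act outside the real module structure, so linearity is obtained from the real
    and imaginary parts of f. *)
Lemma is_CI_scal (c : C) f a b v : is_CI f a b v -> is_CI (fun t => c * f t)%C a b (c * v).
Proof.
  intros H.
  assert (H1 := is_RInt_fct_extend_fst (U := R_NormedModule) (V := R_NormedModule) _ _ _ _ H).
  assert (H2 := is_RInt_fct_extend_snd (U := R_NormedModule) (V := R_NormedModule) _ _ _ _ H).
  apply (is_RInt_fct_extend_pair (U := R_NormedModule) (V := R_NormedModule)); simpl.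
  - apply (is_RInt_minus (V := R_NormedModule)).
    apply (is_RInt_scal (V := R_NormedModule) _ _ _ (fst c)). exact H1.
    apply (is_RInt_scal (V := R_NormedModule) _ _ _ (snd c)). exact H2.
  - apply (is_RInt_plus (V := R_NormedModule)).
    apply (is_RInt_scal (V := R_NormedModule) _ _ _ (fst c)). exact H2.
    apply (is_RInt_scal (V := R_NormedModule) _ _ _ (snd c)). exact H1.
Qed.

Lemma is_CI_real f a b v : is_RInt f a b v -> is_CI (fun t => RtoC (f t)) a b (RtoC v).
Proof.
  intros H. apply (is_RInt_fct_extend_pair (U := R_NormedModule) (V := R_NormedModule)); simpl.
  exact H.
  assert (X := is_RInt_const (V := R_NormedModule) a b 0).
  change (scal (b - a) 0) with ((b - a) * 0) in X. rewrite Rmult_0_r in X. exact X.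
Qed.

Lemma is_CI_const (c : C) a b : is_CI (fun _ => c) a b (RtoC (b - a) * c).
Proof.
  assert (X := is_RInt_const (V := C_R_NormedModule) a b c).
  replace (RtoC (b - a) * c)%C with (@scal _ C_R_NormedModule (b - a) c). exact X.
  apply injective_projections; simpl; unfold scal; simpl; unfold mult; simpl; ring.
Qed.

Lemma is_CI_bound f a b v M : a <= b -> (forall t, a <= t <= b -> Cmod (f t) <= M) ->
  is_CI f a b v -> Cmod v <= (b - a) * M.
Proof.
  intros Hab H I. rewrite Cmod_norm.
  apply (norm_RInt_le_const (V := C_R_NormedModule) f a b v M Hab); trivial.
  intros t Ht. rewrite norm_CR. auto.
Qed.

Lemma is_CI_bound_fun f g a b v w : a <= b -> (forall t, a <= t <= b -> Cmod (f t) <= g t) ->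
  is_CI f a b v -> is_RInt g a b w -> Cmod v <= w.
Proof.
  intros Hab H I J. rewrite Cmod_norm.
  apply (norm_RInt_le (V := C_R_NormedModule) f g a b v w Hab); trivial.
  intros t Ht. rewrite norm_CR. auto.
Qed.

Lemma CI_ext f g a b : a <= b -> (forall t, a < t < b -> f t = g t) -> CI f a b = CI g a b.
Proof.
  intros Hab E. apply (RInt_ext (V := C_R_CompleteNormedModule)).
  rewrite Rmin_left, Rmax_right by lra. exact E.
Qed.

Lemma is_CI_comp_lin f u v a b l : is_CI f (u * a + v) (u * b + v) l ->
  is_CI (fun t => RtoC u * f (u * t + v)%R)%C a b l.
Proof.
  intros H. apply (is_RInt_comp_lin (V := C_R_NormedModule)) in H.
  eapply (is_RInt_ext (V := C_R_NormedModule)); [|exact H].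
  intros t _. apply injective_projections; simpl; unfold scal; simpl; unfold mult; simpl; ring.
Qed.

Lemma ccont_rcont f (g : R -> C) t : ccont f (g t) -> rcont g t -> rcont (fun t => f (g t)) t.
Proof.
  intros Hf Hg e He. destruct (Hf e He) as [d [Hd H1]].
  destruct (Hg d Hd) as [d' [Hd' H2]]. exists d'. split; trivial. intros s Hs. auto.
Qed.

Lemma rcont_hor c t : rcont (fun t => (t, c) : C) t.
Proof.
  intros e He. exists e. split; trivial. intros s Hs.
  replace ((s, c) - (t, c))%C with (RtoC (s - t)) by (apply injective_projections; simpl; ring).
  rewrite Cmod_R. exact Hs.
Qed.

Lemma rcont_ver c t : rcont (fun t => (c, t) : C) t.
Proof.
  intros e He. exists e. split; trivial. intros s Hs.
  replace ((c, s) - (c, t))%C with (Ci * RtoC (s - t))%C by (apply injective_projections; simpl; ring).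
  rewrite Cmod_mult, Cmod_Ci, Cmod_R. lra.
Qed.

Lemma rcont_cder_hor f c t : cder f (t, c) -> rcont (fun t => f (t, c)) t.
Proof. intros H. apply (ccont_rcont f (fun t => (t, c))). apply cder_ccont, H. apply rcont_hor. Qed.

Lemma rcont_cder_ver f c t : cder f (c, t) -> rcont (fun t => f (c, t)) t.
Proof. intros H. apply (ccont_rcont f (fun t => (c, t))). apply cder_ccont, H. apply rcont_ver. Qed.

Lemma rcont_const c t : rcont (fun _ => c) t.
Proof.
  intros e He. exists 1. split. lra. intros. rewrite Cmod_self; lra.
Qed.

Lemma rcont_plus f g t : rcont f t -> rcont g t -> rcont (fun t => f t + g t)%C t.
Proof.
  intros Hf Hg e He. destruct (Hf (e / 2)) as [d1 [P1 H1]]. lra.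
  destruct (Hg (e / 2)) as [d2 [P2 H2]]. lra.
  exists (Rmin d1 d2). split. apply Rmin_pos; trivial. intros s Hs.
  specialize (H1 s (Rlt_le_trans _ _ _ Hs (Rmin_l _ _))).
  specialize (H2 s (Rlt_le_trans _ _ _ Hs (Rmin_r _ _))).
  replace (f s + g s - (f t + g t))%C with ((f s - f t) + (g s - g t))%C by ring.
  eapply Rle_lt_trans. apply Cmod_triangle. lra.
Qed.

Lemma rcont_mult f g t : rcont f t -> rcont g t -> rcont (fun t => f t * g t)%C t.
Proof.
  intros Hf Hg e He.
  assert (F0 := Cmod_ge_0 (f t)). assert (G0 := Cmod_ge_0 (g t)).
  destruct (Hf (e / 2 / (Cmod (g t) + 1))) as [d1 [P1 H1]]. apply Rdiv_lt_0_compat; lra.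
  destruct (Hg (Rmin 1 (e / 2 / (Cmod (f t) + 1)))) as [d2 [P2 H2]].
  apply Rmin_pos. lra. apply Rdiv_lt_0_compat; lra.
  exists (Rmin d1 d2). split. apply Rmin_pos; trivial. intros s Hs.
  specialize (H1 s (Rlt_le_trans _ _ _ Hs (Rmin_l _ _))).
  specialize (H2 s (Rlt_le_trans _ _ _ Hs (Rmin_r _ _))).
  split_min H2 H3 H4.
  replace (f s * g s - f t * g t)%C with ((f s - f t) * g s + f t * (g s - g t))%C by ring.
  eapply Rle_lt_trans. apply Cmod_triangle. rewrite !Cmod_mult.
  assert (T := Cmod_triangle_rev (g s) (g t)).
  apply Rlt_div_r in H1; [|lra]. apply Rlt_div_r in H4; [|lra].
  assert (Q1 := Cmod_ge_0 (f s - f t)). assert (Q2 := Cmod_ge_0 (g s - g t)).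
  nra.
Qed.

(** * Cauchy's theorem on rectangles *)

Definition rect (a b c d : R) (z : C) : Prop := a <= fst z <= b /\ c <= snd z <= d.

Definition rbd (a b c d : R) (z : C) : Prop :=
  rect a b c d z /\ (fst z = a \/ fst z = b \/ snd z = c \/ snd z = d).

(** Counterclockwise contour integral: bottom, right, top, left, with dz = i dt on the vertical
    sides. *)
Definition rint (f : C -> C) (a b c d : R) : C :=
  (CI (fun t => f (t, c)) a b + Ci * CI (fun t => f (b, t)) c d
   - CI (fun t => f (t, d)) a b - Ci * CI (fun t => f (a, t)) c d)%C.

Ltac split5 := split; [|split; [|split; [|split]]].

(** Continuity in the plane, required at boundary points only: poles in the interior are
    permitted. *)
Definition bcont (f : C -> C) (a b c d : R) : Prop := forall z, rbd a b c d z -> ccont f z.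

Definition hedge (f : C -> C) (a b c : R) : Prop := ex_CI (fun t => f (t, c)) a b.
Definition vedge (f : C -> C) (a c d : R) : Prop := ex_CI (fun t => f (a, t)) c d.

Lemma hedge_cont f a b c : a <= b -> (forall t, a <= t <= b -> ccont f (t, c)) -> hedge f a b c.
Proof.
  intros H K. apply ex_CI_cont; trivial. intros t Ht.
  apply (ccont_rcont f (fun t => (t, c))); auto. apply rcont_hor.
Qed.

Lemma vedge_cont f a c d : c <= d -> (forall t, c <= t <= d -> ccont f (a, t)) -> vedge f a c d.
Proof.
  intros H K. apply ex_CI_cont; trivial. intros t Ht.
  apply (ccont_rcont f (fun t => (a, t))); auto. apply rcont_ver.
Qed.

Lemma bcont_edges f a b c d : a <= b -> c <= d -> bcont f a b c d ->
  hedge f a b c /\ hedge f a b d /\ vedge f a c d /\ vedge f b c d.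
Proof.
  intros H K B. split; [|split; [|split]];
  [apply hedge_cont|apply hedge_cont|apply vedge_cont|apply vedge_cont]; trivial; intros t Ht;
  apply B; split; unfold rect; simpl; lra.
Qed.

(** Relational form recording the four side integrals: linearity and bounds transfer side by side
    without reproving integrability. *)
Definition is_rint (f : C -> C) (a b c d : R) (v : C) : Prop :=
  exists v1 v2 v3 v4, is_CI (fun t => f (t, c)) a b v1 /\ is_CI (fun t => f (b, t)) c d v2 /\
    is_CI (fun t => f (t, d)) a b v3 /\ is_CI (fun t => f (a, t)) c d v4 /\
    v = (v1 + Ci * v2 - v3 - Ci * v4)%C.

Lemma is_rint_unique f a b c d v : is_rint f a b c d v -> rint f a b c d = v.
Proof.
  intros (v1 & v2 & v3 & v4 & H1 & H2 & H3 & H4 & ->). unfold rint.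
  apply is_CI_unique in H1, H2, H3, H4. rewrite H1, H2, H3, H4. reflexivity.
Qed.

Lemma rint_correct f a b c d : a <= b -> c <= d -> bcont f a b c d ->
  is_rint f a b c d (rint f a b c d).
Proof.
  intros H K B. destruct (bcont_edges f a b c d H K B) as (E1 & E2 & E3 & E4).
  eexists _, _, _, _. split5; try reflexivity; apply CI_correct; assumption.
Qed.

Lemma is_rint_plus f g a b c d u v : is_rint f a b c d u -> is_rint g a b c d v ->
  is_rint (fun z => f z + g z)%C a b c d (u + v).
Proof.
  intros (v1 & v2 & v3 & v4 & H1 & H2 & H3 & H4 & ->)
    (u1 & u2 & u3 & u4 & K1 & K2 & K3 & K4 & ->).
  exists (v1 + u1)%C, (v2 + u2)%C, (v3 + u3)%C, (v4 + u4)%C.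
  split5; [apply (is_CI_plus _ _ _ _ _ _ H1 K1)|apply (is_CI_plus _ _ _ _ _ _ H2 K2)|apply (is_CI_plus _ _ _ _ _ _ H3 K3)|apply (is_CI_plus _ _ _ _ _ _ H4 K4)|]. ring.
Qed.

Lemma is_rint_scal k f a b c d u : is_rint f a b c d u ->
  is_rint (fun z => k * f z)%C a b c d (k * u).
Proof.
  intros (v1 & v2 & v3 & v4 & H1 & H2 & H3 & H4 & ->).
  exists (k * v1)%C, (k * v2)%C, (k * v3)%C, (k * v4)%C.
  split5; [apply (is_CI_scal k _ _ _ _ H1)|apply (is_CI_scal k _ _ _ _ H2)|apply (is_CI_scal k _ _ _ _ H3)|apply (is_CI_scal k _ _ _ _ H4)|]. ring.
Qed.

Lemma is_rint_ext f g a b c d v : a <= b -> c <= d ->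
  (forall z, rbd a b c d z -> f z = g z) -> is_rint f a b c d v -> is_rint g a b c d v.
Proof.
  intros H K E (v1 & v2 & v3 & v4 & H1 & H2 & H3 & H4 & ->).
  exists v1, v2, v3, v4.
  split5; trivial;
  [revert H1|revert H2|revert H3|revert H4]; apply is_CI_ext; trivial; intros t Ht; simpl; apply E;
    split; unfold rect; simpl; lra.
Qed.

Lemma is_rint_minus f g a b c d u v : is_rint f a b c d u -> is_rint g a b c d v ->
  is_rint (fun z => f z - g z)%C a b c d (u - v).
Proof.
  intros H K. apply (is_rint_scal (- (1))) in K.
  replace (u - v)%C with (u + - (1) * v)%C by ring.
  assert (X := is_rint_plus _ _ _ _ _ _ _ _ H K). simpl in X.
  eapply eq_ind with (P := fun F => is_rint F a b c d _). exact X.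
  apply functional_extensionality. intros; ring.
Qed.

Lemma is_rint_bound f a b c d v M : a <= b -> c <= d ->
  (forall z, rbd a b c d z -> Cmod (f z) <= M) -> is_rint f a b c d v ->
  Cmod v <= 2 * ((b - a) + (d - c)) * M.
Proof.
  intros H K E (v1 & v2 & v3 & v4 & H1 & H2 & H3 & H4 & ->).
  apply is_CI_bound with (M := M) in H1, H2, H3, H4; trivial;
   try (intros t Ht; apply E; split; unfold rect; simpl; lra).
  replace (v1 + Ci * v2 - v3 - Ci * v4)%C with ((v1 - v3) + Ci * (v2 - v4))%C by ring.
  eapply Rle_trans. apply Cmod_triangle.
  rewrite Cmod_mult, Cmod_Ci.
  assert (T1 := Cmod_triangle_minus v1 v3). assert (T2 := Cmod_triangle_minus v2 v4). lra.
Qed.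

Lemma rint_split_v f a m b c d : a <= m <= b -> c <= d ->
  bcont f a m c d -> bcont f m b c d ->
  rint f a b c d = (rint f a m c d + rint f m b c d)%C.
Proof.
  intros H K B1 B2. 
  destruct (rint_correct f a m c d ltac:(lra) K B1) as (v1 & v2 & v3 & v4 & H1 & H2 & H3 & H4 & ->).
  destruct (rint_correct f m b c d ltac:(lra) K B2) as (u1 & u2 & u3 & u4 & K1 & K2 & K3 & K4 & ->).
  apply is_rint_unique.
  assert (E : v2 = u4). { apply is_CI_unique in H2, K4. congruence. }
  exists (v1 + u1)%C, u2, (v3 + u3)%C, v4.
  split5; trivial; try (eapply is_CI_Chasles; eassumption).
  subst. ring.
Qed.

Lemma rint_split_h f a b c m d : a <= b -> c <= m <= d ->
  bcont f a b c m -> bcont f a b m d ->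
  rint f a b c d = (rint f a b c m + rint f a b m d)%C.
Proof.
  intros H K B1 B2. 
  destruct (rint_correct f a b c m H ltac:(lra) B1) as (v1 & v2 & v3 & v4 & H1 & H2 & H3 & H4 & ->).
  destruct (rint_correct f a b m d H ltac:(lra) B2) as (u1 & u2 & u3 & u4 & K1 & K2 & K3 & K4 & ->).
  apply is_rint_unique.
  assert (E : v3 = u1). { apply is_CI_unique in H3, K1. congruence. }
  exists v1, (v2 + u2)%C, u3, (v4 + u4)%C.
  split5; trivial; try (eapply is_CI_Chasles; eassumption).
  subst. ring.
Qed.

Lemma is_RInt_id a b : is_RInt (fun t => t) a b ((b * b - a * a) / 2).
Proof.
  replace ((b * b - a * a) / 2) with (@minus R_AbelianGroup (b * b / 2) (a * a / 2))
    by (unfold minus, plus, opp; simpl; field).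
  apply (is_RInt_derive (V := R_CompleteNormedModule) (fun t => t * t / 2)).
  - intros x _. auto_derive; trivial. field.
  - intros x _. apply continuous_id.
Qed.

(** Direct computation; affine functions are the part subtracted from f in Goursat's argument. *)
Lemma is_rint_affine k l a b c d : is_rint (fun z => k + l * z)%C a b c d 0.
Proof.
  replace (RtoC 0) with ((k * 0) + l * 0)%C by ring.
  assert (I0 : is_rint (fun _ => RtoC 1) a b c d 0).
  { exists (RtoC (b - a) * 1)%C, (RtoC (d - c) * 1)%C, (RtoC (b - a) * 1)%C, (RtoC (d - c) * 1)%C.
    split5; try apply is_CI_const. ring. }
  assert (Hh : forall c, is_CI (fun t => (t, c)) a b ((b * b - a * a) / 2, (b - a) * c)).
  { intros e. apply (is_RInt_fct_extend_pair (U := R_NormedModule) (V := R_NormedModule)); simpl.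
    apply is_RInt_id. apply (is_RInt_const (V := R_NormedModule)). }
  assert (Hv : forall a, is_CI (fun t => (a, t)) c d ((d - c) * a, (d * d - c * c) / 2)).
  { intros e. apply (is_RInt_fct_extend_pair (U := R_NormedModule) (V := R_NormedModule)); simpl.
    apply (is_RInt_const (V := R_NormedModule)). apply is_RInt_id. }
  assert (I1 : is_rint (fun z => z) a b c d 0).
  { eexists _, _, _, _. split5; try apply Hh; try apply Hv.
    apply injective_projections; simpl; field. }
  assert (X := is_rint_plus _ _ _ _ _ _ _ _ (is_rint_scal k _ _ _ _ _ _ I0) (is_rint_scal l _ _ _ _ _ _ I1)).
  eapply eq_ind with (P := fun F => is_rint F a b c d _). exact X.
  apply functional_extensionality. intros; simpl; ring.
Qed.

(** Left endpoints increase and right endpoints decrease; the supremum of the left endpoints lies in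
    every interval. *)
Lemma nested_limit (u : nat -> R) (L : R) : 0 <= L ->
  (forall n, u n <= u (S n) /\ u (S n) + L / 2 ^ (S n) <= u n + L / 2 ^ n) ->
  exists x, forall n, u n <= x <= u n + L / 2 ^ n.
Proof.
  intros HL H.
  assert (P : forall n, 0 <= L / 2 ^ n).
  { intros n. apply Rmult_le_pos; trivial. left. apply Rinv_0_lt_compat, pow_lt. lra. }
  assert (M : forall n k, u n <= u (n + k)%nat /\ u (n + k)%nat + L / 2 ^ (n + k) <= u n + L / 2 ^ n).
  { intros n k. induction k. rewrite Nat.add_0_r. lra.
    rewrite Nat.add_succ_r. specialize (H (n + k)%nat). lra. }
  assert (B : forall n m, u m <= u n + L / 2 ^ n).
  { intros n m. destruct (Nat.le_ge_cases n m) as [Q|Q].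
    - replace m with (n + (m - n))%nat by lia. specialize (M n (m - n)%nat).
      specialize (P (n + (m - n))%nat). lra.
    - specialize (M m (n - m)%nat). replace (m + (n - m))%nat with n in M by lia.
      specialize (P n). lra. }
  destruct (completeness (fun x => exists n, x = u n)) as [x [X1 X2]].
  - exists (u 0%nat + L / 2 ^ 0). intros y [n ->]. apply B.
  - exists (u 0%nat), 0%nat. trivial.
  - exists x. intros n. split. apply X1. eauto. apply X2. intros y [m ->]. apply B.
Qed.

(** Bisection. If P failed, one of the four quarters would fail again and again; the nested failing
    rectangles shrink to a point p, and the local hypothesis at p contradicts the failure of a small
    one. *)
Lemma rect_induction (P : R -> R -> R -> R -> Prop) (a c L H : R) :
  0 <= L -> 0 <= H ->
  (forall a' c' L' H', 0 <= L' -> 0 <= H' -> a <= a' -> a' + L' <= a + L -> c <= c' -> c' + H' <= c + H ->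
    P a' c' (L' / 2) (H' / 2) -> P (a' + L' / 2) c' (L' / 2) (H' / 2) ->
    P a' (c' + H' / 2) (L' / 2) (H' / 2) -> P (a' + L' / 2) (c' + H' / 2) (L' / 2) (H' / 2) ->
    P a' c' L' H') ->
  (forall p : C, a <= fst p <= a + L -> c <= snd p <= c + H -> exists e, 0 < e /\
    forall a' c' L' H', 0 <= L' -> 0 <= H' -> a <= a' -> a' + L' <= a + L -> c <= c' -> c' + H' <= c + H ->
      a' <= fst p <= a' + L' -> c' <= snd p <= c' + H' -> L' + H' < e -> P a' c' L' H') ->
  P a c L H.
Proof.
  intros HL HH Q Lc. apply NNPP. intros NP.
  set (bad := fun n (s : R * R) => ~ P (fst s) (snd s) (L / 2 ^ n) (H / 2 ^ n)).
  set (D := fun n (s s' : R * R) => bad (S n) s' /\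
     (fst s' = fst s \/ fst s' = fst s + L / 2 ^ (S n)) /\ (snd s' = snd s \/ snd s' = snd s + H / 2 ^ (S n))).
  set (inn := fun n (s : R * R) => a <= fst s /\ fst s + L / 2 ^ n <= a + L /\ c <= snd s /\ snd s + H / 2 ^ n <= c + H).
  assert (PL : forall n, 0 <= L / 2 ^ n).
  { intros n. apply Rmult_le_pos; trivial. left. apply Rinv_0_lt_compat, pow_lt. lra. }
  assert (PH : forall n, 0 <= H / 2 ^ n).
  { intros n. apply Rmult_le_pos; trivial. left. apply Rinv_0_lt_compat, pow_lt. lra. }
  assert (HS : forall n x, x / 2 ^ S n = x / 2 ^ n / 2).
  { intros n x. simpl. field. apply pow_nonzero. lra. }
  assert (EX : forall n s, bad n s -> inn n s -> exists s', D n s s').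
  { intros n s B (I1 & I2 & I3 & I4). apply NNPP. intros N. apply B.
    assert (A : forall s', (fst s' = fst s \/ fst s' = fst s + L / 2 ^ (S n)) ->
       (snd s' = snd s \/ snd s' = snd s + H / 2 ^ (S n)) ->
       P (fst s') (snd s') (L / 2 ^ S n) (H / 2 ^ S n)).
    { intros s' F1 F2. apply NNPP. intros NN. apply N. exists s'. split; [exact NN|tauto]. }
    apply Q; trivial; rewrite <- !HS.
    apply (A (fst s, snd s)); simpl; tauto.
    apply (A (fst s + L / 2 ^ S n, snd s)); simpl; tauto.
    apply (A (fst s, snd s + H / 2 ^ S n)); simpl; tauto.
    apply (A (fst s + L / 2 ^ S n, snd s + H / 2 ^ S n)); simpl; tauto. }
  (* Dependent choice of a failing quarter by Hilbert's epsilon; [s n] is the lower left corner at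
     stage n. *)
  set (nxt := fun n s => epsilon (inhabits s) (D n s)).
  set (s := fix s n := match n with O => (a, c) | S m => nxt m (s m) end).
  assert (IN : forall n, bad n (s n) /\ inn n (s n)).
  { induction n as [|n [B I]].
    - split. unfold bad. simpl. rewrite !Rdiv_1_r. exact NP. unfold inn; simpl. lra.
    - assert (E := epsilon_spec (inhabits (s n)) _ (EX n _ B I)).
      change (epsilon (inhabits (s n)) (D n (s n))) with (s (S n)) in E.
      destruct E as (E1 & E2 & E3). split; trivial.
      unfold inn in *. assert (X1 := PL (S n)). assert (X2 := PH (S n)).
      rewrite !HS in *. lra. }
  assert (ST : forall n, D n (s n) (s (S n))).
  { intros n. destruct (IN n) as [B I]. exact (epsilon_spec (inhabits (s n)) _ (EX n _ B I)). }
  destruct (nested_limit (fun n => fst (s n)) L HL) as [px Hx].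
  { intros n. destruct (ST n) as (_ & E & _). assert (X1 := PL (S n)). rewrite !HS in *. lra. }
  destruct (nested_limit (fun n => snd (s n)) H HH) as [py Hy].
  { intros n. destruct (ST n) as (_ & _ & E). assert (X1 := PH (S n)). rewrite !HS in *. lra. }
  destruct (Lc (px, py)) as [e [He LL]].
  { simpl. specialize (Hx 0%nat). simpl in Hx. lra. }
  { simpl. specialize (Hy 0%nat). simpl in Hy. lra. }
  (* The added 1 keeps the quotient meaningful when the rectangle degenerates to L = H = 0. *)
  destruct (pow_lt_1_zero (/ 2)) with (y := e / (L + H + 1)) as [n Hn].
  { rewrite Rabs_pos_eq; lra. } { apply Rdiv_lt_0_compat; lra. }
  specialize (Hn n (Nat.le_refl n)).
  destruct (IN n) as [B (I1 & I2 & I3 & I4)]. apply B.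
  apply LL; trivial; try apply PL; try apply PH; simpl; auto.
  rewrite Rabs_pos_eq in Hn by (apply pow_le; lra).
  rewrite pow_inv in Hn. apply Rlt_div_r in Hn; [|lra].
  unfold Rdiv. rewrite <- Rmult_plus_distr_r.
  assert (0 < / 2 ^ n) by (apply Rinv_0_lt_compat, pow_lt; lra). lra.
Qed.

Lemma cder_bcont f a b c d : (forall z, rect a b c d z -> cder f z) -> bcont f a b c d.
Proof. intros H z [Hz _]. apply cder_ccont; auto. Qed.

Lemma goursat f a b c d : a <= b -> c <= d ->
  (forall z, rect a b c d z -> cder f z) -> rint f a b c d = 0.
Proof.
  intros Hab Hcd Hf.
  (* The bound is quadratic in the side lengths, so the bounds of the four quarters add up exactly
     to that of the whole. Near p the affine part of f drops out, and the remainder (e/2)(L + H)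
     meets a perimeter 2 (L + H). *)
  assert (G : forall e, 0 < e -> Cmod (rint f a b c d) <= e * ((b - a) + (d - c)) ^ 2).
  { intros e He.
    set (P := fun a c L H => Cmod (rint f a (a + L) c (c + H)) <= e * (L + H) ^ 2).
    assert (X : P a c (b - a) (d - c)).
    2: { unfold P in X. replace (a + (b - a)) with b in X by ring.
         replace (c + (d - c)) with d in X by ring. exact X. }
    assert (HF : forall z, rect a (a + (b - a)) c (c + (d - c)) z -> cder f z).
    { intros z. replace (a + (b - a)) with b by ring. replace (c + (d - c)) with d by ring. auto. }
    apply rect_induction; try lra.
    - intros a' c' L H HL HH A1 A2 C1 C2 P1 P2 P3 P4. unfold P in *.
      assert (BC : forall x1 x2 y1 y2, a' <= x1 -> x2 <= a' + L -> c' <= y1 -> y2 <= c' + H ->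
         bcont f x1 x2 y1 y2).
      { intros. apply cder_bcont. intros z [Z1 Z2]. apply HF. split; lra. }
      rewrite (rint_split_v f a' (a' + L / 2) (a' + L)) by (try apply BC; lra).
      rewrite (rint_split_h f _ _ c' (c' + H / 2) (c' + H)) by (try apply BC; lra).
      rewrite (rint_split_h f _ _ c' (c' + H / 2) (c' + H)) by (try apply BC; lra).
      replace (a' + L / 2 + L / 2) with (a' + L) in * by field.
      replace (c' + H / 2 + H / 2) with (c' + H) in * by field.
      eapply Rle_trans. apply Cmod_triangle.
      eapply Rle_trans. apply Rplus_le_compat; apply Cmod_triangle.
      replace (e * (L + H) ^ 2) with (4 * (e * (L / 2 + H / 2) ^ 2)) by field. lra.
    - intros p Hp1 Hp2. destruct (HF p) as [l Hl]. split; lra.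
      destruct (Hl (e / 2)) as [r [Hr HH]]. lra.
      exists r. split; trivial. intros a' c' L H HL HH' A1 A2 C1 C2 Q1 Q2 Hs. unfold P.
      assert (BC : bcont f a' (a' + L) c' (c' + H)).
      { apply cder_bcont. intros z [Z1 Z2]. apply HF. split; lra. }
      assert (I1 := rint_correct f a' (a' + L) c' (c' + H) ltac:(lra) ltac:(lra) BC).
      assert (I2 := is_rint_affine (f p - l * p) l a' (a' + L) c' (c' + H)).
      assert (I3 := is_rint_minus _ _ _ _ _ _ _ _ I1 I2).
      apply is_rint_bound with (M := e / 2 * (L + H)) in I3; try lra.
      + replace (rint f a' (a' + L) c' (c' + H) - 0)%C with (rint f a' (a' + L) c' (c' + H)) in I3 by ring.
        eapply Rle_trans. exact I3. right. field.
      + intros z [[Z1 Z2] _].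
        assert (Dz : Cmod (z - p) <= L + H).
        { eapply Rle_trans. apply Cmod_le_Rabs. destruct z as [z1 z2], p as [p1 p2]. simpl in *.
          apply Rplus_le_compat; apply Rabs_le; lra. }
        replace (f z - (f p - l * p + l * z))%C with (f z - f p - l * (z - p))%C by ring.
        eapply Rle_trans. apply HH. lra. apply Rmult_le_compat_l; lra. }
  apply Cmod_lt_0_eq. intros e He.
  replace (rint f a b c d - 0)%C with (rint f a b c d) by ring.
  set (K := ((b - a) + (d - c)) ^ 2) in *. assert (0 <= K) by apply pow2_ge_0.
  specialize (G (e / (K + 1)) ltac:(apply Rdiv_lt_0_compat; lra)).
  eapply Rle_trans. exact G.
  replace (e / (K + 1) * K) with (e * (K / (K + 1))) by (field; lra).
  rewrite <- (Rmult_1_r e) at 2. apply Rmult_le_compat_l. lra. apply Rle_div_l; lra.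
Qed.

Lemma is_RInt_poisson (T q a b : R) : T <> 0 ->
  is_RInt (fun t => T / ((t - q) * (t - q) + T * T)) a b (atan ((b - q) / T) - atan ((a - q) / T)).
Proof.
  intros HT.
  assert (P : forall t, 0 < (t - q) * (t - q) + T * T).
  { intros t. assert (0 < T * T) by (apply (Rlt_0_sqr T HT)). assert (0 <= (t - q) * (t - q)) by apply Rle_0_sqr. lra. }
  apply (is_RInt_derive (V := R_CompleteNormedModule) (fun t => atan ((t - q) / T))).
  - intros x _. auto_derive; trivial. specialize (P x).
    field. split; trivial. intros E. lra.
  - intros x _. apply (ex_derive_continuous (V := R_NormedModule)). auto_derive.
    specialize (P x). lra.
Qed.

(** What lies outside the small square is cut into four rectangles avoiding p, and Goursat applies
    to each. *)
Lemma rint_shrink f a b c d p r : 0 < r ->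
  a <= fst p - r -> fst p + r <= b -> c <= snd p - r -> snd p + r <= d ->
  (forall z, rect a b c d z -> z <> p -> cder f z) ->
  rint f a b c d = rint f (fst p - r) (fst p + r) (snd p - r) (snd p + r).
Proof.
  destruct p as [p q]; simpl. intros Hr A B C0 D Hf.
  assert (K : forall x1 x2 y1 y2, a <= x1 -> x2 <= b -> c <= y1 -> y2 <= d ->
    (x2 < p \/ p < x1 \/ y2 < q \/ q < y1) -> forall z, rect x1 x2 y1 y2 z -> cder f z).
  { intros x1 x2 y1 y2 X1 X2 Y1 Y2 O z [Z1 Z2]. apply Hf. split; lra.
    intros ->. simpl in *. lra. }
  assert (BC : forall x1 x2 y1 y2, a <= x1 -> x2 <= b -> c <= y1 -> y2 <= d ->
    x1 <> p -> x2 <> p -> y1 <> q -> y2 <> q -> bcont f x1 x2 y1 y2).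
  { intros x1 x2 y1 y2 X1 X2 Y1 Y2 N1 N2 N3 N4 z [[Z1 Z2] E].
    apply cder_ccont, Hf. split; lra. intros ->. simpl in E. lra. }
  rewrite (rint_split_v f a (p - r) b) by (try apply BC; lra).
  rewrite (rint_split_v f (p - r) (p + r) b) by (try apply BC; lra).
  rewrite (rint_split_h f (p - r) (p + r) c (q - r) d) by (try apply BC; lra).
  rewrite (rint_split_h f (p - r) (p + r) (q - r) (q + r) d) by (try apply BC; lra).
  rewrite (goursat f a (p - r)) by (try lra; apply K; lra).
  rewrite (goursat f (p + r) b) by (try lra; apply K; lra).
  rewrite (goursat f _ _ c) by (try lra; apply K; lra).
  rewrite (goursat f _ _ (q + r) d) by (try lra; apply K; lra).
  ring.
Qed.

Lemma atan_m1 : atan (-1) = - (PI / 4).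
Proof. rewrite <- atan_1, <- atan_opp. reflexivity. Qed.

(** On opposite sides the difference of 1/(z - p) is a Poisson kernel times 2i or 2. Each kernel
    integrates to pi/2 by [atan], and the two pairs of sides contribute i pi each. *)
Lemma rint_inv_square (p : C) r : 0 < r ->
  rint (fun z => / (z - p))%C (fst p - r) (fst p + r) (snd p - r) (snd p + r) = twopii.
Proof.
  destruct p as [p q]; simpl. intros Hr.
  assert (BC : bcont (fun z => / (z - (p, q)))%C (p - r) (p + r) (q - r) (q + r)).
  { intros z [[Z1 Z2] E]. apply cder_ccont. apply cder_inv.
    apply cder_minus. apply cder_id. apply cder_const.
    apply Cminus_neq_0. intros ->. simpl in E. lra. }
  destruct (rint_correct (fun z => / (z - (p, q)))%C (p - r) (p + r) (q - r) (q + r) ltac:(lra) ltac:(lra) BC)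
    as (v1 & v2 & v3 & v4 & H1 & H2 & H3 & H4 & ->).
  assert (I : forall s, is_CI (fun t => RtoC (r / ((t - s) * (t - s) + r * r))) (s - r) (s + r) (RtoC (PI / 2))).
  { intros s. apply is_CI_real. assert (X := is_RInt_poisson r s (s - r) (s + r) ltac:(lra)).
    replace ((s + r - s) / r) with 1 in X by (field; lra).
    replace ((s - r - s) / r) with (-1) in X by (field; lra).
    rewrite atan_1, atan_m1 in X. replace (PI / 4 - - (PI / 4)) with (PI / 2) in X by field. exact X. }
  assert (P : forall t s, 0 < (t - s) * (t - s) + r * r)
    by (intros t s; assert (0 <= (t - s) * (t - s)) by apply Rle_0_sqr; assert (0 < r * r) by nra; lra).
  assert (E1 : (v1 - v3 = 2 * Ci * RtoC (PI / 2))%C).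
  { assert (X := is_CI_minus _ _ _ _ _ _ H1 H3). apply is_CI_unique in X. rewrite <- X.
    apply is_CI_unique. eapply is_CI_ext; [lra| |apply is_CI_scal; apply I].
    intros t Ht. simpl. specialize (P t p).
    assert (N : forall u, u = (t - p) * (t - p) + r * r -> u <> 0) by (intros u ->; lra).
    apply injective_projections; simpl; field; repeat split; apply N; ring. }
  assert (E2 : (v2 - v4 = 2 * RtoC (PI / 2))%C).
  { assert (X := is_CI_minus _ _ _ _ _ _ H2 H4). apply is_CI_unique in X. rewrite <- X.
    apply is_CI_unique. eapply is_CI_ext; [lra| |apply is_CI_scal; apply I].
    intros t Ht. simpl. specialize (P t q).
    assert (N : forall u, u = (t - q) * (t - q) + r * r -> u <> 0) by (intros u ->; lra).
    apply injective_projections; simpl; field; repeat split; apply N; ring. }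
  replace (v1 + Ci * v2 - v3 - Ci * v4)%C with ((v1 - v3) + Ci * (v2 - v4))%C by ring.
  rewrite E1, E2. unfold twopii. apply injective_projections; simpl; field.
Qed.

Definition rint_interior (a b c d : R) (p : C) : Prop := a < fst p < b /\ c < snd p < d.

Lemma interior_room a b c d p : rint_interior a b c d p -> exists r, 0 < r /\
  a <= fst p - r /\ fst p + r <= b /\ c <= snd p - r /\ snd p + r <= d.
Proof.
  intros [H K].
  exists (Rmin (Rmin (fst p - a) (b - fst p)) (Rmin (snd p - c) (d - snd p))).
  assert (X1 := Rmin_l (Rmin (fst p - a) (b - fst p)) (Rmin (snd p - c) (d - snd p))).
  assert (X2 := Rmin_r (Rmin (fst p - a) (b - fst p)) (Rmin (snd p - c) (d - snd p))).
  assert (X3 := Rmin_l (fst p - a) (b - fst p)). assert (X4 := Rmin_r (fst p - a) (b - fst p)).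
  assert (X5 := Rmin_l (snd p - c) (d - snd p)). assert (X6 := Rmin_r (snd p - c) (d - snd p)).
  repeat split; try lra. repeat apply Rmin_pos; lra.
Qed.

Lemma rint_inv a b c d p : rint_interior a b c d p ->
  rint (fun z => / (z - p))%C a b c d = twopii.
Proof.
  intros Hp. destruct (interior_room _ _ _ _ _ Hp) as (r & Hr & A & B & C0 & D).
  rewrite (rint_shrink _ a b c d p r); trivial.
  - apply rint_inv_square; trivial.
  - intros z _ Hz. apply cder_inv. apply cder_minus; [apply cder_id|apply cder_const].
    apply Cminus_neq_0; trivial.
Qed.

Lemma rbd_neq a b c d p z : rint_interior a b c d p -> rbd a b c d z -> z <> p.
Proof. intros [H K] [_ E] ->. lra. Qed.

(** After shrinking to a square of half-side r, f(p)/(z - p) is subtracted: the remaining difference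
    quotient is bounded near p, and the contour length tends to 0. *)
Lemma cauchy_formula f a b c d p : rint_interior a b c d p ->
  (forall z, rect a b c d z -> cder f z) ->
  is_rint (fun z => f z / (z - p))%C a b c d (twopii * f p).
Proof.
  intros Hp Hf. destruct (interior_room _ _ _ _ _ Hp) as (r0 & Hr0 & A & B & C0 & D).
  assert (Rp : rect a b c d p) by (destruct Hp; split; lra).
  destruct (Hf p Rp) as [l Hl]. destruct (Hl 1 Rlt_0_1) as [r1 [Hr1 H1]].
  assert (DF : forall z, rect a b c d z -> z <> p -> cder (fun z => f z / (z - p))%C z).
  { intros z Hz N. apply cder_div; auto. apply cder_minus; [apply cder_id|apply cder_const].
    apply Cminus_neq_0; trivial. }
  assert (Hab : a <= b) by (destruct Hp; lra). assert (Hcd : c <= d) by (destruct Hp; lra).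
  assert (BC : bcont (fun z => f z / (z - p))%C a b c d).
  { intros z Hz. apply cder_ccont. apply DF. apply Hz. eapply rbd_neq; eauto. }
  assert (E : rint (fun z => f z / (z - p))%C a b c d = (twopii * f p)%C).
  2: { rewrite <- E. apply rint_correct; trivial. }
  assert (L0 := Cmod_ge_0 l).
  apply Cmod_lt_0_eq. intros e He.
  (* The entry r1 / 3 keeps the square in the disc where the difference quotient is at most |l| + 1;
     the entry with e / 8 pays for the contour length 8 r. *)
  set (r := Rmin (Rmin r0 (r1 / 3)) (e / 8 / (Cmod l + 1))).
  assert (Hr : 0 < r). { repeat apply Rmin_pos; try lra. apply Rdiv_lt_0_compat; lra. }
  assert (R1 : r <= r0) by (eapply Rle_trans; [apply Rmin_l|apply Rmin_l]).
  assert (R2 : r <= r1 / 3) by (eapply Rle_trans; [apply Rmin_l|apply Rmin_r]).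
  assert (R3 : r <= e / 8 / (Cmod l + 1)) by apply Rmin_r.
  rewrite (rint_shrink _ a b c d p r) by (exact DF || lra).
  assert (BC1 : bcont (fun z => f z / (z - p))%C (fst p - r) (fst p + r) (snd p - r) (snd p + r)).
  { intros z [[Z1 Z2] E]. apply cder_ccont. apply DF. split; lra. intros ->. lra. }
  assert (BC2 : bcont (fun z => / (z - p))%C (fst p - r) (fst p + r) (snd p - r) (snd p + r)).
  { intros z [[Z1 Z2] E]. apply cder_ccont. apply cder_inv. apply cder_minus; [apply cder_id|apply cder_const].
    apply Cminus_neq_0. intros ->. lra. }
  assert (I1 := rint_correct _ (fst p - r) (fst p + r) (snd p - r) (snd p + r) ltac:(lra) ltac:(lra) BC1).
  assert (I2 := rint_correct _ (fst p - r) (fst p + r) (snd p - r) (snd p + r) ltac:(lra) ltac:(lra) BC2).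
  rewrite rint_inv_square in I2 by trivial.
  assert (I3 := is_rint_minus _ _ _ _ _ _ _ _ I1 (is_rint_scal (f p) _ _ _ _ _ _ I2)).
  apply is_rint_bound with (M := Cmod l + 1) in I3; try lra.
  - replace (twopii * f p)%C with (f p * twopii)%C by ring. eapply Rle_trans. exact I3.
    apply Rle_div_r in R3; lra.
  - intros z [[Z1 Z2] E]. assert (N : z <> p) by (intros ->; lra).
    replace (f z / (z - p) - f p * / (z - p))%C with ((f z - f p) / (z - p))%C
      by (field; apply Cminus_neq_0; trivial).
    assert (Nz := Cminus_neq_0 _ _ N). assert (Pz := proj1 (Cmod_gt_0 _) Nz).
    rewrite Cmod_div by trivial. apply Rle_div_l; trivial.
    assert (X : Cmod (z - p) < r1).
    { eapply Rle_lt_trans. apply Cmod_le_Rabs. destruct z as [z1 z2], p as [p1 p2]; simpl in *.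
      assert (Rabs (z1 + - p1) <= r) by (apply Rabs_le; lra).
      assert (Rabs (z2 + - p2) <= r) by (apply Rabs_le; lra). lra. }
    specialize (H1 z X).
    replace (f z - f p)%C with ((f z - f p - l * (z - p)) + l * (z - p))%C by ring.
    eapply Rle_trans. apply Cmod_triangle. rewrite Cmod_mult. lra.
Qed.

(** * Cauchy-type integrals over squares *)

Lemma rcont_bounded (f : R -> C) a b : a <= b -> (forall t, a <= t <= b -> rcont f t) ->
  exists M, forall t, a <= t <= b -> Cmod (f t) <= M.
Proof.
  intros Hab H.
  destruct (continuity_ab_maj (fun t => Cmod (f t)) a b Hab) as [m [Hm _]].
  - intros t Ht e He. destruct (H t Ht e He) as [d [Hd HH]].
    exists d. split; trivial. intros s [_ Hs]. unfold R_met, R_dist in *; simpl in *. unfold Rdist in *.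
    specialize (HH s Hs).
    assert (T1 := Cmod_triangle_rev (f s) (f t)). assert (T2 := Cmod_triangle_rev (f t) (f s)).
    rewrite Cmod_minus_sym in T2. apply Rabs_def1; lra.
  - exists (Cmod (f m)). exact Hm.
Qed.

Lemma bcont_bounded f a b c d : a <= b -> c <= d -> bcont f a b c d ->
  exists M, 0 <= M /\ forall z, rbd a b c d z -> Cmod (f z) <= M.
Proof.
  intros Hab Hcd B.
  assert (Hh : forall y, y = c \/ y = d -> exists M, forall t, a <= t <= b -> Cmod (f (t, y)) <= M).
  { intros y Hy. apply rcont_bounded; trivial. intros t Ht.
    apply (ccont_rcont f (fun t => (t, y))). apply B. split; unfold rect; simpl; lra. apply rcont_hor. }
  assert (Hv : forall y, y = a \/ y = b -> exists M, forall t, c <= t <= d -> Cmod (f (y, t)) <= M).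
  { intros y Hy. apply rcont_bounded; trivial. intros t Ht.
    apply (ccont_rcont f (fun t => (y, t))). apply B. split; unfold rect; simpl; lra. apply rcont_ver. }
  destruct (Hh c ltac:(tauto)) as [M1 H1]. destruct (Hh d ltac:(tauto)) as [M2 H2].
  destruct (Hv a ltac:(tauto)) as [M3 H3]. destruct (Hv b ltac:(tauto)) as [M4 H4].
  exists (Rmax (Rmax M1 M2) (Rmax M3 M4)).
  assert (Q1 := Rmax_l M1 M2). assert (Q2 := Rmax_r M1 M2).
  assert (Q3 := Rmax_l M3 M4). assert (Q4 := Rmax_r M3 M4).
  assert (Q5 := Rmax_l (Rmax M1 M2) (Rmax M3 M4)). assert (Q6 := Rmax_r (Rmax M1 M2) (Rmax M3 M4)).
  split. { specialize (H1 a ltac:(lra)). assert (X := Cmod_ge_0 (f (a, c))). lra. }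
  intros [z1 z2] [[Z1 Z2] E]. simpl in *.
  destruct E as [ -> | [ -> | [ -> | -> ]]].
  specialize (H3 z2 Z2). lra. specialize (H4 z2 Z2). lra.
  specialize (H1 z1 Z1). lra. specialize (H2 z1 Z1). lra.
Qed.

(** Squares take the place of circles, since the rectangle calculus covers them. Their boundary
    points lie at distance between s and 2 s from p, whence the half-side r / 3 inside a disc of
    radius r. *)
Definition sqb (p : C) (s : R) (z : C) : Prop := rbd (fst p - s) (fst p + s) (snd p - s) (snd p + s) z.
Definition sqint (f : C -> C) (p : C) (s : R) : C := rint f (fst p - s) (fst p + s) (snd p - s) (snd p + s).
Definition is_sqint (f : C -> C) (p : C) (s : R) v : Prop := is_rint f (fst p - s) (fst p + s) (snd p - s) (snd p + s) v.

Lemma Cmod_ge_max (z : C) : Rabs (fst z) <= Cmod z /\ Rabs (snd z) <= Cmod z.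
Proof. split. apply (re_le_Cmod z). apply (im_le_Cmod z). Qed.

Lemma sqb_far p s z : 0 < s -> sqb p s z -> s <= Cmod (z - p).
Proof.
  intros Hs [[H1 H2] E]. destruct (Cmod_ge_max (z - p)) as [A B]. destruct z as [z1 z2], p as [p1 p2]; simpl in *.
  destruct E as [E|[E|[E|E]]]; subst;
  [refine (Rle_trans _ _ _ _ A)|refine (Rle_trans _ _ _ _ A)|refine (Rle_trans _ _ _ _ B)|refine (Rle_trans _ _ _ _ B)];
  (rewrite Rabs_pos_eq; lra) || (rewrite Rabs_left; lra).
Qed.

Lemma sq_near p s z : 0 < s -> rect (fst p - s) (fst p + s) (snd p - s) (snd p + s) z -> Cmod (z - p) <= 2 * s.
Proof.
  intros Hs [H1 H2]. eapply Rle_trans. apply Cmod_le_Rabs. destruct z as [z1 z2], p as [p1 p2]; simpl in *.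
  assert (Rabs (z1 + - p1) <= s) by (apply Rabs_le; lra).
  assert (Rabs (z2 + - p2) <= s) by (apply Rabs_le; lra). lra.
Qed.

Lemma sq_in_disc p r z : 0 < r -> rect (fst p - r / 3) (fst p + r / 3) (snd p - r / 3) (snd p + r / 3) z ->
  Cmod (z - p) < r.
Proof. intros Hr H. apply sq_near in H; lra. Qed.

Lemma sqb_dist p s z w : 0 < s -> sqb p s z -> s - Cmod (w - p) <= Cmod (z - w).
Proof.
  intros Hs H. apply sqb_far in H; trivial.
  assert (T := Cmod_triangle3 z w p). lra.
Qed.

Lemma sqb_neq p s z w : 0 < s -> sqb p s z -> Cmod (w - p) < s -> (z - w)%C <> 0.
Proof.
  intros Hs H K. apply Cmod_gt_0. assert (X := sqb_dist p s z w Hs H). lra.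
Qed.

Lemma sq_interior p s w : Cmod (w - p) < s -> rint_interior (fst p - s) (fst p + s) (snd p - s) (snd p + s) w.
Proof.
  intros H. destruct (Cmod_ge_max (w - p)) as [A B]. destruct w as [w1 w2], p as [p1 p2]; simpl in *.
  apply Rle_lt_trans with (2 := H) in A. apply Rle_lt_trans with (2 := H) in B.
  apply Rabs_lt_between in A. apply Rabs_lt_between in B. split; simpl; lra.
Qed.

Definition sqcont (f : C -> C) (p : C) (s : R) : Prop := forall z, sqb p s z -> ccont f z.

Lemma is_sqint_bound f p s v M : 0 < s -> (forall z, sqb p s z -> Cmod (f z) <= M) ->
  is_sqint f p s v -> Cmod v <= 8 * s * M.
Proof.
  intros Hs H I. apply is_rint_bound with (M := M) in I; [|lra|lra|exact H].
  eapply Rle_trans. exact I. right. ring.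
Qed.

Lemma sqint_correct f p s : 0 < s -> sqcont f p s -> is_sqint f p s (sqint f p s).
Proof. intros Hs H. apply rint_correct; try lra. exact H. Qed.

Lemma ccont_mult f g z : ccont f z -> ccont g z -> ccont (fun z => f z * g z)%C z.
Proof.
  intros Hf Hg e He.
  assert (F0 := Cmod_ge_0 (f z)). assert (G0 := Cmod_ge_0 (g z)).
  destruct (Hf (e / 2 / (Cmod (g z) + 1))) as [d1 [P1 H1]]. apply Rdiv_lt_0_compat; lra.
  destruct (Hg (Rmin 1 (e / 2 / (Cmod (f z) + 1)))) as [d2 [P2 H2]].
  apply Rmin_pos. lra. apply Rdiv_lt_0_compat; lra.
  exists (Rmin d1 d2). split. apply Rmin_pos; trivial. intros s Hs.
  specialize (H1 s (Rlt_le_trans _ _ _ Hs (Rmin_l _ _))).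
  specialize (H2 s (Rlt_le_trans _ _ _ Hs (Rmin_r _ _))).
  split_min H2 H3 H4.
  replace (f s * g s - f z * g z)%C with ((f s - f z) * g s + f z * (g s - g z))%C by ring.
  eapply Rle_lt_trans. apply Cmod_triangle. rewrite !Cmod_mult.
  assert (T := Cmod_triangle_rev (g s) (g z)).
  apply Rlt_div_r in H1; [|lra]. apply Rlt_div_r in H4; [|lra].
  assert (Q1 := Cmod_ge_0 (f s - f z)). assert (Q2 := Cmod_ge_0 (g s - g z)).
  nra.
Qed.

Lemma ccont_inv_minus w z : (z - w)%C <> 0 -> ccont (fun z => / (z - w))%C z.
Proof.
  intros H. apply cder_ccont, cder_inv; trivial. apply cder_minus. apply cder_id. apply cder_const.
Qed.

Lemma sqcont_div f p s w : 0 < s -> sqcont f p s -> Cmod (w - p) < s ->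
  sqcont (fun z => f z / (z - w))%C p s.
Proof.
  intros Hs H Hw z Hz. apply ccont_mult; auto. apply ccont_inv_minus. eapply sqb_neq; eauto.
Qed.

Lemma is_sqint_ext f g p s v : 0 < s -> (forall z, sqb p s z -> f z = g z) ->
  is_sqint f p s v -> is_sqint g p s v.
Proof. intros Hs. apply is_rint_ext; lra. Qed.

Lemma cmod_div_le (a b : C) m d : 0 < d -> Cmod a <= m -> d <= Cmod b -> Cmod (a / b) <= m / d.
Proof.
  intros Hd Ha Hb. assert (b <> 0) by (apply Cmod_gt_0; lra).
  assert (A0 := Cmod_ge_0 a).
  rewrite Cmod_div by trivial. apply Rmult_le_compat; trivial.
  left; apply Rinv_0_lt_compat; lra. apply Rinv_le_contravar; trivial.
Qed.

(** Differentiation under the integral sign through the exact identity 1/(z-y) - 1/(z-w) -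
    (y-w)/(z-w)^2 = (y-w)^2 / ((z-y)(z-w)^2); only continuity of f on the contour enters. *)
Lemma cauchy_type_cder f p s w : 0 < s -> sqcont f p s -> Cmod (w - p) < s ->
  cder (fun w => sqint (fun z => f z / (z - w))%C p s) w.
Proof.
  intros Hs Hf Hw.
  destruct (bcont_bounded f (fst p - s) (fst p + s) (snd p - s) (snd p + s)) as [M [M0 HM]]; try lra.
  { exact Hf. }
  set (d := s - Cmod (w - p)) in *. assert (Hd : 0 < d) by (unfold d; lra).
  exists (sqint (fun z => f z / (z - w) / (z - w))%C p s).
  intros e He.
  set (K := 8 * s * (M * 2 / (d * d * d))).
  assert (D3 : 0 < d * d * d) by (repeat apply Rmult_lt_0_compat; lra).
  assert (K0 : 0 <= K). { unfold K. apply Rmult_le_pos. lra. apply Rmult_le_pos. lra. left; apply Rinv_0_lt_compat; lra. }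
  exists (Rmin (d / 2) (e / (K + 1))). split. apply Rmin_pos. lra. apply Rdiv_lt_0_compat; lra.
  intros y Hy. split_min Hy Y1 Y2.
  assert (Hyp : Cmod (y - p) < s - d / 2).
  { assert (T := Cmod_triangle3 y w p). unfold d in *. lra. }
  assert (I1 := sqint_correct _ p s Hs (sqcont_div f p s y Hs Hf ltac:(lra))).
  assert (I2 := sqint_correct _ p s Hs (sqcont_div f p s w Hs Hf Hw)).
  assert (I3 := sqint_correct _ p s Hs (sqcont_div _ p s w Hs (sqcont_div f p s w Hs Hf Hw) Hw)).
  assert (I := is_rint_minus _ _ _ _ _ _ _ _ (is_rint_minus _ _ _ _ _ _ _ _ I1 I2) (is_rint_scal (y - w) _ _ _ _ _ _ I3)).
  apply is_sqint_bound with (M := Cmod (y - w) * Cmod (y - w) * (M * 2 / (d * d * d))) in I; trivial.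
  - replace (sqint (fun z => f z / (z - w) / (z - w))%C p s * (y - w))%C with
      ((y - w) * sqint (fun z => f z / (z - w) / (z - w))%C p s)%C by ring.
    eapply Rle_trans. exact I.
    set (t := Cmod (y - w)) in *. assert (T0 : 0 <= t) by apply Cmod_ge_0.
    replace (8 * s * (t * t * (M * 2 / (d * d * d)))) with (K * t * t) by (unfold K; ring).
    apply Rmult_le_compat_r; trivial. apply Rlt_div_r in Y2; [|lra]. nra.
  - intros z Hz.
    assert (N1 := sqb_neq p s z y Hs Hz ltac:(lra)). assert (N2 := sqb_neq p s z w Hs Hz Hw).
    replace (f z / (z - y) - f z / (z - w) - (y - w) * (f z / (z - w) / (z - w)))%C with
     ((y - w) * (y - w) * (f z / ((z - y) * (z - w) * (z - w))))%C by (field; auto).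
    rewrite !Cmod_mult. apply Rmult_le_compat_l. apply Rmult_le_pos; apply Cmod_ge_0.
    assert (Z1 := sqb_dist p s z y Hs Hz). assert (Z2 := sqb_dist p s z w Hs Hz). fold d in Z2.
    replace (M * 2 / (d * d * d)) with (M / (d / 2 * d * d)) by (field; lra).
    apply cmod_div_le. repeat apply Rmult_lt_0_compat; lra.
    apply HM. exact Hz.
    rewrite !Cmod_mult. apply Rmult_le_compat; try lra. apply Rmult_le_pos; lra.
    apply Rmult_le_compat; lra.
Qed.

Lemma twopii_neq_0 : twopii <> 0.
Proof.
  unfold twopii. assert (H := PI_RGT_0). intros E. apply (f_equal snd) in E. simpl in E. lra.
Qed.

Lemma Cmod_twopii : Cmod twopii = 2 * PI.
Proof.
  unfold twopii. rewrite !Cmod_mult, Cmod_Ci, !Cmod_R, !Rabs_pos_eq; try lra. assert (H := PI_RGT_0). lra.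
Qed.

Lemma cauchy_square f p r w : 0 < r -> (forall z, Cmod (z - p) < r -> cder f z) ->
  Cmod (w - p) < r / 3 -> is_sqint (fun z => f z / (z - w))%C p (r / 3) (twopii * f w).
Proof.
  intros Hr Hf Hw. apply cauchy_formula.
  apply sq_interior; lra. intros z Hz. apply Hf. apply sq_in_disc; trivial.
Qed.

(** Weierstrass's theorem. Cauchy's formula survives a uniform limit, so near p the limit is a
    Cauchy-type integral of a continuous function, hence differentiable. *)
Lemma uniform_limit_cder f p r : 0 < r ->
  (forall e, 0 < e -> exists fe, (forall z, Cmod (z - p) < r -> cder fe z) /\
     forall z, Cmod (z - p) < r -> Cmod (fe z - f z) <= e) ->
  cder f p.
Proof.
  intros Hr H.
  assert (HC : forall z, Cmod (z - p) < r -> ccont f z).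
  { intros z Hz e He. destruct (H (e / 3) ltac:(lra)) as [g [G1 G2]].
    destruct (cder_ccont _ _ (G1 z Hz) (e / 3) ltac:(lra)) as [d [Hd HH]].
    exists (Rmin d (r - Cmod (z - p))). split. apply Rmin_pos; lra.
    intros y Hy. specialize (HH y (Rlt_le_trans _ _ _ Hy (Rmin_l _ _))).
    assert (Y2 := Rlt_le_trans _ _ _ Hy (Rmin_r _ _)).
    assert (T := Cmod_triangle3 y z p).
    assert (A1 := G2 y ltac:(lra)). assert (A2 := G2 z Hz). rewrite Cmod_minus_sym in A1.
    assert (T1 := Cmod_triangle3 (f y) (g y) (f z)). assert (T2 := Cmod_triangle3 (g y) (g z) (f z)). lra. }
  set (s := r / 3). assert (Hs : 0 < s) by (unfold s; lra).
  assert (SC : sqcont f p s). { intros z [Hz _]. apply HC. apply sq_in_disc; trivial. }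
  apply cder_local with (f := fun w => (/ twopii * sqint (fun z => f z / (z - w)) p s)%C) (r := s); trivial.
  2: { apply cder_mult. apply cder_const. apply cauchy_type_cder; trivial.
    rewrite Cmod_self; trivial. }
  intros w Hw.
  assert (E : sqint (fun z => f z / (z - w))%C p s = (twopii * f w)%C).
  2: { rewrite E. field. apply twopii_neq_0. }
  apply Cmod_lt_0_eq. intros e He.
  set (d := s - Cmod (w - p)). assert (Hd : 0 < d) by (unfold d; lra).
  assert (PP := PI_RGT_0).
  (* An approximation error e / k enters once under the integral, at the cost 8 s / d, and once at
     w, at the cost 2 pi. *)
  set (k := 8 * s / d + 2 * PI). assert (K0 : 0 < k).
  { unfold k. assert (0 < 8 * s / d) by (apply Rdiv_lt_0_compat; lra). lra. }
  destruct (H (e / k)) as [g [G1 G2]]. apply Rdiv_lt_0_compat; lra.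
  assert (I1 := cauchy_square g p r w Hr G1 Hw). fold s in I1.
  assert (I2 := sqint_correct _ p s Hs (sqcont_div f p s w Hs SC Hw)).
  assert (I := is_rint_minus _ _ _ _ _ _ _ _ I1 I2).
  apply is_sqint_bound with (M := e / k / d) in I; trivial.
  - eapply Rle_trans. apply (Cmod_triangle3 _ (twopii * g w)).
    rewrite Cmod_minus_sym.
    replace (twopii * g w - twopii * f w)%C with (twopii * (g w - f w))%C by ring.
    rewrite Cmod_mult, Cmod_twopii.
    assert (X := G2 w ltac:(unfold s in Hw; lra)).
    apply Rle_trans with (8 * s * (e / k / d) + 2 * PI * (e / k)).
    { apply Rplus_le_compat; trivial. apply Rmult_le_compat_l; lra. }
    right. unfold k. field. split. lra. unfold k in K0. intros E.
    replace (8 * s / d + 2 * PI) with ((8 * s + 2 * PI * d) / d) in K0 by (field; lra).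
    rewrite E in K0. unfold Rdiv in K0. lra.
  - intros z Hz. assert (N := sqb_neq p s z w Hs Hz Hw).
    replace (g z / (z - w) - f z / (z - w))%C with ((g z - f z) / (z - w))%C by (field; auto).
    apply cmod_div_le; trivial. apply G2. apply sq_in_disc; trivial. apply Hz.
    apply sqb_dist; trivial.
Qed.

Lemma is_sqint_unique f p s v : is_sqint f p s v -> sqint f p s = v.
Proof. apply is_rint_unique. Qed.

(** From 1/(z-w) - 1/(z-p) = (w-p)/((z-p)(z-w)): a divided difference of a Cauchy-type integral is
    again one. *)
Lemma sqint_divdiff f p s w : 0 < s -> sqcont f p s -> Cmod (w - p) < s ->
  (sqint (fun z => f z / (z - w)) p s - sqint (fun z => f z / (z - p)) p s =
   (w - p) * sqint (fun z => f z / (z - p) / (z - w)) p s)%C.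
Proof.
  intros Hs Hf Hw.
  assert (Hp : Cmod (p - p) < s). { rewrite Cmod_self; trivial. }
  assert (I1 := sqint_correct _ p s Hs (sqcont_div f p s w Hs Hf Hw)).
  assert (I2 := sqint_correct _ p s Hs (sqcont_div f p s p Hs Hf Hp)).
  assert (I3 := sqint_correct _ p s Hs (sqcont_div _ p s w Hs (sqcont_div f p s p Hs Hf Hp) Hw)).
  assert (I := is_rint_minus _ _ _ _ _ _ _ _ I1 I2).
  apply is_sqint_unique in I. rewrite <- I.
  apply is_sqint_unique. eapply is_sqint_ext; [trivial| |apply is_rint_scal; exact I3].
  intros z Hz. simpl.
  assert (N1 := sqb_neq p s z p Hs Hz Hp). assert (N2 := sqb_neq p s z w Hs Hz Hw).
  field; auto.
Qed.

(** The singularity of the difference quotient is removable: near p it agrees with a Cauchy-type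
    integral, whose value at p completes it. *)
Lemma diff_quotient f p r : 0 < r -> (forall z, Cmod (z - p) < r -> cder f z) ->
  exists g, cder g p /\ forall z, z <> p -> g z = ((f z - f p) / (z - p))%C.
Proof.
  intros Hr Hf. set (s := r / 3). assert (Hs : 0 < s) by (unfold s; lra).
  assert (SC : sqcont f p s). { intros z [Hz _]. apply cder_ccont, Hf. apply sq_in_disc; trivial. }
  assert (Hp : Cmod (p - p) < s). { rewrite Cmod_self; trivial. }
  set (h := fun w => (/ twopii * sqint (fun z => f z / (z - p) / (z - w)) p s)%C).
  assert (Hh : cder h p).
  { apply cder_mult. apply cder_const. apply cauchy_type_cder; trivial. apply sqcont_div; trivial. }
  assert (Eh : forall w, Cmod (w - p) < s -> ((w - p) * h w)%C = (f w - f p)%C).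
  { intros w Hw. unfold h.
    replace ((w - p) * (/ twopii * sqint (fun z => f z / (z - p) / (z - w)) p s))%C with
      (/ twopii * ((w - p) * sqint (fun z => f z / (z - p) / (z - w)) p s))%C by ring.
    rewrite <- sqint_divdiff by trivial.
    rewrite (is_sqint_unique _ p s _ (cauchy_square f p r w Hr Hf Hw)).
    rewrite (is_sqint_unique _ p s _ (cauchy_square f p r p Hr Hf Hp)).
    field. apply twopii_neq_0. }
  exists (fun z => if excluded_middle_informative (z = p) then h p else ((f z - f p) / (z - p))%C).
  split.
  - apply cder_local with (f := h) (r := s); trivial. intros w Hw.
    destruct (excluded_middle_informative (w = p)) as [->|N]; trivial.
    rewrite <- Eh by trivial. field. apply Cminus_neq_0; trivial.
  - intros z Hz. destruct (excluded_middle_informative (z = p)); tauto.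
Qed.

Lemma ccont_zero f p : ccont f p ->
  (forall e, 0 < e -> exists w, 0 < Cmod (w - p) < e /\ f w = 0) -> f p = 0.
Proof.
  intros Hc H. apply Cmod_lt_0_eq. intros e He.
  destruct (Hc e He) as [d [Hd HH]]. destruct (H d Hd) as [w [Hw E]].
  specialize (HH w ltac:(lra)). rewrite E in HH. rewrite Cmod_minus_sym. lra.
Qed.

(* Cauchy's formula is divided by w - p again and again: f w = (w - p)^n G_n w, where
   G_n is a Cauchy-type integral over a square of half-side s and is O(s^(-n)). *)
Lemma local_identity f p r : 0 < r -> (forall z, Cmod (z - p) < r -> cder f z) ->
  (forall e, 0 < e -> exists w, 0 < Cmod (w - p) < e /\ f w = 0) ->
  exists r', 0 < r' /\ forall w, Cmod (w - p) < r' -> f w = 0.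
Proof.
  intros Hr Hf Hz. set (s := r / 3). assert (Hs : 0 < s) by (unfold s; lra).
  assert (SC : sqcont f p s). { intros z [Hz' _]. apply cder_ccont, Hf. apply sq_in_disc; trivial. }
  assert (Hp : Cmod (p - p) < s). { rewrite Cmod_self; trivial. }
  set (F := fix F n := match n with O => f | S m => fun z => (F m z / (z - p))%C end).
  assert (FC : forall n, sqcont (F n) p s).
  { induction n. exact SC. apply (sqcont_div (F n)); trivial. }
  set (G := fun n w => sqint (fun z => F n z / (z - w))%C p s).
  assert (A : forall n w, Cmod (w - p) < s -> (twopii * f w = (w - p) ^ n * G n w)%C).
  { induction n; intros w Hw.
    - unfold G. simpl. rewrite (is_sqint_unique _ p s _ (cauchy_square f p r w Hr Hf Hw)). ring.
    - rewrite IHn by trivial.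
      (* At a zero v of f close to p the induction hypothesis gives G n v = 0, and such v accumulate
         at p. *)
      assert (G0 : G n p = 0).
      { apply ccont_zero. apply cder_ccont. apply (cauchy_type_cder (F n) p s p); trivial.
        intros e He. destruct (Hz (Rmin e s)) as [v [Hv Ev]]. apply Rmin_pos; trivial.
        exists v. split. split. lra. eapply Rlt_le_trans. apply Hv. apply Rmin_l.
        assert (Q := IHn v (Rlt_le_trans _ _ _ (proj2 Hv) (Rmin_r _ _))). rewrite Ev in Q.
        replace (twopii * 0)%C with (RtoC 0) in Q by ring.
        assert (N : ((v - p) ^ n)%C <> 0). { apply Cpow_nz. apply Cmod_gt_0. lra. }
        destruct (Ceq_dec (G n v) 0) as [X|X]; trivial. exfalso.
        symmetry in Q. revert Q. apply Cmult_neq_0; trivial. }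
      assert (X := sqint_divdiff (F n) p s w Hs (FC n) Hw).
      change (G n w - G n p = (w - p) * G (S n) w)%C in X. rewrite G0 in X.
      replace (G n w) with (G n w - 0)%C by ring. rewrite X. simpl. ring. }
  destruct (bcont_bounded f (fst p - s) (fst p + s) (snd p - s) (snd p + s)) as [M [M0 HM]]; try lra.
  { exact SC. }
  assert (FB : forall n z, sqb p s z -> Cmod (F n z) <= M / s ^ n).
  { induction n; intros z Hz'. simpl. rewrite Rdiv_1_r. apply HM, Hz'.
    change (F (S n) z) with (F n z / (z - p))%C.
    replace (M / s ^ S n) with (M / s ^ n / s) by (simpl; field; split; [apply pow_nonzero|]; lra).
    apply cmod_div_le; auto. apply sqb_far; trivial. }
  exists (s / 2). split. lra. intros w Hw.
  apply Cmod_lt_0_eq. intros e He. replace (f w - 0)%C with (f w) by ring.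
  (* The bound |w - p| < s / 2 against s^n in the denominator leaves 2^(-n); 16 is the length 8 s
     divided by the distance s / 2, and the factor 2 pi >= 1 is dropped. *)
  assert (B : forall n, Cmod (f w) <= 16 * M * (/ 2) ^ n).
  { intros n. assert (Q := f_equal Cmod (A n w ltac:(lra))).
    rewrite !Cmod_mult, Cmod_twopii, Cmod_pow in Q.
    assert (I := sqint_correct _ p s Hs (sqcont_div (F n) p s w Hs (FC n) ltac:(lra))).
    apply is_sqint_bound with (M := M / s ^ n / (s / 2)) in I; trivial.
    2: { intros z Hz'. apply cmod_div_le. lra. apply FB; trivial.
         assert (T := sqb_dist p s z w Hs Hz'). lra. }
    fold (G n w) in I.
    assert (PP := PI2_1). assert (F0 := Cmod_ge_0 (f w)).
    apply Rle_trans with (2 * PI * Cmod (f w)). nra. rewrite Q.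
    assert (P2 : Cmod (w - p) ^ n <= (s / 2) ^ n) by (apply pow_incr; split; [apply Cmod_ge_0|lra]).
    apply Rle_trans with ((s / 2) ^ n * (8 * s * (M / s ^ n / (s / 2)))).
    { apply Rmult_le_compat; trivial. apply pow_le, Cmod_ge_0. apply Cmod_ge_0. }
    right. unfold Rdiv at 1. rewrite Rpow_mult_distr. field. split. apply pow_nonzero; lra. lra. }
  destruct (pow_lt_1_zero (/ 2)) with (y := e / (16 * M + 1)) as [n Hn].
  { rewrite Rabs_pos_eq; lra. } { apply Rdiv_lt_0_compat; lra. }
  specialize (Hn n (Nat.le_refl n)). rewrite Rabs_pos_eq in Hn by (apply pow_le; lra).
  apply Rlt_div_r in Hn; [|lra]. specialize (B n).
  assert (0 < (/ 2) ^ n) by (apply pow_lt; lra). lra.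
Qed.

(** * Unordered sums *)

Definition rsum (M : R -> R) (l : list R) : R := fold_right (fun t s => M t + s) 0 l.

Lemma fin_sum_mod_rsum f l : fin_sum_mod f l = rsum (fun t => Cmod (f t)) l.
Proof. reflexivity. Qed.

Lemma fin_sum_app f l l' : fin_sum f (l ++ l') = (fin_sum f l + fin_sum f l')%C.
Proof. induction l; simpl. ring. rewrite IHl. ring. Qed.

Lemma rsum_app M l l' : rsum M (l ++ l') = rsum M l + rsum M l'.
Proof. induction l; simpl. ring. rewrite IHl. ring. Qed.

Lemma fin_sum_perm f l l' : Permutation l l' -> fin_sum f l = fin_sum f l'.
Proof.
  induction 1; simpl; trivial. congruence. ring. congruence.
Qed.

Lemma rsum_perm M l l' : Permutation l l' -> rsum M l = rsum M l'.
Proof.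
  induction 1; simpl; trivial. congruence. ring. congruence.
Qed.

Lemma fin_sum_ext f g l : (forall t, In t l -> f t = g t) -> fin_sum f l = fin_sum g l.
Proof.
  induction l; simpl; intros H; trivial. rewrite H, IHl; auto.
Qed.

Lemma fin_sum_plus f g l : fin_sum (fun t => f t + g t)%C l = (fin_sum f l + fin_sum g l)%C.
Proof. induction l; simpl. ring. rewrite IHl. ring. Qed.

Lemma fin_sum_scal k f l : fin_sum (fun t => k * f t)%C l = (k * fin_sum f l)%C.
Proof. induction l; simpl. ring. rewrite IHl. ring. Qed.

Lemma rsum_le M N l : (forall t, In t l -> M t <= N t) -> rsum M l <= rsum N l.
Proof.
  induction l; simpl; intros H. lra.
  assert (X := H a (or_introl eq_refl)). assert (rsum M l <= rsum N l) by auto. lra.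
Qed.

Lemma rsum_pos M l : (forall t, In t l -> 0 <= M t) -> 0 <= rsum M l.
Proof.
  induction l; simpl; intros H. lra.
  assert (X := H a (or_introl eq_refl)). assert (0 <= rsum M l) by auto. lra.
Qed.

Lemma rsum_scal k M l : rsum (fun t => k * M t) l = k * rsum M l.
Proof. induction l; simpl. ring. rewrite IHl. ring. Qed.

Lemma Cmod_fin_sum f M l : (forall t, In t l -> Cmod (f t) <= M t) -> Cmod (fin_sum f l) <= rsum M l.
Proof.
  induction l; simpl; intros H. rewrite Cmod_0. lra.
  eapply Rle_trans. apply Cmod_triangle. apply Rplus_le_compat; auto.
Qed.

Definition memb (l : list R) (t : R) : bool := if in_dec Req_EM_T t l then true else false.
Definition ldiff (l l0 : list R) : list R := filter (fun t => negb (memb l0 t)) l.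
Definition lunion (l l' : list R) : list R := nodup Req_EM_T (l ++ l').

Lemma in_ldiff l l0 t : In t (ldiff l l0) <-> In t l /\ ~ In t l0.
Proof.
  unfold ldiff, memb. rewrite filter_In. destruct (in_dec Req_EM_T t l0); simpl; intuition congruence.
Qed.

Lemma in_lunion l l' t : In t (lunion l l') <-> In t l \/ In t l'.
Proof. unfold lunion. rewrite nodup_In, in_app_iff. tauto. Qed.

Lemma fp_ldiff A l l0 : finite_part A l -> finite_part A (ldiff l l0).
Proof.
  intros [H K]. split. apply NoDup_filter; trivial. intros t Ht. apply in_ldiff in Ht. apply K, Ht.
Qed.

Lemma fp_lunion A l l' : finite_part A l -> finite_part A l' -> finite_part A (lunion l l').
Proof.
  intros [H K] [H' K']. split. apply NoDup_nodup. intros t Ht. apply in_lunion in Ht. destruct Ht; auto.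
Qed.

Lemma fp_incl A B l : (forall t, A t -> B t) -> finite_part A l -> finite_part B l.
Proof. intros S [H K]. split; auto. Qed.

Lemma fp_nil A : finite_part A [].
Proof. split. constructor. intros t []. Qed.

Lemma perm_ldiff l l0 : NoDup l -> NoDup l0 -> incl l0 l -> Permutation l (l0 ++ ldiff l l0).
Proof.
  intros H K I. apply NoDup_Permutation; trivial.
  - apply NoDup_app; trivial. apply NoDup_filter; trivial.
    intros t Ht Ht'. apply in_ldiff in Ht'. tauto.
  - intros t. rewrite in_app_iff, in_ldiff. split.
    + intros Ht. destruct (in_dec Req_EM_T t l0); tauto.
    + intros [Ht|Ht]; [auto|tauto].
Qed.

Lemma fin_sum_ldiff f l l0 : NoDup l -> NoDup l0 -> incl l0 l ->
  fin_sum f l = (fin_sum f l0 + fin_sum f (ldiff l l0))%C.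
Proof. intros. rewrite (fin_sum_perm f l (l0 ++ ldiff l l0)). apply fin_sum_app. apply perm_ldiff; trivial. Qed.

(** Majorants for the Weierstrass M-test. Sign and bound are required on A only, so a majorant may
    be written by a global formula. *)
Definition summ (A : R -> Prop) (M : R -> R) : Prop :=
  (forall t, A t -> 0 <= M t) /\ exists B, forall l, finite_part A l -> rsum M l <= B.

Lemma abs_summable_summ A f : abs_summable A f -> summ A (fun t => Cmod (f t)).
Proof. intros [B H]. split. intros; apply Cmod_ge_0. exists B. exact H. Qed.

Lemma summ_abs_summable A f M : summ A M -> (forall t, A t -> Cmod (f t) <= M t) -> abs_summable A f.
Proof.
  intros [_ [B H]] K. exists B. intros l Hl. rewrite fin_sum_mod_rsum.
  eapply Rle_trans; [|apply H, Hl]. apply rsum_le. intros t Ht. apply K, Hl, Ht.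
Qed.

Lemma summ_le A M N : summ A N -> (forall t, A t -> 0 <= M t <= N t) -> summ A M.
Proof.
  intros [_ [B H]] K. split. intros t Ht; apply K, Ht. exists B. intros l Hl.
  eapply Rle_trans; [|apply H, Hl]. apply rsum_le. intros t Ht. apply K, Hl, Ht.
Qed.

Lemma summ_scal A M k : 0 <= k -> summ A M -> summ A (fun t => k * M t).
Proof.
  intros Hk [P [B H]]. split. intros t Ht. apply Rmult_le_pos; auto.
  exists (k * B). intros l Hl. rewrite rsum_scal. apply Rmult_le_compat_l; auto.
Qed.

Lemma summ_subset A B M : (forall t, A t -> B t) -> summ B M -> summ A M.
Proof.
  intros S [P [K H]]. split; auto. exists K. intros l Hl. apply H. eapply fp_incl; eauto.
Qed.

Lemma summ_union A B M : summ A M -> summ B M -> summ (fun t => A t \/ B t) M.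
Proof.
  intros [P [K H]] [P' [K' H']]. split. intros t [Ht|Ht]; auto.
  exists (K + K'). intros l [N Hl].
  set (p := fun t => if excluded_middle_informative (A t) then true else false).
  assert (E : rsum M l = rsum M (filter p l) + rsum M (filter (fun t => negb (p t)) l)).
  { clear. induction l; simpl. ring. destruct (p a); simpl; rewrite IHl; ring. }
  rewrite E. apply Rplus_le_compat.
  - apply H. split. apply NoDup_filter; trivial. intros t Ht. apply filter_In in Ht.
    unfold p in Ht. destruct (excluded_middle_informative (A t)); trivial. destruct Ht; discriminate.
  - apply H'. split. apply NoDup_filter; trivial. intros t Ht. apply filter_In in Ht.
    unfold p in Ht. destruct (excluded_middle_informative (A t)); simpl in Ht. destruct Ht; discriminate.
    destruct (Hl t (proj1 Ht)); tauto.
Qed.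

(** Take l0 with sum within e of the supremum of all finite sums: a finite set disjoint from l0 can
    then add at most e. *)
Lemma summ_tail A M : summ A M -> forall e, 0 < e -> exists l0, finite_part A l0 /\
  forall l, finite_part A l -> (forall t, In t l -> ~ In t l0) -> rsum M l <= e.
Proof.
  intros [P [B H]] e He.
  destruct (completeness (fun x => exists l, finite_part A l /\ x = rsum M l)) as [S [S1 S2]].
  - exists B. intros x [l [Hl ->]]. auto.
  - exists 0, []. split. apply fp_nil. reflexivity.
  - assert (N : exists l0, finite_part A l0 /\ S - e < rsum M l0).
    { apply NNPP. intros N. assert (S <= S - e); [|lra]. apply S2. intros x [l [Hl ->]].
      apply Rnot_lt_le. intros K. apply N. eauto. }
    destruct N as [l0 [F0 L0]]. exists l0. split; trivial. intros l [N Hl] D.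
    assert (X : rsum M (l0 ++ l) <= S).
    { apply S1. exists (l0 ++ l). split; trivial. destruct F0 as [N0 Hl0]. split.
      apply NoDup_app; trivial. intros t A1 A2. apply (D t A2 A1).
      intros t Ht. apply in_app_iff in Ht. destruct Ht; auto. }
    rewrite rsum_app in X. lra.
Qed.

Lemma is_usum_unique A f s s' : is_usum A f s -> is_usum A f s' -> s = s'.
Proof.
  intros H K. apply Cmod_lt_0_eq. intros e He.
  destruct (H (e / 2) ltac:(lra)) as [l [F L]]. destruct (K (e / 2) ltac:(lra)) as [l' [F' L']].
  set (m := lunion l l') in *. assert (Hm : finite_part A m) by (apply fp_lunion; trivial).
  assert (I : incl l m) by (intros t Ht; apply in_lunion; tauto).
  assert (I' : incl l' m) by (intros t Ht; apply in_lunion; tauto).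
  specialize (L m Hm I). specialize (L' m Hm I').
  assert (T := Cmod_triangle3 s (fin_sum f m) s').
  rewrite (Cmod_minus_sym s (fin_sum f m)) in T. lra.
Qed.

Lemma usum_unique A f s : is_usum A f s -> usum A f = s.
Proof.
  intros H. apply (iota_unique (V := C_R_CompleteNormedModule)); trivial.
  intros y Hy. eapply is_usum_unique; eassumption.
Qed.

(** The finite subsets containing a given one generate a proper filter; by the tail estimate the
    partial sums are Cauchy along it, and C is complete. *)
Lemma is_usum_exists A f : abs_summable A f -> exists s, is_usum A f s.
Proof.
  intros Hs. assert (T := summ_tail _ _ (abs_summable_summ _ _ Hs)).
  set (F := fun P : C -> Prop => exists l0, finite_part A l0 /\
     forall l, finite_part A l -> incl l0 l -> P (fin_sum f l)).
  assert (PF : ProperFilter F).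
  { constructor.
    - intros P [l0 [H K]]. exists (fin_sum f l0). apply K; trivial. apply incl_refl.
    - constructor.
      + exists []. split. apply fp_nil. trivial.
      + intros P Q [l [H K]] [l' [H' K']]. exists (lunion l l'). split. apply fp_lunion; trivial.
        intros m Hm I. split; [apply K|apply K']; trivial; intros t Ht; apply I, in_lunion; tauto.
      + intros P Q S [l [H K]]. exists l. split; auto. }
  assert (CF : @cauchy C_R_CompleteNormedModule F).
  { intros [e He]. destruct (T (e / 2) ltac:(lra)) as [l0 [F0 H0]].
    exists (fin_sum f l0), l0. split; trivial. intros l Hl I.
    apply (norm_compat1 (V := C_R_NormedModule)). rewrite norm_CR.
    change (Cmod (fin_sum f l - fin_sum f l0) < e).
    rewrite (fin_sum_ldiff f l l0) by (apply Hl || apply F0 || trivial).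
    replace (fin_sum f l0 + fin_sum f (ldiff l l0) - fin_sum f l0)%C with (fin_sum f (ldiff l l0)) by ring.
    eapply Rle_lt_trans. apply Cmod_fin_sum. intros; apply Rle_refl.
    apply Rle_lt_trans with (e / 2). 2: lra. apply H0. apply fp_ldiff; trivial.
    intros t Ht. apply in_ldiff in Ht. tauto. }
  exists (@lim C_R_CompleteNormedModule F). intros e He.
  (* Completeness yields closeness in the uniform structure; [norm_factor] converts it into a bound
     for the modulus. *)
  set (k := @norm_factor R_AbsRing C_R_NormedModule).
  assert (K0 : 0 < k) by apply norm_factor_gt_0.
  assert (He' : 0 < e / 2 / k) by (apply Rdiv_lt_0_compat; lra).
  destruct (complete_cauchy (T := C_R_CompleteNormedModule) F PF CF (mkposreal _ He')) as [l0 [H0 K]].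
  exists l0. split; trivial. intros l Hl I. specialize (K l Hl I).
  apply (norm_compat2 (V := C_R_NormedModule)) in K. rewrite norm_CR in K. simpl in K.
  eapply Rlt_le_trans. exact K. fold k. apply Rle_trans with (e / 2); [right; field; lra|lra].
Qed.

Lemma usum_correct A f : abs_summable A f -> is_usum A f (usum A f).
Proof. intros H. destruct (is_usum_exists _ _ H) as [s Hs]. rewrite (usum_unique _ _ _ Hs). exact Hs. Qed.

Lemma is_usum_ext A f g s : (forall t, A t -> f t = g t) -> is_usum A f s -> is_usum A g s.
Proof.
  intros E H e He. destruct (H e He) as [l0 [F K]]. exists l0. split; trivial.
  intros l Hl I. rewrite <- (fin_sum_ext f g). auto. intros t Ht. apply E, Hl, Ht.
Qed.

(** Valid without summability: both sides are [iota] of the same predicate. *)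
Lemma usum_ext A f g : (forall t, A t -> f t = g t) -> usum A f = usum A g.
Proof.
  intros E. unfold usum. f_equal. apply functional_extensionality. intros s.
  apply propositional_extensionality. split; apply is_usum_ext; auto.
  intros; symmetry; auto.
Qed.

Lemma is_usum_plus A f g s t : is_usum A f s -> is_usum A g t -> is_usum A (fun x => f x + g x)%C (s + t).
Proof.
  intros H K e He.
  destruct (H (e / 2) ltac:(lra)) as [l [F L]]. destruct (K (e / 2) ltac:(lra)) as [l' [F' L']].
  exists (lunion l l'). split. apply fp_lunion; trivial. intros m Hm I.
  rewrite fin_sum_plus.
  replace (fin_sum f m + fin_sum g m - (s + t))%C with ((fin_sum f m - s) + (fin_sum g m - t))%C by ring.
  eapply Rle_lt_trans. apply Cmod_triangle.
  specialize (L m Hm (fun t Ht => I t (proj2 (in_lunion _ _ _) (or_introl Ht)))).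
  specialize (L' m Hm (fun t Ht => I t (proj2 (in_lunion _ _ _) (or_intror Ht)))). lra.
Qed.

Lemma is_usum_scal A k f s : is_usum A f s -> is_usum A (fun x => k * f x)%C (k * s).
Proof.
  intros H e He. assert (K0 := Cmod_ge_0 k).
  destruct (H (e / (Cmod k + 1))) as [l [F L]]. apply Rdiv_lt_0_compat; lra.
  exists l. split; trivial. intros m Hm I. rewrite fin_sum_scal.
  replace (k * fin_sum f m - k * s)%C with (k * (fin_sum f m - s))%C by ring.
  rewrite Cmod_mult. specialize (L m Hm I). apply Rlt_div_r in L; [|lra].
  nra.
Qed.

Lemma is_usum_minus A f g s t : is_usum A f s -> is_usum A g t -> is_usum A (fun x => f x - g x)%C (s - t).
Proof.
  intros H K. apply (is_usum_scal _ (- (1))) in K.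
  replace (s - t)%C with (s + - (1) * t)%C by ring.
  eapply is_usum_ext; [|apply (is_usum_plus _ _ _ _ _ H K)]. intros; simpl; ring.
Qed.

(** Extension by zero brings sums over different index sets to a common one, where they can be
    added. *)
Definition ext0 (A : R -> Prop) (f : R -> C) (t : R) : C :=
  if excluded_middle_informative (A t) then f t else 0.

Lemma ext0_in A f t : A t -> ext0 A f t = f t.
Proof. intros H. unfold ext0. destruct (excluded_middle_informative (A t)); tauto. Qed.
Lemma ext0_out A f t : ~ A t -> ext0 A f t = 0.
Proof. intros H. unfold ext0. destruct (excluded_middle_informative (A t)); tauto. Qed.

Lemma is_usum_ext0 A B f s : (forall t, A t -> B t) -> is_usum A f s -> is_usum B (ext0 A f) s.
Proof.
  intros S H e He. destruct (H e He) as [l0 [F K]]. exists l0. split. eapply fp_incl; eauto.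
  intros l Hl I.
  set (p := fun t => if excluded_middle_informative (A t) then true else false).
  assert (E : fin_sum (ext0 A f) l = fin_sum f (filter p l)).
  { clear. induction l; simpl; trivial. rewrite IHl. unfold p, ext0.
    destruct (excluded_middle_informative (A a)); simpl. reflexivity. ring. }
  rewrite E. apply K.
  - split. apply NoDup_filter, Hl. intros t Ht. apply filter_In in Ht.
    unfold p in Ht. destruct (excluded_middle_informative (A t)); trivial. destruct Ht; discriminate.
  - intros t Ht. apply filter_In. split. auto. unfold p.
    destruct (excluded_middle_informative (A t)) as [|N]; trivial. destruct N. apply F, Ht.
Qed.

Lemma is_usum_single A (f : R -> C) (a : R) : A a -> (forall t, A t -> t <> a -> f t = 0) -> is_usum A f (f a).
Proof.
  intros Ha Hz e He. exists [a]. split.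
  { split. constructor; [intros []|constructor]. intros t [<-|[]]; trivial. }
  intros l Hl I. rewrite (fin_sum_ldiff f l [a]); trivial. 2: apply Hl.
  2: constructor; [intros []|constructor].
  replace (fin_sum f (ldiff l [a])) with (RtoC 0).
  { simpl. replace (f a + 0 + 0 - f a)%C with (RtoC 0) by ring. rewrite Cmod_0; trivial. }
  symmetry. transitivity (fin_sum (fun _ => RtoC 0) (ldiff l [a])).
  - apply fin_sum_ext. intros t Ht. apply in_ldiff in Ht. apply Hz. apply Hl, Ht.
    intros ->. apply Ht. left; trivial.
  - induction (ldiff l [a]); simpl; trivial. rewrite IHl0. ring.
Qed.

(** Isolates the finitely many poles near a bounded region, the rest of the series being uniformly
    dominated there. *)
Lemma is_usum_remove A f s L : finite_part A L ->
  is_usum (fun t => A t /\ ~ In t L) f s <-> is_usum A f (s + fin_sum f L).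
Proof.
  intros HL. split; intros H e He; destruct (H e He) as [l0 [F K]].
  - exists (lunion l0 L). split.
    { apply fp_lunion; trivial. eapply fp_incl; [|exact F]. simpl; tauto. }
    intros l Hl I. rewrite (fin_sum_ldiff f l L); try apply Hl; try apply HL.
    2: intros t Ht; apply I, in_lunion; tauto.
    replace (fin_sum f L + fin_sum f (ldiff l L) - (s + fin_sum f L))%C with (fin_sum f (ldiff l L) - s)%C by ring.
    apply K.
    + split. apply NoDup_filter, Hl. intros t Ht. apply in_ldiff in Ht. split. apply Hl, Ht. apply Ht.
    + intros t Ht. apply in_ldiff. split. apply I, in_lunion; tauto. apply F in Ht. tauto.
  - exists (ldiff l0 L). split.
    { split. apply NoDup_filter, F. intros t Ht. apply in_ldiff in Ht. split. apply F, Ht. apply Ht. }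
    intros l Hl I.
    assert (X : finite_part A (L ++ l)).
    { split. apply NoDup_app. apply HL. apply Hl. intros t A1 A2. apply Hl in A2. tauto.
      intros t Ht. apply in_app_iff in Ht. destruct Ht. apply HL; trivial. apply Hl; trivial. }
    specialize (K _ X). rewrite fin_sum_app in K.
    replace (fin_sum f l - s)%C with (fin_sum f L + fin_sum f l - (s + fin_sum f L))%C by ring.
    apply K. intros t Ht. apply in_app_iff. destruct (in_dec Req_EM_T t L). tauto.
    right. apply I. apply in_ldiff. tauto.
Qed.

(** The finite set depends on M and e alone and thus serves all values of a parameter at once. *)
Lemma usum_dominated A M : summ A M -> forall e, 0 < e -> exists l0, finite_part A l0 /\
  forall f s l, (forall t, A t -> Cmod (f t) <= M t) -> is_usum A f s ->
    finite_part A l -> incl l0 l -> Cmod (s - fin_sum f l) <= e.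
Proof.
  intros HM e He. destruct (summ_tail A M HM e He) as [l0 [F0 T]]. exists l0. split; trivial.
  intros f s l Hf Hs Hl I. apply Rnot_lt_le. intros N.
  destruct (Hs (Cmod (s - fin_sum f l) - e) ltac:(lra)) as [l1 [F1 K]].
  specialize (K (lunion l1 l) (fp_lunion _ _ _ F1 Hl) ltac:(intros t Ht; apply in_lunion; tauto)).
  assert (U : finite_part A (lunion l1 l)) by (apply fp_lunion; trivial).
  rewrite (fin_sum_ldiff f _ l) in K; [|apply U|apply Hl|intros t Ht; apply in_lunion; tauto].
  assert (B : Cmod (fin_sum f (ldiff (lunion l1 l) l)) <= e).
  { eapply Rle_trans. apply Cmod_fin_sum with (M := M).
    intros t Ht. apply Hf. apply in_ldiff in Ht. apply U, Ht.
    apply T. apply fp_ldiff; trivial. intros t Ht Ht'. apply in_ldiff in Ht. apply Ht, I, Ht'. }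
  set (x := fin_sum f (ldiff (lunion l1 l) l)) in *.
  assert (Tr := Cmod_triangle (s - fin_sum f l - x) x).
  replace (s - fin_sum f l - x + x)%C with (s - fin_sum f l)%C in Tr by ring.
  replace (fin_sum f l + x - s)%C with (- (s - fin_sum f l - x))%C in K by ring.
  rewrite Cmod_opp in K. lra.
Qed.

Lemma usum_bound A M f s B : (forall l, finite_part A l -> rsum M l <= B) ->
  (forall t, A t -> Cmod (f t) <= M t) -> is_usum A f s -> Cmod s <= B.
Proof.
  intros HB Hf Hs. apply Rnot_lt_le. intros N.
  destruct (Hs (Cmod s - B) ltac:(lra)) as [l [F K]]. specialize (K l F (incl_refl l)).
  assert (X : Cmod (fin_sum f l) <= B).
  { eapply Rle_trans. apply Cmod_fin_sum with (M := M). intros; apply Hf, F; trivial. auto. }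
  assert (T := Cmod_triangle_rev s (fin_sum f l)). rewrite Cmod_minus_sym in T. lra.
Qed.

Lemma cder_fin_sum (f : R -> C -> C) l z : (forall t, In t l -> cder (f t) z) ->
  cder (fun z => fin_sum (fun t => f t z) l) z.
Proof.
  induction l; simpl; intros H. apply cder_const. apply cder_plus; auto.
Qed.

Lemma usum_cder A M (f : R -> C -> C) p r : summ A M -> 0 < r ->
  (forall t z, A t -> Cmod (z - p) < r -> cder (f t) z /\ Cmod (f t z) <= M t) ->
  cder (fun z => usum A (fun t => f t z)) p.
Proof.
  intros HM Hr H. apply uniform_limit_cder with r; trivial. intros e He.
  destruct (usum_dominated A M HM e He) as [l0 [F0 K]].
  exists (fun z => fin_sum (fun t => f t z) l0). split.
  - intros z Hz. apply cder_fin_sum. intros t Ht. apply H; trivial. apply F0; trivial.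
  - intros z Hz. rewrite Cmod_minus_sym.
    assert (X : forall t, A t -> Cmod (f t z) <= M t) by (intros t Ht; apply H; trivial).
    apply (K (fun t => f t z)); trivial; [|apply incl_refl].
    apply usum_correct. eapply summ_abs_summable; eauto.
Qed.

Lemma is_CI_fin_sum (f : R -> R -> C) (v : R -> C) a b l : (forall t, In t l -> is_CI (f t) a b (v t)) ->
  is_CI (fun s => fin_sum (fun t => f t s) l) a b (fin_sum v l).
Proof.
  induction l; simpl; intros H.
  - assert (X := is_CI_const 0 a b). replace (RtoC (b - a) * 0)%C with (RtoC 0) in X by ring. exact X.
  - apply is_CI_plus; auto.
Qed.

Lemma rcont_fin_sum (f : R -> R -> C) l s : (forall t, In t l -> rcont (f t) s) ->
  rcont (fun s => fin_sum (fun t => f t s) l) s.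
Proof.
  induction l; simpl; intros H. apply rcont_const. apply rcont_plus; auto.
Qed.

Lemma rcont_usum A M (f : R -> R -> C) s r : summ A M -> 0 < r ->
  (forall t y, A t -> Rabs (y - s) < r -> Cmod (f t y) <= M t) ->
  (forall t, A t -> rcont (f t) s) ->
  rcont (fun s => usum A (fun t => f t s)) s.
Proof.
  intros HM Hr Hb Hc e He.
  destruct (usum_dominated A M HM (e / 3) ltac:(lra)) as [l0 [F0 K]].
  destruct (rcont_fin_sum f l0 s ltac:(intros; apply Hc, F0; trivial) (e / 3) ltac:(lra)) as [d [Hd D]].
  exists (Rmin d r). split. apply Rmin_pos; trivial. intros y Hy.
  specialize (D y (Rlt_le_trans _ _ _ Hy (Rmin_l _ _))).
  assert (Hy2 := Rlt_le_trans _ _ _ Hy (Rmin_r _ _)).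
  assert (Hs : Rabs (s - s) < r) by (rewrite Rminus_diag, Rabs_R0; trivial).
  assert (X : forall y, Rabs (y - s) < r -> Cmod (usum A (fun t => f t y) - fin_sum (fun t => f t y) l0) <= e / 3).
  { intros x Hx. apply (K (fun t => f t x)); auto; [|apply incl_refl].
    apply usum_correct. eapply summ_abs_summable; eauto. }
  assert (X1 := X y Hy2). assert (X2 := X s Hs).
  set (a := usum A (fun t => f t y)) in *. set (b := usum A (fun t => f t s)) in *.
  set (a' := fin_sum (fun t => f t y) l0) in *. set (b' := fin_sum (fun t => f t s) l0) in *.
  assert (T1 := Cmod_triangle3 a a' b). assert (T2 := Cmod_triangle3 a' b' b).
  rewrite (Cmod_minus_sym b' b) in T2. simpl in D. change (Cmod (a' - b') < e / 3) in D. lra.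
Qed.


(** The domination reaches one unit beyond [a, b] because continuity of the sum at an endpoint needs
    a two-sided neighbourhood. *)
Lemma is_CI_usum A M (f : R -> R -> C) (v : R -> C) a b : summ A M -> a <= b ->
  (forall t s, A t -> rcont (f t) s) ->
  (forall t s, A t -> a - 1 < s < b + 1 -> Cmod (f t s) <= M t) ->
  (forall t, A t -> is_CI (f t) a b (v t)) ->
  exists s, is_usum A v s /\ is_CI (fun s => usum A (fun t => f t s)) a b s.
Proof.
  intros HM Hab Hc Hb Hv.
  assert (EX : ex_CI (fun s => usum A (fun t => f t s)) a b).
  { apply ex_CI_cont; trivial. intros s Hs. apply (rcont_usum A M f s 1); auto. lra.
    intros t y Ht Hy. apply Hb; trivial. apply Rabs_lt_between in Hy. lra. }
  destruct EX as [s Hs]. exists s. split; trivial.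
  intros e He.
  destruct (usum_dominated A M HM (e / 2 / (b - a + 1))) as [l0 [F0 K]].
  { apply Rdiv_lt_0_compat; lra. }
  exists l0. split; trivial. intros l Hl I.
  assert (J := is_CI_minus _ _ _ _ _ _ (is_CI_fin_sum f v a b l ltac:(intros; apply Hv, Hl; trivial)) Hs).
  apply is_CI_bound with (M := e / 2 / (b - a + 1)) in J; trivial.
  - eapply Rle_lt_trans. exact J.
    apply Rle_lt_trans with (e / 2). 2: lra.
    replace ((b - a) * (e / 2 / (b - a + 1))) with (e / 2 * ((b - a) / (b - a + 1))) by (field; lra).
    rewrite <- (Rmult_1_r (e / 2)) at 2. apply Rmult_le_compat_l. lra. apply Rle_div_l; lra.
  - intros y Hy. rewrite Cmod_minus_sym.
    assert (X : forall t, A t -> Cmod (f t y) <= M t) by (intros t Ht; apply Hb; trivial; lra).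
    apply (K (fun t => f t y)); trivial.
    apply usum_correct. eapply summ_abs_summable; eauto.
Qed.

(** * The identity theorem for meromorphic functions *)

Definition holo_at (f : C -> C) (p : C) : Prop :=
  exists r, 0 < r /\ forall z, Cmod (z - p) < r -> cder f z.

(* Unlike [meromorphic], this ignores the value at p. *)
Definition mero_at (f : C -> C) (p : C) : Prop :=
  exists (n : nat) (phi : C -> C) (r : R), 0 < r /\
    (forall z, Cmod (z - p) < r -> cder phi z) /\
    forall z, 0 < Cmod (z - p) < r -> ((z - p) ^ n * f z)%C = phi z.

(** Punctured, since the value at a pole carries no information. *)
Definition null_near (f : C -> C) (p : C) : Prop :=
  exists r, 0 < r /\ forall z, 0 < Cmod (z - p) < r -> f z = 0.

Lemma holomorphic_at_holo f p : holomorphic_at f p <-> holo_at f p.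
Proof.
  split; intros [r [Hr H]]; exists r; split; trivial; intros z Hz; apply ex_derive_cder; auto.
Qed.

Lemma holo_mero f p : holo_at f p -> mero_at f p.
Proof.
  intros [r [Hr H]]. exists 0%nat, f, r. repeat split; trivial. intros; simpl; ring.
Qed.

Lemma meromorphic_mero f : meromorphic f -> forall p, mero_at f p.
Proof.
  intros H p. destruct (H p) as [K|(n & phi & r & _ & K1 & _ & Hr & K2)].
  - apply holo_mero, holomorphic_at_holo; trivial.
  - apply holomorphic_at_holo in K1. destruct K1 as [r' [Hr' K1]].
    exists n, phi, (Rmin r r'). split. apply Rmin_pos; trivial. split.
    + intros z Hz. apply K1. eapply Rlt_le_trans. exact Hz. apply Rmin_r.
    + intros z [Z1 Z2]. rewrite K2. 2: split; trivial; eapply Rlt_le_trans; [exact Z2|apply Rmin_l].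
      field. apply Cpow_nz. apply Cmod_gt_0; trivial.
Qed.

Lemma mero_minus f g p : mero_at f p -> mero_at g p -> mero_at (fun z => f z - g z)%C p.
Proof.
  intros (n & phi & r & Hr & P1 & P2) (m & psi & r' & Hr' & Q1 & Q2).
  exists (n + m)%nat, (fun z => (z - p) ^ m * phi z - (z - p) ^ n * psi z)%C, (Rmin r r').
  split. apply Rmin_pos; trivial. split.
  - intros z Hz. split_min Hz Z1 Z2.
    assert (D : forall k, cder (fun z => (z - p) ^ k)%C z).
    { intros k. apply (cder_pow (fun z => z - p)%C). apply cder_minus. apply cder_id. apply cder_const. }
    apply cder_minus; apply cder_mult; auto.
  - intros z [Z0 Hz]. split_min Hz Z1 Z2.
    rewrite <- P2, <- Q2 by (split; trivial). rewrite Cpow_add_r. ring.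
Qed.

Lemma mero_identity f p : mero_at f p ->
  (forall e, 0 < e -> exists w, 0 < Cmod (w - p) < e /\ f w = 0) -> null_near f p.
Proof.
  intros (n & phi & r & Hr & P1 & P2) H.
  destruct (local_identity phi p r Hr P1) as [r' [Hr' K]].
  - intros e He. destruct (H (Rmin e r)) as [w [Hw E]]. apply Rmin_pos; trivial.
    assert (Z1 := Rlt_le_trans _ _ _ (proj2 Hw) (Rmin_l _ _)). assert (Z2 := Rlt_le_trans _ _ _ (proj2 Hw) (Rmin_r _ _)).
    exists w. split. lra. rewrite <- P2, E by lra. ring.
  - exists (Rmin r r'). split. apply Rmin_pos; trivial. intros z [Z0 Hz].
    split_min Hz Z1 Z2.
    specialize (P2 z ltac:(lra)). rewrite (K z Z2) in P2.
    assert (N : ((z - p) ^ n)%C <> 0) by (apply Cpow_nz, Cmod_gt_0; trivial).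
    destruct (Ceq_dec (f z) 0) as [X|X]; trivial. exfalso. revert P2. apply Cmult_neq_0; trivial.
Qed.

Lemma null_near_punctured (f : C -> C) p r : (forall z, 0 < Cmod (z - p) < r -> f z = 0) ->
  forall q, 0 < Cmod (q - p) < r -> null_near f q.
Proof.
  intros H q Hq. exists (Rmin (Cmod (q - p)) (r - Cmod (q - p))).
  split. apply Rmin_pos; lra. intros z [_ Hz].
  split_min Hz Z1 Z2.
  apply H. assert (T1 := Cmod_triangle3 z q p). assert (T2 := Cmod_triangle3 q z p).
  rewrite (Cmod_minus_sym q z) in T2. lra.
Qed.

Lemma point_at_distance (p : C) d : 0 <= d -> Cmod (p + RtoC d - p) = d.
Proof.
  intros H. replace (p + RtoC d - p)%C with (RtoC d) by ring. rewrite Cmod_R. apply Rabs_pos_eq; trivial.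
Qed.

(** Continuation along a segment. Let m be the supremum of the parameters up to which f is null near
    [g s]. Zeros accumulate at [g m], so f is null near [g m], and then a little beyond: hence m =
    1. *)
Lemma identity_segment f (p q : C) :
  (forall s : R, 0 <= s <= 1 -> mero_at f (p + s * (q - p))%C) ->
  null_near f p -> null_near f q.
Proof.
  intros HM H0.
  destruct (Ceq_dec p q) as [<-|N]; trivial.
  assert (D0 : 0 < Cmod (q - p)). { apply Cmod_gt_0. apply Cminus_neq_0. congruence. }
  set (g := fun s : R => (p + s * (q - p))%C).
  assert (GD : forall s s', Cmod (g s - g s') = Rabs (s - s') * Cmod (q - p)).
  { intros s s'. unfold g. replace (p + s * (q - p) - (p + s' * (q - p)))%C with (RtoC (s - s') * (q - p))%C.
    rewrite Cmod_mult, Cmod_R; trivial. rewrite RtoC_minus. ring. }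
  assert (G0 : g 0 = p) by (unfold g; ring). assert (G1 : g 1 = q) by (unfold g; ring).
  destruct (completeness (fun s => 0 <= s <= 1 /\ forall s', 0 <= s' <= s -> null_near f (g s'))) as [m [M1 M2]].
  - exists 1. intros s [Hs _]. lra.
  - exists 0. split. lra. intros s' Hs'. replace s' with 0 by lra. rewrite G0; trivial.
  - assert (B0 : 0 <= m). { apply M1. split. lra. intros s' Hs'. replace s' with 0 by lra. rewrite G0; trivial. }
    assert (B1 : m <= 1). { apply M2. intros s [Hs _]. lra. }
    assert (BL : forall s, 0 <= s < m -> null_near f (g s)).
    { intros s Hs. apply NNPP. intros K. assert (m <= s); [|lra]. apply M2. intros t [Ht HH].
      apply Rnot_lt_le. intros L. apply K, HH. lra. }
    assert (Em : null_near f (g m)).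
    { destruct (Req_dec m 0) as [->|Nm]. rewrite G0; trivial.
      apply mero_identity. apply HM. lra. intros e He.
      set (s := Rmax 0 (m - e / 2 / Cmod (q - p))).
      assert (Q : 0 < e / 2 / Cmod (q - p)) by (apply Rdiv_lt_0_compat; lra).
      assert (S1 : 0 <= s < m). { unfold s. split. apply Rmax_l. apply Rmax_lub_lt; lra. }
      assert (S2 : m - s <= e / 2 / Cmod (q - p)). { assert (X := Rmax_r 0 (m - e / 2 / Cmod (q - p))). fold s in X. lra. }
      assert (DS : 0 < Cmod (g s - g m) <= e / 2).
      { rewrite GD, Rabs_left by lra. split. apply Rmult_lt_0_compat; lra. apply Rle_div_r in S2; lra. }
      destruct (BL s S1) as [r [Hr K]].
      (* The point [g s] may itself be a singularity with an arbitrary value, so the zero is taken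
         beside it, still away from [g m]. *)
      set (d := Rmin (r / 2) (Cmod (g s - g m) / 2)).
      assert (Dd : 0 < d) by (apply Rmin_pos; lra).
      assert (d1 : d <= r / 2) by apply Rmin_l. assert (d2 : d <= Cmod (g s - g m) / 2) by apply Rmin_r.
      exists (g s + RtoC d)%C. assert (X := point_at_distance (g s) d ltac:(lra)). split.
      - assert (T1 := Cmod_triangle3 (g s + RtoC d) (g s) (g m)). assert (T2 := Cmod_triangle3 (g s) (g s + RtoC d) (g m)).
        rewrite (Cmod_minus_sym (g s) (g s + RtoC d)) in T2. lra.
      - apply K. lra. }
    destruct (Req_dec m 1) as [->|Nm]. rewrite <- G1; trivial.
    exfalso. destruct Em as [r [Hr K]].
    set (d := Rmin (1 - m) (r / 2 / Cmod (q - p))).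
    assert (Q : 0 < r / 2 / Cmod (q - p)) by (apply Rdiv_lt_0_compat; lra).
    assert (Dd : 0 < d) by (apply Rmin_pos; lra).
    assert (d1 : d <= 1 - m) by apply Rmin_l. assert (d2 : d <= r / 2 / Cmod (q - p)) by apply Rmin_r.
    assert (m + d <= m); [|lra]. apply M1. split. lra. intros s' Hs'.
    destruct (Rlt_le_dec s' m) as [L|L]. apply BL; lra.
    destruct (Req_dec s' m) as [->|NE]. exists r. split; trivial.
    apply (null_near_punctured f (g m) r); trivial. rewrite GD, Rabs_pos_eq by lra.
    split. apply Rmult_lt_0_compat; lra. apply Rle_div_r in d2; [|lra]. nra.
Qed.

Lemma null_near_ccont f p : ccont f p -> null_near f p -> f p = 0.
Proof.
  intros Hc [r [Hr H]]. apply ccont_zero; trivial. intros e He.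
  assert (0 < Rmin e r) by (apply Rmin_pos; trivial).
  assert (Rmin e r <= e) by apply Rmin_l. assert (Rmin e r <= r) by apply Rmin_r.
  assert (X := point_at_distance p (Rmin e r / 2) ltac:(lra)).
  exists (p + RtoC (Rmin e r / 2))%C. split. lra. apply H. lra.
Qed.

(** Source of the local finiteness of La. Zeros of G are isolated by the identity theorem; a
    supremum argument along [a, b] replaces compactness. *)
Lemma entire_zeros_locally_finite (G : C -> C) : (forall z, cder G z) -> (exists z, G z <> RtoC 0) ->
  forall a b : R, exists l : list R, forall t, G (RtoC t) = 0 -> a <= t <= b -> In t l.
Proof.
  intros HG [z0 Hz0] a b.
  assert (M : forall p, mero_at G p). { intros p. apply holo_mero. exists 1. split. lra. auto. }
  assert (I : forall p, exists r, 0 < r /\ forall z, 0 < Cmod (z - p) < r -> G z <> 0).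
  { intros p. apply NNPP. intros N. apply Hz0. apply null_near_ccont. apply cder_ccont; auto.
    apply identity_segment with p. auto. apply mero_identity; trivial. intros e He.
    apply NNPP. intros K. apply N. exists e. split; trivial. intros z Hz E. apply K. eauto. }
  destruct (Rlt_le_dec b a) as [L|L]. { exists []. intros; lra. }
  destruct (completeness (fun x => a <= x <= b /\ exists l : list R, forall t, G (RtoC t) = 0 -> a <= t <= x -> In t l)) as [m [M1 M2]].
  - exists b. intros x [Hx _]. lra.
  - exists a. split. lra. exists [a]. intros t _ Ht. left. lra.
  - assert (B0 : a <= m). { apply M1. split. lra. exists [a]. intros t _ Ht. left. lra. }
    assert (B1 : m <= b). { apply M2. intros s [Hs _]. lra. }
    destruct (I (RtoC m)) as [r [Hr K]].
    assert (X : exists x l, m - r < x /\ forall t, G (RtoC t) = 0 -> a <= t <= x -> In t l).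
    { apply NNPP. intros N. assert (m <= m - r); [|lra]. apply M2. intros x [Hx [l Hl]].
      apply Rnot_lt_le. intros Q. apply N. eauto. }
    destruct X as (x & l & Hx & Hl).
    assert (Y : forall t, G (RtoC t) = 0 -> a <= t < m + r -> In t (m :: l)).
    { intros t Ht Q. destruct (Req_dec t m) as [->|Nt]. left; trivial. right. apply Hl; trivial.
      split. lra. apply Rnot_lt_le. intros W. apply (K (RtoC t)); trivial.
      rewrite <- RtoC_minus, Cmod_R. split. apply Rabs_pos_lt. lra. apply Rabs_lt_between. lra. }
    destruct (Rlt_le_dec b (m + r)) as [W|W].
    + exists (m :: l). intros t Ht Q. apply Y; trivial. lra.
    + exfalso. assert (m + r / 2 <= m); [|lra]. apply M1. split. lra. exists (m :: l).
      intros t Ht Q. apply Y; trivial. lra.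
Qed.

(** * Integrals over horizontal lines *)

(** Both ends tend to infinity independently, as in [RInt_gen]. The line integrals below all have a
    majorant K / (1 + t^2). *)
Definition is_LI (f : R -> C) (l : C) : Prop :=
  forall e, 0 < e -> exists M, 0 < M /\ forall a b, a < - M -> M < b ->
    exists v, is_CI f a b v /\ Cmod (v - l) < e.

Definition LI (f : R -> C) : C :=
  RInt_gen (V := C_R_CompleteNormedModule) f (Rbar_locally m_infty) (Rbar_locally p_infty).

Lemma is_LI_unique f l : is_LI f l -> LI f = l.
Proof.
  intros H. unfold LI.
  assert (G : is_RInt_gen (V := C_R_CompleteNormedModule) f (Rbar_locally m_infty) (Rbar_locally p_infty) l).
  2: exact (@is_RInt_gen_unique C_R_CompleteNormedModule _ _ (Proper_StrongProper _ (Rbar_locally_filter _)) (Proper_StrongProper _ (Rbar_locally_filter _)) f l G).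
  intros P [[e He] HP]. destruct (H e He) as [M [_ HM]].
  apply (Filter_prod _ _ _ (fun a => a < - M) (fun b => M < b)).
  - exists (- M). trivial.
  - exists M. trivial.
  - intros a b Ha Hb. destruct (HM a b Ha Hb) as [v [Hv Dv]]. exists v. split; trivial.
    apply HP. apply (norm_compat1 (V := C_R_NormedModule)). rewrite norm_CR. exact Dv.
Qed.

Lemma is_LI_plus f g u v : is_LI f u -> is_LI g v -> is_LI (fun t => f t + g t)%C (u + v).
Proof.
  intros H K e He. destruct (H (e / 2) ltac:(lra)) as [M [M0 HM]]. destruct (K (e / 2) ltac:(lra)) as [N [N0 HN]].
  exists (Rmax M N). split. apply Rlt_le_trans with M; trivial. apply Rmax_l.
  assert (X := Rmax_l M N). assert (Y := Rmax_r M N). intros a b Ha Hb.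
  destruct (HM a b ltac:(lra) ltac:(lra)) as [v1 [I1 D1]]. destruct (HN a b ltac:(lra) ltac:(lra)) as [v2 [I2 D2]].
  exists (v1 + v2)%C. split. apply is_CI_plus; trivial.
  replace (v1 + v2 - (u + v))%C with ((v1 - u) + (v2 - v))%C by ring.
  eapply Rle_lt_trans. apply Cmod_triangle. lra.
Qed.

Lemma is_LI_scal k f u : is_LI f u -> is_LI (fun t => k * f t)%C (k * u).
Proof.
  intros H e He. assert (K0 := Cmod_ge_0 k).
  destruct (H (e / (Cmod k + 1))) as [M [M0 HM]]. apply Rdiv_lt_0_compat; lra.
  exists M. split; trivial. intros a b Ha Hb. destruct (HM a b Ha Hb) as [v [I D]].
  exists (k * v)%C. split. apply is_CI_scal; trivial.
  replace (k * v - k * u)%C with (k * (v - u))%C by ring. rewrite Cmod_mult.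
  apply Rlt_div_r in D; [|lra]. nra.
Qed.

Lemma is_LI_ext f g u : (forall t, f t = g t) -> is_LI f u -> is_LI g u.
Proof.
  intros E H. replace g with f; trivial. apply functional_extensionality; trivial.
Qed.

Lemma cauchy_bound_int K a b : is_RInt (fun t => K / (1 + t * t)) a b (K * (atan b - atan a)).
Proof.
  replace (K * (atan b - atan a)) with (@minus R_AbelianGroup (K * atan b) (K * atan a))
    by (unfold minus, plus, opp; simpl; ring).
  assert (P : forall t, 0 < 1 + t * t). { intros t. assert (X := Rle_0_sqr t). unfold Rsqr in X. lra. }
  apply (is_RInt_derive (V := R_CompleteNormedModule) (fun t => K * atan t)).
  - intros x _. auto_derive; trivial. specialize (P x). field. lra.
  - intros x _. apply (ex_derive_continuous (V := R_NormedModule)). auto_derive. specialize (P x). lra.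
Qed.

(** The tail beyond M is at most pi/2 - atan M = atan (1/M) <= 1/M. *)
Lemma atan_tail M b b' : 0 < M -> M < b -> b <= b' -> 0 <= atan b' - atan b <= / M.
Proof.
  intros HM Hb Hb'. split.
  - destruct Hb' as [L | ->]. assert (X := atan_increasing _ _ L). lra. lra.
  - destruct Hb' as [L | ->]. 2: { rewrite Rminus_diag. left. apply Rinv_0_lt_compat; trivial. }
    destruct (MVT_gen atan b b' (fun t => / (1 + t ^ 2))) as [c [Hc E]].
    + intros x _. apply is_derive_Reals. apply derivable_pt_lim_atan.
    + intros x _. apply continuity_pt_filterlim. apply (ex_derive_continuous (V := R_NormedModule)). eexists. apply is_derive_Reals, derivable_pt_lim_atan.
    + assert (X := atan_bound b').
      assert (Y : atan (/ M) = PI / 2 - atan M) by (apply atan_inv; trivial).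
      assert (Z := atan_increasing _ _ Hb).
      assert (W : atan (/ M) <= / M).
      { assert (Q : 0 < / M) by (apply Rinv_0_lt_compat; trivial).
        destruct (MVT_gen atan 0 (/ M) (fun t => / (1 + t ^ 2))) as [c' [Hc' E']].
        - intros x _. apply is_derive_Reals. apply derivable_pt_lim_atan.
        - intros x _. apply continuity_pt_filterlim. apply (ex_derive_continuous (V := R_NormedModule)). eexists. apply is_derive_Reals, derivable_pt_lim_atan.
        - rewrite atan_0 in E'. assert (S := pow2_ge_0 c').
          assert (/ (1 + c' ^ 2) <= 1). { rewrite <- Rinv_1. apply Rinv_le_contravar; lra. }
          nra. }
      lra.
Qed.

Lemma CI_cauchy_bound f K a b v : 0 <= K -> a <= b -> (forall t, Cmod (f t) <= K / (1 + t * t)) ->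
  is_CI f a b v -> Cmod v <= K * (atan b - atan a).
Proof.
  intros HK Hab H I. eapply is_CI_bound_fun; [exact Hab| |exact I|apply cauchy_bound_int]. auto.
Qed.

Lemma CI_tail f K M b b' v : 0 <= K -> (forall t, Cmod (f t) <= K / (1 + t * t)) -> 0 < M ->
  (M < b /\ M < b' \/ b < - M /\ b' < - M) -> is_CI f b b' v -> Cmod v <= K * / M.
Proof.
  intros HK Hf HM Hb.
  assert (W : forall b b' v, b <= b' -> (M < b /\ M < b' \/ b < - M /\ b' < - M) -> is_CI f b b' v -> Cmod v <= K * / M).
  { clear b b' v Hb. intros b b' v L Hb I. apply CI_cauchy_bound with (K := K) in I; trivial.
    eapply Rle_trans. exact I. apply Rmult_le_compat_l; trivial.
    destruct Hb as [[A B]|[A B]]. apply atan_tail; trivial.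
    assert (X := atan_tail M (- b') (- b) HM ltac:(lra) ltac:(lra)). rewrite !atan_opp in X. lra. }
  intros I. destruct (Rle_lt_dec b b') as [L|L]. eapply W; eauto.
  apply is_CI_swap in I. rewrite <- Cmod_opp. apply (W b' b); trivial. lra. tauto.
Qed.

Lemma is_LI_exists f K : 0 <= K -> (forall t, rcont f t) -> (forall t, Cmod (f t) <= K / (1 + t * t)) ->
  exists l, is_LI f l.
Proof.
  intros HK Hc Hf.
  assert (EX : forall a b, exists v, is_CI f a b v).
  { intros a b. destruct (Rle_lt_dec a b) as [L|L]. apply ex_CI_cont; trivial; auto.
    destruct (ex_CI_cont f b a (Rlt_le _ _ L) ltac:(auto)) as [v Hv]. exists (- v)%C. apply is_CI_swap; trivial. }
  set (F := fun P : C -> Prop => exists M, 0 < M /\ forall a b, a < - M -> M < b -> P (CI f a b)).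
  assert (PF : ProperFilter F).
  { constructor.
    - intros P [M [M0 H]]. exists (CI f (- M - 1) (M + 1)). apply H; lra.
    - constructor.
      + exists 1. split. lra. trivial.
      + intros P Q [M [M0 H]] [N [N0 H']]. exists (Rmax M N).
        assert (X := Rmax_l M N). assert (Y := Rmax_r M N). split. lra.
        intros a b Ha Hb. split; [apply H|apply H']; lra.
      + intros P Q S [M [M0 H]]. exists M. split; auto. }
  assert (CF : @cauchy C_R_CompleteNormedModule F).
  { intros [e He]. set (M := 3 * (K + 1) / e). assert (M0 : 0 < M) by (unfold M; apply Rdiv_lt_0_compat; lra).
    assert (KM : K * / M <= e / 3).
    { unfold M. rewrite Rinv_div. replace (K * (e / (3 * (K + 1)))) with (e / 3 * (K / (K + 1))) by (field; lra).
      rewrite <- (Rmult_1_r (e / 3)) at 2. apply Rmult_le_compat_l. lra. apply Rle_div_l; lra. }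
    exists (CI f (- M - 1) (M + 1)), M. split; trivial. intros a b Ha Hb.
    apply (norm_compat1 (V := C_R_NormedModule)). rewrite norm_CR.
    change (Cmod (CI f a b - CI f (- M - 1) (M + 1)) < e).
    destruct (EX a (- M - 1)) as [v1 H1]. destruct (EX (- M - 1) (M + 1)) as [v2 H2]. destruct (EX (M + 1) b) as [v3 H3].
    assert (H := is_CI_Chasles _ _ _ _ _ _ (is_CI_Chasles _ _ _ _ _ _ H1 H2) H3).
    rewrite (is_CI_unique _ _ _ _ H), (is_CI_unique _ _ _ _ H2).
    replace (v1 + v2 + v3 - v2)%C with (v1 + v3)%C by ring.
    apply CI_tail with (K := K) (M := M) in H1; trivial; [|lra].
    apply CI_tail with (K := K) (M := M) in H3; trivial; [|lra].
    eapply Rle_lt_trans. apply Cmod_triangle. lra. }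
  exists (@lim C_R_CompleteNormedModule F). intros e He.
  set (k := @norm_factor R_AbsRing C_R_NormedModule).
  assert (K0 : 0 < k) by apply norm_factor_gt_0.
  assert (He' : 0 < e / 2 / k) by (apply Rdiv_lt_0_compat; lra).
  destruct (complete_cauchy (T := C_R_CompleteNormedModule) F PF CF (mkposreal _ He')) as [M [M0 H]].
  exists M. split; trivial. intros a b Ha Hb. exists (CI f a b). split. apply CI_correct, EX.
  specialize (H a b Ha Hb).
  apply (norm_compat2 (V := C_R_NormedModule)) in H. rewrite norm_CR in H. simpl in H.
  eapply Rlt_le_trans. exact H. fold k. apply Rle_trans with (e / 2); [right; field; lra|lra].
Qed.

Lemma LI_correct f K : 0 <= K -> (forall t, rcont f t) -> (forall t, Cmod (f t) <= K / (1 + t * t)) ->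
  is_LI f (LI f).
Proof.
  intros HK Hc Hf. destruct (is_LI_exists f K HK Hc Hf) as [l Hl]. rewrite (is_LI_unique _ _ Hl); trivial.
Qed.

(** The constant 4 bounds pi, the total mass of 1 / (1 + t^2). *)
Lemma is_LI_bound f K l : 0 <= K -> (forall t, Cmod (f t) <= K / (1 + t * t)) -> is_LI f l -> Cmod l <= 4 * K.
Proof.
  intros HK Hf H. apply Rnot_lt_le. intros N.
  destruct (H (Cmod l - 4 * K) ltac:(lra)) as [M [M0 HM]].
  destruct (HM (- M - 1) (M + 1) ltac:(lra) ltac:(lra)) as [v [I D]].
  apply CI_cauchy_bound with (K := K) in I; trivial; [|lra].
  assert (T := Cmod_triangle_rev l v). rewrite Cmod_minus_sym in T.
  assert (X := atan_bound (M + 1)). assert (Y := atan_bound (- M - 1)). assert (P4 := PI_4).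
  assert (K * (atan (M + 1) - atan (- M - 1)) <= K * 4) by (apply Rmult_le_compat_l; lra). lra.
Qed.

(** Both improper integrals are read off the same symmetric intervals, which serve as horizontal
    sides of one rectangle. *)
Lemma is_LI_diff f g u v k : is_LI f u -> is_LI g v ->
  (forall e, 0 < e -> exists M, forall n, M < n -> forall x y, is_CI f (- n) n x -> is_CI g (- n) n y ->
     Cmod (x - y - k) < e) -> u = (v + k)%C.
Proof.
  intros H K D. apply Cmod_lt_0_eq. intros e He.
  destruct (H (e / 3) ltac:(lra)) as [M1 [_ H1]]. destruct (K (e / 3) ltac:(lra)) as [M2 [_ H2]].
  destruct (D (e / 3) ltac:(lra)) as [M3 H3].
  set (n := Rmax M1 (Rmax M2 M3) + 1).
  assert (X1 := Rmax_l M1 (Rmax M2 M3)). assert (X2 := Rmax_r M1 (Rmax M2 M3)).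
  assert (X3 := Rmax_l M2 M3). assert (X4 := Rmax_r M2 M3).
  destruct (H1 (- n) n) as [x [Ix Dx]]; try (unfold n; lra).
  destruct (H2 (- n) n) as [y [Iy Dy]]; try (unfold n; lra).
  specialize (H3 n ltac:(unfold n; lra) x y Ix Iy).
  replace (u - (v + k))%C with ((u - x) + ((y - v) + (x - y - k)))%C by ring.
  eapply Rle_trans. apply Cmod_triangle. rewrite (Cmod_minus_sym u x).
  assert (T := Cmod_triangle (y - v) (x - y - k)). lra.
Qed.

(** * The Fourier transform of the test functions *)

(** Entire extension of e^(-t^2) e^(-2 pi i xi t), the numerator of the Fourier integrand of
    [f_eps 1 z]. *)
Definition gauss_char (xi : R) (u : C) : C := cexp (- (u * u) - twopii * xi * u)%C.

Lemma cder_gauss_char xi u : cder (gauss_char xi) u.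
Proof.
  apply cder_cexp. apply cder_minus. apply cder_opp, cder_mult; apply cder_id.
  apply cder_mult. apply cder_const. apply cder_id.
Qed.

Lemma Cmod_gauss_char xi t y : Cmod (gauss_char xi (t, y)) = exp (- (t * t)) * exp (y * y + 2 * PI * xi * y).
Proof.
  unfold gauss_char. rewrite Cmod_cexp, <- exp_plus. f_equal. unfold twopii. simpl. ring.
Qed.

Lemma exp_neg_sq t : exp (- (t * t)) <= / (1 + t * t).
Proof.
  rewrite exp_Ropp. assert (X := Rle_0_sqr t). unfold Rsqr in X.
  apply Rinv_le_contravar. lra. apply exp_ineq1_le.
Qed.

(** Growth factor of [gauss_char] on the line Im u = b. For b of sign opposite to xi it decays
    exponentially in |xi|, which is the gain of shifting the line. *)
Definition gauss_const (xi b : R) : R := exp (b * b + 2 * PI * xi * b).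

Lemma gauss_char_line_bound xi b t : Cmod (gauss_char xi (t, b)) <= gauss_const xi b / (1 + t * t).
Proof.
  rewrite Cmod_gauss_char. unfold gauss_const, Rdiv. rewrite Rmult_comm. apply Rmult_le_compat_l.
  left; apply exp_pos. apply exp_neg_sq.
Qed.

Definition line_kernel (xi b : R) (z : C) (t : R) : C := (gauss_char xi (t, b) / (z - (t, b)))%C.

Definition line_transform (xi b : R) (z : C) : C := LI (line_kernel xi b z).

Lemma line_dist (z : C) t b : Rabs (snd z - b) <= Cmod (z - (t, b)).
Proof. apply (proj2 (Cmod_ge_max (z - (t, b)))). Qed.

Lemma line_neq (z : C) t b : snd z <> b -> (z - (t, b))%C <> 0.
Proof. intros H. apply Cminus_neq_0. intros ->. apply H. reflexivity. Qed.

Lemma gauss_const_pos xi b : 0 < gauss_const xi b.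
Proof. apply exp_pos. Qed.

Lemma div_bound_aux K d s : 0 < d -> 0 < s -> K / s / d = K / d / s.
Proof. intros. field. lra. Qed.

Lemma one_sq_pos t : 0 < 1 + t * t.
Proof. assert (X := Rle_0_sqr t). unfold Rsqr in X. lra. Qed.

Lemma line_kernel_bound xi b z d t : 0 < d -> d <= Rabs (snd z - b) ->
  Cmod (line_kernel xi b z t) <= gauss_const xi b / d / (1 + t * t).
Proof.
  intros Hd H. unfold line_kernel. rewrite <- div_bound_aux by (trivial; apply one_sq_pos).
  apply cmod_div_le; trivial. apply gauss_char_line_bound.
  eapply Rle_trans. exact H. apply line_dist.
Qed.

Lemma cder_line_kernel_arg xi z u : (z - u)%C <> 0 -> cder (fun u => gauss_char xi u / (z - u))%C u.
Proof.
  intros H. apply cder_div; trivial. apply cder_gauss_char. apply cder_minus. apply cder_const. apply cder_id.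
Qed.

Lemma line_kernel_rcont xi b z t : snd z <> b -> rcont (line_kernel xi b z) t.
Proof.
  intros H. apply (rcont_cder_hor (fun u => gauss_char xi u / (z - u))%C b t).
  apply cder_line_kernel_arg. apply line_neq; trivial.
Qed.

Lemma line_transform_correct xi b z : snd z <> b -> is_LI (line_kernel xi b z) (line_transform xi b z).
Proof.
  intros H. assert (D : 0 < Rabs (snd z - b)) by (apply Rabs_pos_lt; lra).
  apply LI_correct with (K := gauss_const xi b / Rabs (snd z - b)).
  - left. apply Rdiv_lt_0_compat; trivial. apply gauss_const_pos.
  - intros t. apply line_kernel_rcont; trivial.
  - intros t. apply line_kernel_bound; trivial. lra.
Qed.

Lemma line_transform_bound xi b z d : 0 < d -> d <= Rabs (snd z - b) -> Cmod (line_transform xi b z) <= 4 * (gauss_const xi b / d).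
Proof.
  intros Hd H. assert (N : snd z <> b). { intros E. rewrite E, Rminus_diag, Rabs_R0 in H. lra. }
  apply is_LI_bound with (f := line_kernel xi b z).
  - left. apply Rdiv_lt_0_compat; trivial. apply gauss_const_pos.
  - intros t. apply line_kernel_bound; trivial.
  - apply line_transform_correct; trivial.
Qed.

(** The derivative is minus the integral with (z - u)^2 in the denominator; the second-order
    remainder is again an explicit kernel with a majorant K / (1 + t^2). *)
Lemma line_transform_cder xi b z : snd z <> b -> cder (line_transform xi b) z.
Proof.
  intros H. set (d := Rabs (snd z - b)).
  assert (D : 0 < d) by (apply Rabs_pos_lt; lra).
  assert (P := gauss_const_pos xi b).
  set (f2 := fun t => (gauss_char xi (t, b) / ((z - (t, b)) * (z - (t, b))))%C).
  assert (L2 : is_LI f2 (LI f2)).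
  { apply LI_correct with (K := gauss_const xi b / (d * d)).
    - left. apply Rdiv_lt_0_compat; trivial. nra.
    - intros t. apply (rcont_cder_hor (fun u => gauss_char xi u / ((z - u) * (z - u)))%C b t).
      assert (N := line_neq z t b H).
      apply cder_div. apply cder_gauss_char.
      apply cder_mult; (apply cder_minus; [apply cder_const|apply cder_id]).
      apply Cmult_neq_0; trivial.
    - intros t. rewrite <- div_bound_aux; [|nra|apply one_sq_pos].
      apply cmod_div_le. nra. apply gauss_char_line_bound. rewrite Cmod_mult.
      assert (X := line_dist z t b). fold d in X. apply Rmult_le_compat; lra. }
  exists (- LI f2)%C. intros e He.
  set (K := 4 * (gauss_const xi b / (d / 2 * (d * d)))).
  assert (Q : 0 < d / 2 * (d * d)) by (assert (0 < d * d) by nra; nra).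
  assert (K0 : 0 < K). { unfold K. apply Rmult_lt_0_compat. lra. apply Rdiv_lt_0_compat; trivial. }
  exists (Rmin (d / 2) (e / K)). split. apply Rmin_pos. lra. apply Rdiv_lt_0_compat; lra.
  intros y Hy. split_min Hy Y1 Y2.
  assert (Dy : d / 2 <= Rabs (snd y - b)).
  { destruct (Cmod_ge_max (y - z)) as [_ X]. simpl in X.
    assert (T := Rabs_triang (snd y - b) (- (snd y + - snd z))). rewrite Rabs_Ropp in T.
    replace (snd y - b + - (snd y + - snd z)) with (snd z - b) in T by ring. fold d in T. lra. }
  assert (Ny : snd y <> b). { intros E. rewrite E, Rminus_diag, Rabs_R0 in Dy. lra. }
  assert (I : is_LI (fun t => (y - z) * (y - z) * (gauss_char xi (t, b) / ((y - (t, b)) * ((z - (t, b)) * (z - (t, b))))))%C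
     (line_transform xi b y - line_transform xi b z - - LI f2 * (y - z))%C).
  { replace (line_transform xi b y - line_transform xi b z - - LI f2 * (y - z))%C with
      ((line_transform xi b y + (- (1)) * line_transform xi b z) + (y - z) * LI f2)%C by ring.
    eapply is_LI_ext; [|apply (is_LI_plus _ _ _ _ (is_LI_plus _ _ _ _ (line_transform_correct xi b y Ny) (is_LI_scal (- (1)) _ _ (line_transform_correct xi b z H))) (is_LI_scal (y - z) _ _ L2))].
    intros t. unfold line_kernel, f2. assert (N1 := line_neq z t b H). assert (N2 := line_neq y t b Ny).
    field; auto. }
  set (s := Cmod (y - z)) in *. assert (S0 : 0 <= s) by apply Cmod_ge_0.
  apply is_LI_bound with (K := s * s * (gauss_const xi b / (d / 2 * (d * d)))) in I.
  - eapply Rle_trans. exact I.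
    replace (4 * (s * s * (gauss_const xi b / (d / 2 * (d * d))))) with (s * K * s) by (unfold K; ring).
    apply Rmult_le_compat_r; trivial. apply Rlt_div_r in Y2; lra.
  - apply Rmult_le_pos. nra. left. apply Rdiv_lt_0_compat; trivial.
  - intros t. rewrite (Cmod_mult ((y - z) * (y - z))), (Cmod_mult (y - z) (y - z)). fold s.
    replace (s * s * (gauss_const xi b / (d / 2 * (d * d))) / (1 + t * t)) with
      (s * s * (gauss_const xi b / (d / 2 * (d * d)) / (1 + t * t))) by (unfold Rdiv; ring).
    apply Rmult_le_compat_l. nra.
    change (Cmod (gauss_char xi (t, b) / ((y - (t, b)) * ((z - (t, b)) * (z - (t, b))))) <= gauss_const xi b / (d / 2 * (d * d)) / (1 + t * t)).
    rewrite <- div_bound_aux; trivial; [|apply one_sq_pos].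
    apply cmod_div_le; trivial. apply gauss_char_line_bound. rewrite !Cmod_mult.
    assert (X := line_dist z t b). fold d in X. assert (X' := line_dist y t b).
    apply Rmult_le_compat; try lra. nra. apply Rmult_le_compat; lra.
Qed.

(** Cauchy's formula on [-n, n] x [c, d]: the pole u = z of 1/(z - u) lies inside exactly when Im z
    is between the two heights, and the vertical sides tend to 0. *)
Lemma line_transform_shift xi c d z k : c < d -> snd z <> c -> snd z <> d ->
  (c < snd z < d /\ k = (- twopii * gauss_char xi z)%C \/ ~ (c < snd z < d) /\ k = 0) ->
  line_transform xi c z = (line_transform xi d z + k)%C.
Proof.
  intros Hcd N1 N2 Hk.
  apply is_LI_diff with (line_kernel xi c z) (line_kernel xi d z); try (apply line_transform_correct; trivial).
  intros e He. set (m := Rabs c + Rabs d).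
  (* E bounds the growth of [gauss_char] over the whole strip between the lines; the Gaussian
     e^(-n^2) <= 1/n remains for the vertical sides. *)
  set (E := exp (m * m + 2 * PI * Rabs xi * m)). 
  (* The first entry keeps the vertical sides at distance at least 1 from z; the second makes their
     contribution smaller than e. *)
  set (M := Rmax (Rabs (fst z) + 1) (2 * ((d - c) * E) / e + 1)).
  assert (M1 : Rabs (fst z) + 1 <= M) by apply Rmax_l.
  assert (M2 : 2 * ((d - c) * E) / e + 1 <= M) by apply Rmax_r.
  exists M. intros n Hn x y Ix Iy.
  assert (Rz1 : - Rabs (fst z) <= fst z <= Rabs (fst z)) by (apply Rabs_le_between; lra).
  set (f := fun u => (gauss_char xi u / (z - u))%C).
  assert (SB : forall s t, (s = n \/ s = - n) -> c <= t <= d -> Cmod (f (s, t)) <= E / n).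
  { intros s t Hs Ht. unfold f. 
    assert (SS : s * s = n * n) by (destruct Hs; subst; ring).
    replace (E / n) with (E / n / 1) by (field; lra).
    apply cmod_div_le. lra.
    - rewrite Cmod_gauss_char, SS. unfold Rdiv. rewrite Rmult_comm. apply Rmult_le_compat; try (left; apply exp_pos).
      + unfold E.
        assert (Tm : Rabs t <= m).
        { unfold m. apply Rabs_le. assert (X1 := Rle_abs d). assert (X2 := Rle_abs (- c)). rewrite Rabs_Ropp in X2.
          assert (X3 := Rabs_pos c). assert (X4 := Rabs_pos d). lra. }
        assert (PP := PI_RGT_0). assert (X := Rabs_pos t). assert (Y := Rabs_pos xi).
        assert (T1 : t * t <= m * m). { rewrite <- (Rabs_pos_eq (t * t)) by apply Rle_0_sqr. rewrite Rabs_mult. apply Rmult_le_compat; lra. }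
        assert (T2 : xi * t <= Rabs xi * m). { eapply Rle_trans. apply Rle_abs. rewrite Rabs_mult. apply Rmult_le_compat_l; lra. }
        assert (T3 : 2 * PI * xi * t <= 2 * PI * Rabs xi * m).
        { rewrite !Rmult_assoc. apply Rmult_le_compat_l. lra. apply Rmult_le_compat_l; lra. }
        assert (L : t * t + 2 * PI * xi * t <= m * m + 2 * PI * Rabs xi * m) by lra.
        apply exp_le; exact L.
      + eapply Rle_trans. apply exp_neg_sq. apply Rinv_le_contravar. lra. nra.
    - destruct (Cmod_ge_max (z - (s, t))) as [X _]. simpl in X. refine (Rle_trans _ _ _ _ X).
      destruct Hs; subst. rewrite Rabs_left; lra. rewrite Rabs_pos_eq; lra. }
  assert (HI : rint f (- n) n c d = k).
  { destruct Hk as [[Hz ->]|[Hz ->]].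
    - apply is_rint_unique.
      assert (I := cauchy_formula (gauss_char xi) (- n) n c d z ltac:(split; lra) ltac:(intros; apply cder_gauss_char)).
      apply (is_rint_scal (- (1))) in I.
      replace (- twopii * gauss_char xi z)%C with (- (1) * (twopii * gauss_char xi z))%C by ring.
      eapply is_rint_ext; [lra|lra| |exact I]. intros u Hu. unfold f.
      assert (N := rbd_neq (- n) n c d z u ltac:(split; lra) Hu).
      field. split; apply Cminus_neq_0; congruence.
    - apply goursat; try lra. intros u [U1 U2]. apply cder_line_kernel_arg. apply Cminus_neq_0. intros ->. lra. }
  assert (BC : bcont f (- n) n c d).
  { intros u [[U1 U2] Ub]. apply cder_ccont, cder_line_kernel_arg. apply Cminus_neq_0. intros ->. lra. }
  destruct (rint_correct f (- n) n c d ltac:(lra) ltac:(lra) BC) as (v1 & v2 & v3 & v4 & H1 & H2 & H3 & H4 & EQ).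
  rewrite HI in EQ.
  assert (v1 = x). { apply is_CI_unique in H1, Ix. rewrite <- H1, <- Ix. reflexivity. }
  assert (v3 = y). { apply is_CI_unique in H3, Iy. rewrite <- H3, <- Iy. reflexivity. }
  subst v1 v3. rewrite EQ.
  replace (x - y - (x + Ci * v2 - y - Ci * v4))%C with (Ci * (v4 - v2))%C by ring.
  rewrite Cmod_mult, Cmod_Ci.
  apply is_CI_bound with (M := E / n) in H2; [|lra|intros; apply SB; auto].
  apply is_CI_bound with (M := E / n) in H4; [|lra|intros; apply SB; auto].
  assert (T := Cmod_triangle_minus v4 v2).
  assert (F : 2 * ((d - c) * (E / n)) < e).
  { replace (2 * ((d - c) * (E / n))) with (2 * ((d - c) * E) / n) by (field; lra).
    apply Rlt_div_l. lra. assert (X : 2 * ((d - c) * E) / e < n) by lra.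
    apply Rlt_div_l in X; lra. }
  lra.
Qed.

Lemma fourier_line_transform z xi : fourier (f_eps 1 z) xi = line_transform xi 0 z.
Proof.
  unfold fourier, line_transform, LI. f_equal. apply functional_extensionality. intros t.
  unfold f_eps, line_kernel, gauss_char, Cdiv.
  replace (exp (- (1) * t ^ 2))%R with (exp (- (t * t))) by (f_equal; ring).
  rewrite <- cexp_real.
  replace (- (t * t))%R with (- (t * t))%R by ring.
  replace (cexp (- ((t, 0) * (t, 0)) - twopii * xi * (t, 0))) with
    (cexp (- (t * t))%R * cexp (- twopii * t * xi))%C.
  change (t, 0) with (RtoC t). ring.
  rewrite <- cexp_plus. f_equal. change (t, 0) with (RtoC t). rewrite RtoC_opp, RtoC_mult. ring.
Qed.

(** The same function as [heaviside], seen as the weight of an index in a primed sum over t >= 0;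
    [neg_weight] belongs to t <= 0, so index 0 is shared equally. *)
Definition pos_weight (t : R) : R := if Rlt_dec t 0 then 0 else if Req_EM_T t 0 then 1 / 2 else 1.
Definition neg_weight (t : R) : R := 1 - pos_weight t.

Lemma pos_weight_cases t : (t < 0 /\ pos_weight t = 0) \/ (t = 0 /\ pos_weight t = 1 / 2) \/ (0 < t /\ pos_weight t = 1).
Proof.
  unfold pos_weight. destruct (Rlt_dec t 0), (Req_EM_T t 0); lra.
Qed.

(** The line is moved in the direction in which e^(-2 pi i xi u) decays: up for xi < 0, down for xi
    > 0, half each for xi = 0. Neither line meets the strip |Im z| < 3/2 eta, so the result is
    holomorphic there. *)
Definition shifted_fourier (eta xi : R) (z : C) : C :=
  (neg_weight xi * line_transform xi (2 * eta) z + pos_weight xi * line_transform xi (- (2 * eta)) z)%C.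

(** The width 3/2 eta includes the lines at height +-eta, where the series converge, and keeps
    distance eta/2 from the shifted lines. *)
Lemma strip_away (eta y : R) : 0 < eta -> Rabs y < 3 / 2 * eta ->
  eta / 2 <= Rabs (y - 2 * eta) /\ eta / 2 <= Rabs (y - - (2 * eta)).
Proof.
  intros H K. apply Rabs_lt_between in K. split.
  rewrite Rabs_left; lra. rewrite Rabs_pos_eq; lra.
Qed.

Lemma shifted_fourier_cder eta xi z : 0 < eta -> Rabs (snd z) < 3 / 2 * eta -> cder (shifted_fourier eta xi) z.
Proof.
  intros H K. apply Rabs_lt_between in K.
  apply cder_plus; (apply cder_mult; [apply cder_const|apply line_transform_cder; lra]).
Qed.

(** The rate 2 pi eta in |xi| is the one against which (a) makes h summable; the lines at height +-2
    eta would even give 4 pi eta for xi other than 0. *)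
Lemma shifted_fourier_bound eta xi z : 0 < eta -> Rabs (snd z) < 3 / 2 * eta ->
  Cmod (shifted_fourier eta xi z) <= 16 * exp (4 * eta * eta) / eta * exp (- (2 * PI * eta * Rabs xi)).
Proof.
  intros H K. destruct (strip_away eta (snd z) H K) as [A B].
  assert (PP := PI_RGT_0).
  assert (J1 := line_transform_bound xi (2 * eta) z (eta / 2) ltac:(lra) A).
  assert (J2 := line_transform_bound xi (- (2 * eta)) z (eta / 2) ltac:(lra) B).
  assert (Hx : forall b, b * b = 4 * eta * eta -> xi * b <= - (eta * Rabs xi) ->
    4 * (gauss_const xi b / (eta / 2)) <= 8 * exp (4 * eta * eta) / eta * exp (- (2 * PI * eta * Rabs xi))).
  { intros b Eb Lb. unfold gauss_const. rewrite Eb, exp_plus.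
    replace (4 * (exp (4 * eta * eta) * exp (2 * PI * xi * b) / (eta / 2))) with
      (8 * exp (4 * eta * eta) / eta * exp (2 * PI * xi * b)) by (field; lra).
    apply Rmult_le_compat_l. left. apply Rdiv_lt_0_compat; trivial. apply Rmult_lt_0_compat. lra. apply exp_pos.
    assert (Q : 2 * PI * xi * b <= - (2 * PI * eta * Rabs xi)).
    { replace (2 * PI * xi * b) with (2 * PI * (xi * b)) by ring.
      replace (- (2 * PI * eta * Rabs xi)) with (2 * PI * - (eta * Rabs xi)) by ring. apply Rmult_le_compat_l; lra. }
    apply exp_le; exact Q. }
  replace (16 * exp (4 * eta * eta) / eta * exp (- (2 * PI * eta * Rabs xi))) with
    (8 * exp (4 * eta * eta) / eta * exp (- (2 * PI * eta * Rabs xi)) + 8 * exp (4 * eta * eta) / eta * exp (- (2 * PI * eta * Rabs xi))) by (field; lra).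
  set (U := 8 * exp (4 * eta * eta) / eta * exp (- (2 * PI * eta * Rabs xi))) in *.
  assert (U0 : 0 <= U).
  { unfold U. apply Rmult_le_pos. left. apply Rdiv_lt_0_compat; trivial. apply Rmult_lt_0_compat. lra. apply exp_pos. left; apply exp_pos. }
  unfold shifted_fourier. eapply Rle_trans. apply Cmod_triangle. rewrite !Cmod_mult, !Cmod_R.
  unfold neg_weight. destruct (pos_weight_cases xi) as [[L E]|[[L E]|[L E]]]; rewrite E.
  - rewrite Rminus_0_r, Rabs_R1, Rabs_R0.
    assert (X := Hx (2 * eta) ltac:(ring) ltac:(rewrite Rabs_left by lra; nra)). lra.
  - subst xi. rewrite Rabs_R0 in Hx.
    assert (X1 := Hx (2 * eta) ltac:(ring) ltac:(lra)). assert (X2 := Hx (- (2 * eta)) ltac:(ring) ltac:(lra)).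
    rewrite !Rabs_pos_eq by lra. lra.
  - replace (1 - 1) with 0 by ring. rewrite Rabs_R1, Rabs_R0.
    assert (X := Hx (- (2 * eta)) ltac:(ring) ltac:(rewrite Rabs_pos_eq by lra; nra)). lra.
Qed.

(** Moving the real line up crosses the pole u = z, moving it down crosses none. Hence a residue
    comes with [neg_weight] only, and these residues make up E_+. *)
Lemma fourier_upper eta xi z : 0 < eta -> eta <= snd z < 3 / 2 * eta ->
  fourier (f_eps 1 z) xi = (shifted_fourier eta xi z - neg_weight xi * (twopii * gauss_char xi z))%C.
Proof.
  intros H K. rewrite fourier_line_transform.
  assert (A1 : 0 < 2 * eta) by lra. assert (A2 : snd z <> 0) by lra. assert (A3 : snd z <> 2 * eta) by lra.
  assert (A4 : 0 < snd z < 2 * eta) by lra. assert (A5 : - (2 * eta) < 0) by lra. assert (A6 : snd z <> - (2 * eta)) by lra.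
  assert (A7 : ~ (- (2 * eta) < snd z < 0)) by lra.
  assert (E1 := line_transform_shift xi 0 (2 * eta) z _ A1 A2 A3 (or_introl (conj A4 eq_refl))).
  assert (E2 := line_transform_shift xi (- (2 * eta)) 0 z _ A5 A6 A2 (or_intror (conj A7 eq_refl))).
  unfold shifted_fourier. rewrite E2, E1. unfold neg_weight. rewrite RtoC_minus. ring.
Qed.

Lemma fourier_lower eta xi z : 0 < eta -> - (3 / 2 * eta) < snd z <= - eta ->
  fourier (f_eps 1 z) xi = (shifted_fourier eta xi z + pos_weight xi * (twopii * gauss_char xi z))%C.
Proof.
  intros H K. rewrite fourier_line_transform.
  assert (A1 : 0 < 2 * eta) by lra. assert (A2 : snd z <> 0) by lra. assert (A3 : snd z <> 2 * eta) by lra.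
  assert (A4 : ~ (0 < snd z < 2 * eta)) by lra. assert (A5 : - (2 * eta) < 0) by lra. assert (A6 : snd z <> - (2 * eta)) by lra.
  assert (A7 : - (2 * eta) < snd z < 0) by lra.
  assert (E1 := line_transform_shift xi 0 (2 * eta) z _ A1 A2 A3 (or_intror (conj A4 eq_refl))).
  assert (E2 := line_transform_shift xi (- (2 * eta)) 0 z _ A5 A6 A2 (or_introl (conj A7 eq_refl))).
  unfold shifted_fourier. rewrite E2, E1. unfold neg_weight. rewrite RtoC_minus. ring.
Qed.

(** * The meromorphic function interpolating the two series *)

Definition pole_term (rho : R -> C) (t : R) (z : C) : C := (rho t * exp (- (t * t)) / (z - t))%C.

(* The function e^(-z^2) E_+ of the header, with residue function rho on the set P. *)
Definition strip_sum (P : R -> Prop) (rho : R -> C) (Ls : R -> Prop) (hh : R -> C) (eta : R) (z : C) : C :=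
  (usum P (fun t => pole_term rho t z) + usum Ls (fun xi => hh xi * shifted_fourier eta xi z))%C.

(** Undoing the Gaussian factor and changing the sign gives -E_+ above and E_- below: this is E_-
    continued across the strip, with residue -rho(t) at t. *)
Definition strip_fun P rho Ls hh eta (z : C) : C := (- cexp (z * z) * strip_sum P rho Ls hh eta z)%C.

Definition loc_fin (P : R -> Prop) : Prop :=
  forall a b : R, exists l : list R, NoDup l /\ forall t, In t l <-> (P t /\ a <= t <= b).

Lemma locally_finite_loc_fin P : locally_finite P -> loc_fin P.
Proof.
  intros H a b. destruct (H a b) as [l Hl].
  set (p := fun t => if excluded_middle_informative (P t /\ a <= t <= b) then true else false).
  exists (filter p (nodup Req_EM_T l)). split. apply NoDup_filter, NoDup_nodup.
  intros t. rewrite filter_In, nodup_In. unfold p.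
  destruct (excluded_middle_informative (P t /\ a <= t <= b)) as [[A B]|N]; split; auto.
  intros [_ X]; discriminate. intros X; tauto.
Qed.

(** The residues are summable against the Gaussian of [f_eps 1], the coefficients against the decay
    rate of [shifted_fourier]. *)
Definition pole_data (P : R -> Prop) (rho : R -> C) (Ls : R -> Prop) (hh : R -> C) (eta : R) : Prop :=
  0 < eta /\ loc_fin P /\ summ P (fun t => Cmod (rho t) * exp (- (t * t))) /\
  summ Ls (fun xi => Cmod (hh xi) * exp (- (2 * PI * eta * Rabs xi))).

Lemma cder_minus_const z a : cder (fun z => z - a)%C z.
Proof. apply cder_minus. apply cder_id. apply cder_const. Qed.

Lemma dual_sum_cder P rho Ls hh eta z : pole_data P rho Ls hh eta -> Rabs (snd z) < 3 / 2 * eta ->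
  cder (fun z => usum Ls (fun xi => hh xi * shifted_fourier eta xi z)%C) z.
Proof.
  intros (He & _ & _ & HS) Hz.
  set (k := 16 * exp (4 * eta * eta) / eta).
  assert (K0 : 0 <= k). { unfold k. left. apply Rdiv_lt_0_compat; trivial. apply Rmult_lt_0_compat. lra. apply exp_pos. }
  apply usum_cder with (M := fun xi => k * (Cmod (hh xi) * exp (- (2 * PI * eta * Rabs xi)))) (r := 3 / 2 * eta - Rabs (snd z)).
  apply summ_scal; trivial. lra.
  intros xi y Hxi Hy.
  assert (Dy : Rabs (snd y) < 3 / 2 * eta).
  { destruct (Cmod_ge_max (y - z)) as [_ X]. simpl in X.
    assert (T := Rabs_triang (snd z) (snd y + - snd z)). replace (snd z + (snd y + - snd z)) with (snd y) in T by ring. lra. }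
  split. apply cder_mult. apply cder_const. apply shifted_fourier_cder; trivial.
  rewrite Cmod_mult. assert (X := shifted_fourier_bound eta xi y He Dy). fold k in X.
  replace (k * (Cmod (hh xi) * exp (- (2 * PI * eta * Rabs xi)))) with (Cmod (hh xi) * (k * exp (- (2 * PI * eta * Rabs xi)))) by ring.
  apply Rmult_le_compat_l; trivial. apply Cmod_ge_0.
Qed.

Definition region (r eta : R) (z : C) : Prop := Rabs (fst z) < r /\ Rabs (snd z) < 3 / 2 * eta.

Lemma Cmod_exp_scal (c : C) (s : R) : Cmod (c * exp s) = Cmod c * exp s.
Proof. rewrite Cmod_mult, Cmod_R, Rabs_pos_eq; trivial. left; apply exp_pos. Qed.

Lemma far_pole_bound (rho : R -> C) (t : R) (z : C) : 1 <= Cmod (z - t) -> Cmod (pole_term rho t z) <= Cmod (rho t) * exp (- (t * t)).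
Proof.
  intros H. unfold pole_term. rewrite <- (Rdiv_1_r (Cmod (rho t) * exp (- (t * t)))).
  apply cmod_div_le; trivial. lra. rewrite Cmod_exp_scal. lra.
Qed.

Lemma real_dist (z : C) (t : R) : Rabs (fst z - t) <= Cmod (z - t).
Proof. apply (proj1 (Cmod_ge_max (z - t))). Qed.

Lemma strip_sum_split P rho Ls hh eta r : pole_data P rho Ls hh eta -> exists L T,
  NoDup L /\ (forall t, In t L <-> (P t /\ - (r + 1) <= t <= r + 1)) /\
  (forall z, region r eta z -> cder T z) /\
  (forall z, region r eta z -> strip_sum P rho Ls hh eta z = (fin_sum (fun t => pole_term rho t z) L + T z)%C).
Proof.
  intros D. assert (D' := D). destruct D as (He & HP & HR & HS).
  destruct (HP (- (r + 1)) (r + 1)) as [L [N HL]].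
  set (P' := fun t => P t /\ ~ In t L).
  assert (HR' : summ P' (fun t => Cmod (rho t) * exp (- (t * t)))).
  { apply summ_subset with P; trivial. unfold P'; tauto. }
  assert (far : forall t z, P' t -> Rabs (fst z) < r -> 1 < Cmod (z - t)).
  { intros t z [A B] Hz. assert (X := real_dist z t). refine (Rlt_le_trans _ _ _ _ X).
    apply Rabs_lt_between in Hz. rewrite HL in B.
    destruct (Rlt_le_dec t (- (r + 1))) as [Q|Q]. rewrite Rabs_pos_eq; lra.
    destruct (Rlt_le_dec (r + 1) t) as [Q'|Q']. rewrite Rabs_left; lra. exfalso. apply B. split; trivial; lra. }
  exists L, (fun z => usum P' (fun t => pole_term rho t z) + usum Ls (fun xi => hh xi * shifted_fourier eta xi z))%C.
  split; trivial. split; trivial. split.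
  - intros z [Z1 Z2]. apply cder_plus.
    + apply usum_cder with (M := fun t => Cmod (rho t) * exp (- (t * t))) (r := r - Rabs (fst z)); trivial. lra.
      intros t y Ht Hy.
      assert (Dy : Rabs (fst y) < r).
      { destruct (Cmod_ge_max (y - z)) as [X _]. simpl in X.
        assert (T := Rabs_triang (fst z) (fst y + - fst z)). replace (fst z + (fst y + - fst z)) with (fst y) in T by ring. lra. }
      assert (X := far t y Ht Dy). split.
      * apply cder_div. apply cder_const. apply cder_minus_const. apply Cmod_gt_0. lra.
      * apply far_pole_bound. lra.
    + apply dual_sum_cder with P rho; trivial.
  - intros z [Z1 Z2]. unfold strip_sum. rewrite Cplus_assoc. f_equal.
    assert (U : is_usum P' (fun t => pole_term rho t z) (usum P' (fun t => pole_term rho t z))).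
    { apply usum_correct. apply summ_abs_summable with (1 := HR'). intros t Ht. apply far_pole_bound.
      left. apply far; trivial. }
    apply is_usum_remove in U. apply usum_unique in U. rewrite U. ring.
    split; trivial. intros t Ht. apply HL, Ht.
Qed.

Definition entire_fun (f : C -> C) : Prop := forall z, cder f z.

(** One entire quotient for each real t, by choice; it converts W(z)/(z - t) into W(t)/(z - t) plus
    an entire function. *)
Lemma entire_diff_quotient f : entire_fun f -> exists g : R -> C -> C,
  (forall t, entire_fun (g t)) /\ forall t z, z <> RtoC t -> (g t z = (f z - f t) / (z - t))%C.
Proof.
  intros Hf.
  assert (EX : forall t : R, exists g, cder g t /\ forall z, z <> RtoC t -> g z = ((f z - f t) / (z - t))%C).
  { intros t. apply diff_quotient with 1. lra. auto. }
  exists (fun t : R => epsilon (inhabits f) (fun g => cder g t /\ forall z, z <> RtoC t -> g z = ((f z - f t) / (z - t))%C)).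
  assert (S := fun t : R => epsilon_spec (inhabits f) _ (EX t)).
  split.
  - intros t z. destruct (S t) as [S1 S2]. set (g := epsilon _ _) in *.
    destruct (Ceq_dec z t) as [-> | N]; trivial.
    assert (Nz := Cminus_neq_0 _ _ N). assert (Pz := proj1 (Cmod_gt_0 _) Nz).
    apply cder_local with (f := fun z => ((f z - f t) / (z - t))%C) (r := Cmod (z - t)); trivial.
    + intros y Hy. symmetry. apply S2. intros ->. rewrite Cmod_minus_sym in Hy. lra.
    + apply cder_div; trivial. apply cder_minus. apply Hf. apply cder_const. apply cder_minus_const.
  - intros t z Hz. apply (S t); trivial.
Qed.

(** The entire factor E lets one decomposition serve both the local structure, E = 1, and the
    contour integrals, E = e^(2 pi i z w). Points with rho t = 0 need not be avoided, since their
    terms vanish even at z = t. *)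
Lemma strip_fun_decomposition P rho Ls hh eta r E : pole_data P rho Ls hh eta -> entire_fun E -> exists L H,
  NoDup L /\ (forall t, In t L <-> (P t /\ - (r + 1) <= t <= r + 1)) /\
  (forall z, region r eta z -> cder H z) /\
  (forall z, region r eta z -> (forall t, In t L -> rho t <> 0 -> z <> RtoC t) ->
    (E z * strip_fun P rho Ls hh eta z = fin_sum (fun t => - (rho t * E t) / (z - t)) L + H z)%C).
Proof.
  intros D HE. destruct (strip_sum_split P rho Ls hh eta r D) as (L & T & N & HL & HT & EQ).
  (* W collects both entire factors; W(t) e^(-t^2) = -E(t), so no Gaussian is left in the
     residues. *)
  set (W := fun z => (- (E z * cexp (z * z)))%C).
  assert (HW : entire_fun W).
  { intros z. apply cder_opp, cder_mult. apply HE. apply cder_cexp, cder_mult; apply cder_id. }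
  destruct (entire_diff_quotient W HW) as (q & Q1 & Q2).
  exists L, (fun z => fin_sum (fun t => rho t * exp (- (t * t)) * q t z)%C L + W z * T z)%C.
  split; trivial. split; trivial. split.
  - intros z Hz. apply cder_plus.
    + apply (cder_fin_sum (fun t z => rho t * exp (- (t * t)) * q t z)%C). intros t _.
      apply cder_mult. apply cder_const. apply Q1.
    + apply cder_mult. apply HW. apply HT; trivial.
  - intros z Hz Nz. unfold strip_fun. rewrite EQ by trivial.
    replace (E z * (- cexp (z * z) * (fin_sum (fun t => pole_term rho t z) L + T z)))%C with
      (W z * fin_sum (fun t => pole_term rho t z) L + W z * T z)%C by (unfold W; ring).
    rewrite Cplus_assoc. f_equal. rewrite <- fin_sum_scal, <- fin_sum_plus. apply fin_sum_ext.
    intros t Ht. unfold pole_term. destruct (Ceq_dec (rho t) 0) as [->|Nr].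
    { unfold Cdiv. ring. }
    specialize (Nz t Ht Nr). rewrite Q2 by trivial.
    assert (Wt : (W t * exp (- (t * t)) = - E t)%C).
    { unfold W. rewrite <- cexp_real. replace (- (E t * cexp (t * t)) * cexp (- (t * t))%R)%C with
       (- E t * (cexp (t * t) * cexp (- (t * t))%R))%C by ring.
      rewrite <- cexp_plus. replace (t * t + (- (t * t))%R)%C with (RtoC 0). rewrite cexp_0. ring.
      rewrite RtoC_opp, RtoC_mult. ring. }
    assert (X := Cminus_neq_0 _ _ Nz).
    replace (- (rho t * E t))%C with (rho t * (W t * exp (- (t * t))))%C by (rewrite Wt; ring).
    field. trivial.
Qed.

Lemma list_avoid (L : list R) (p : C) : exists r, 0 < r /\ forall t, In t L -> RtoC t <> p -> r <= Cmod (t - p).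
Proof.
  induction L as [|a L [r [Hr H]]].
  - exists 1. split. lra. intros t [].
  - destruct (Ceq_dec a p) as [E|E].
    + exists r. split; trivial. intros t [<-|Ht] N; [contradiction|auto].
    + exists (Rmin r (Cmod (a - p))). split. apply Rmin_pos; trivial. apply Cmod_gt_0, Cminus_neq_0; trivial.
      intros t [<-|Ht] N. apply Rmin_r. eapply Rle_trans. apply Rmin_l. auto.
Qed.

Lemma region_open r eta p : region r eta p -> exists d, 0 < d /\ forall z, Cmod (z - p) < d -> region r eta z.
Proof.
  intros [A B]. exists (Rmin (r - Rabs (fst p)) (3 / 2 * eta - Rabs (snd p))).
  split. apply Rmin_pos; lra. intros z Hz.
  split_min Hz Z1 Z2.
  destruct (Cmod_ge_max (z - p)) as [X Y]. simpl in X, Y.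
  assert (T1 := Rabs_triang (fst p) (fst z + - fst p)). replace (fst p + (fst z + - fst p)) with (fst z) in T1 by ring.
  assert (T2 := Rabs_triang (snd p) (snd z + - snd p)). replace (snd p + (snd z + - snd p)) with (snd z) in T2 by ring.
  split; lra.
Qed.

Lemma strip_region eta (p : C) : Rabs (snd p) < 3 / 2 * eta -> region (Rabs (fst p) + 1) eta p.
Proof. intros H. split; trivial. lra. Qed.

(** Every pole in the strip is at most simple, with its coefficient read off the finite list. The
    last clause includes the point p itself: when no residue sits at p, the singular terms there are
    identically zero. *)
Lemma strip_fun_residue P rho Ls hh eta (p : C) : pole_data P rho Ls hh eta -> Rabs (snd p) < 3 / 2 * eta ->
  exists (c : C) (H : C -> C) (r : R), 0 < r /\ (forall z, Cmod (z - p) < r -> cder H z) /\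
    (forall z, 0 < Cmod (z - p) < r -> strip_fun P rho Ls hh eta z = (c / (z - p) + H z)%C) /\
    (forall t, p = RtoC t -> P t -> c = (- rho t)%C) /\
    ((forall t, P t -> rho t <> 0 -> p <> RtoC t) -> forall z, Cmod (z - p) < r -> strip_fun P rho Ls hh eta z = H z).
Proof.
  intros D Hp. set (r0 := Rabs (fst p) + 1).
  destruct (strip_fun_decomposition P rho Ls hh eta r0 (fun _ => RtoC 1) D ltac:(intros z; apply cder_const))
    as (L & H & N & HL & HH & EQ).
  destruct (region_open r0 eta p (strip_region eta p Hp)) as (d1 & D1 & O1).
  destruct (list_avoid L p) as (d2 & D2 & O2).
  set (r := Rmin d1 d2). assert (Hr : 0 < r) by (apply Rmin_pos; trivial).
  assert (R1 : r <= d1) by apply Rmin_l. assert (R2 : r <= d2) by apply Rmin_r.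
  set (cf := fun t : R => if Ceq_dec t p then (- rho t)%C else RtoC 0).
  set (c := fin_sum cf L).
  set (H' := fun z => (fin_sum (fun t : R => if Ceq_dec t p then RtoC 0 else - (rho t) / (z - t)) L + H z)%C).
  assert (EQ' : forall z, Cmod (z - p) < r -> (forall t, In t L -> rho t <> 0 -> z <> RtoC t) ->
     strip_fun P rho Ls hh eta z = (c / (z - p) + H' z)%C).
  { intros z Hz Nz. replace (strip_fun P rho Ls hh eta z) with (1 * strip_fun P rho Ls hh eta z)%C by ring.
    rewrite EQ by (trivial; apply O1; lra). unfold H', c. rewrite Cplus_assoc. f_equal.
    unfold Cdiv at 2. rewrite Cmult_comm, <- fin_sum_scal, <- fin_sum_plus. apply fin_sum_ext.
    intros t Ht. unfold cf. destruct (Ceq_dec t p) as [<-|E]; unfold Cdiv; ring. }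
  assert (av : forall z t, Cmod (z - p) < r -> In t L -> RtoC t <> p -> z <> RtoC t).
  { intros z t Hz Ht Nt ->. assert (X := O2 t Ht Nt). lra. }
  exists c, H', r. split; trivial. split; [|split; [|split]].
  - intros z Hz. apply cder_plus. 2: apply HH, O1; lra.
    apply (cder_fin_sum (fun (t : R) z => if Ceq_dec t p then RtoC 0 else - (rho t) / (z - t))%C).
    intros t Ht. destruct (Ceq_dec t p) as [E|E]. apply cder_const.
    apply cder_div. apply cder_const. apply cder_minus_const. apply Cminus_neq_0. apply av; trivial.
  - intros z [Hz0 Hz]. apply EQ'; trivial. intros t Ht _.
    destruct (Ceq_dec t p) as [E|E]; [|apply av; trivial]. intros ->. rewrite E in Hz0.
    replace (p - p)%C with (RtoC 0) in Hz0 by ring. rewrite Cmod_0 in Hz0. lra.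
  - intros t -> Pt. assert (In t L).
    { apply HL. split; trivial. unfold r0. simpl. assert (Y := Rle_abs t). assert (Z := Rle_abs (- t)).
      rewrite Rabs_Ropp in Z. lra. }
    unfold c. rewrite (fin_sum_ldiff cf L [t]); trivial.
    2: constructor; [intros []|constructor]. 2: intros s [<-|[]]; trivial.
    replace (fin_sum cf (ldiff L [t])) with (RtoC 0).
    simpl. unfold cf. destruct (Ceq_dec t t) as [_|X]. ring. contradiction.
    symmetry. transitivity (fin_sum (fun _ => RtoC 0) (ldiff L [t])).
    + apply fin_sum_ext. intros s Hs. unfold cf. destruct (Ceq_dec s t) as [E|E]; trivial.
      apply in_ldiff in Hs. exfalso. apply Hs. left. symmetry. apply RtoC_inj; trivial.
    + clear. induction (ldiff L [t]); simpl; trivial. rewrite IHl. ring.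
  - intros Hreg z Hz. 
    assert (c = 0).
    { unfold c. transitivity (fin_sum (fun _ => RtoC 0) L).
      apply fin_sum_ext. intros t Ht. unfold cf. destruct (Ceq_dec t p) as [E|E]; trivial.
      destruct (Ceq_dec (rho t) 0) as [->|Nr]. ring. exfalso. apply (Hreg t); auto. apply HL, Ht.
      clear. induction L; simpl; trivial. rewrite IHL. ring. }
    rewrite EQ'; trivial. rewrite H0. unfold Cdiv. ring.
    intros t Ht Nr. destruct (Ceq_dec t p) as [E|E]; [|apply av; trivial].
    exfalso. apply (Hreg t); auto. apply HL, Ht.
Qed.

Lemma strip_fun_mero P rho Ls hh eta (p : C) : pole_data P rho Ls hh eta -> Rabs (snd p) < 3 / 2 * eta ->
  mero_at (strip_fun P rho Ls hh eta) p.
Proof.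
  intros D Hp. destruct (strip_fun_residue P rho Ls hh eta p D Hp) as (c & H & r & Hr & H1 & H2 & _).
  exists 1%nat, (fun z => c + (z - p) * H z)%C, r. split; trivial. split.
  - intros z Hz. apply cder_plus. apply cder_const. apply cder_mult; auto. apply cder_minus_const.
  - intros z Hz. rewrite H2 by trivial. simpl. field. apply Cmod_gt_0, Hz.
Qed.

Lemma strip_fun_regular P rho Ls hh eta (p : C) : pole_data P rho Ls hh eta -> Rabs (snd p) < 3 / 2 * eta ->
  (forall t, P t -> rho t <> 0 -> p <> RtoC t) -> cder (strip_fun P rho Ls hh eta) p.
Proof.
  intros D Hp Hn. destruct (strip_fun_residue P rho Ls hh eta p D Hp) as (c & H & r & Hr & H1 & _ & _ & H2).
  apply cder_local with (f := H) (r := r); trivial. intros z Hz. symmetry. auto.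
  apply H1. rewrite Cmod_self; trivial.
Qed.

Lemma strip_fun_identity P rho Ls hh eta (f : C -> C) : pole_data P rho Ls hh eta ->
  meromorphic f -> (forall z, - (3 / 2 * eta) < snd z <= - eta -> f z = strip_fun P rho Ls hh eta z) ->
  forall p : C, Rabs (snd p) < 3 / 2 * eta -> null_near (fun z => f z - strip_fun P rho Ls hh eta z)%C p.
Proof.
  intros D Hf HE p Hp. assert (He : 0 < eta) by apply D.
  (* The starting point is the middle of the band where f is known, so a disc of radius eta / 4
     fits; the segment to p stays in the strip by convexity. *)
  apply identity_segment with ((0, - (5 / 4 * eta)) : C).
  - intros s Hs. apply mero_minus. apply meromorphic_mero; trivial. apply strip_fun_mero; trivial.
    simpl. apply Rabs_lt_between in Hp. apply Rabs_lt_between. nra.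
  - exists (eta / 4). split. lra. intros z [_ Hz]. rewrite HE. ring.
    destruct (Cmod_ge_max (z - (0, - (5 / 4 * eta)))) as [_ X]. simpl in X.
    apply Rle_lt_trans with (2 := Hz) in X. apply Rabs_lt_between in X. lra.
Qed.

(** [meromorphic] admits no removable singularity: if f had a pole at p, its numerator would equal
    (z - p)^n g(z) near p and vanish at p by continuity. *)
Lemma meromorphic_value f g p : meromorphic f -> ccont g p -> null_near (fun z => f z - g z)%C p -> f p = g p.
Proof.
  intros Hf Hg Hn. destruct (Hf p) as [K|(n & phi & r & Hn1 & K1 & K2 & Hr & K3)].
  - apply holomorphic_at_holo in K. destruct K as [r [Hr K]].
    replace (f p) with (f p - g p + g p)%C by ring.
    rewrite (null_near_ccont (fun z => f z - g z)%C p); trivial. ring.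
    assert (C1 : ccont f p). { apply cder_ccont, K. rewrite Cmod_self; trivial. }
    intros e He. destruct (C1 (e / 2) ltac:(lra)) as [d1 [P1 Q1]]. destruct (Hg (e / 2) ltac:(lra)) as [d2 [P2 Q2]].
    exists (Rmin d1 d2). split. apply Rmin_pos; trivial. intros y Hy.
    specialize (Q1 y (Rlt_le_trans _ _ _ Hy (Rmin_l _ _))). specialize (Q2 y (Rlt_le_trans _ _ _ Hy (Rmin_r _ _))).
    replace (f y - g y - (f p - g p))%C with ((f y - f p) - (g y - g p))%C by ring.
    eapply Rle_lt_trans. apply Cmod_triangle_minus. lra.
  - exfalso. apply K2.
    apply holomorphic_at_holo in K1. destruct K1 as [r1 [Hr1 K1]].
    assert (C1 : ccont phi p). { apply cder_ccont, K1. rewrite Cmod_self; trivial. }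
    destruct Hn as [r2 [Hr2 Hn]].
    assert (C2 : ccont (fun z => phi z - (z - p) ^ n * g z)%C p).
    { assert (C3 : ccont (fun z => (z - p) ^ n * g z)%C p).
      { apply ccont_mult; trivial. apply cder_ccont. apply (cder_pow (fun z => z - p)%C). apply cder_minus_const. }
      intros e He. destruct (C1 (e / 2) ltac:(lra)) as [d1 [P1 Q1]]. destruct (C3 (e / 2) ltac:(lra)) as [d2 [P2 Q2]].
      exists (Rmin d1 d2). split. apply Rmin_pos; trivial. intros y Hy.
      specialize (Q1 y (Rlt_le_trans _ _ _ Hy (Rmin_l _ _))). specialize (Q2 y (Rlt_le_trans _ _ _ Hy (Rmin_r _ _))).
      match goal with |- Cmod (?a - ?b - (?c - ?d)) < _ => replace (a - b - (c - d))%C with ((a - c) - (b - d))%C by ring end.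
      eapply Rle_lt_trans. apply Cmod_triangle_minus. lra. }
    assert (Z : (phi p - (p - p) ^ n * g p)%C = 0).
    { apply (null_near_ccont (fun z => phi z - (z - p) ^ n * g z)%C p); trivial.
      exists (Rmin r r2). split. apply Rmin_pos; trivial. intros z [Z0 Hz].
      split_min Hz Z1 Z2.
      assert (E : g z = f z). { replace (g z) with (f z - (f z - g z))%C by ring. rewrite Hn by lra. ring. }
      rewrite E, K3 by lra. field. apply Cpow_nz, Cmod_gt_0. trivial. }
    replace (p - p)%C with (RtoC 0) in Z by ring. destruct n. lia. simpl in Z.
    replace (phi p) with (phi p - 0 * 0 ^ n * g p)%C by ring. exact Z.
Qed.

(** * Principal values and half-strip contours *)

Lemma is_pv_plus f g a u v : is_pv f a u -> is_pv g a v -> is_pv (fun t => f t + g t)%C a (u + v).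
Proof.
  intros H K e He. destruct (H (e / 2) ltac:(lra)) as [d1 [P1 Q1]]. destruct (K (e / 2) ltac:(lra)) as [d2 [P2 Q2]].
  exists (Rmin d1 d2). split. apply Rmin_pos; trivial. intros d Hd.
  assert (X1 := Rmin_l d1 d2). assert (X2 := Rmin_r d1 d2).
  destruct (Q1 d ltac:(lra)) as (I1 & I2 & A1 & A2 & A3). destruct (Q2 d ltac:(lra)) as (J1 & J2 & B1 & B2 & B3).
  exists (I1 + J1)%C, (I2 + J2)%C. split. apply (is_CI_plus f g); trivial. split. apply (is_CI_plus f g); trivial.
  replace (I1 + J1 + (I2 + J2) - (u + v))%C with ((I1 + I2 - u) + (J1 + J2 - v))%C by ring.
  eapply Rle_lt_trans. apply Cmod_triangle. lra.
Qed.

Lemma is_pv_scal k f a u : is_pv f a u -> is_pv (fun t => k * f t)%C a (k * u).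
Proof.
  intros H e He. assert (K0 := Cmod_ge_0 k).
  destruct (H (e / (Cmod k + 1))) as [d1 [P1 Q1]]. apply Rdiv_lt_0_compat; lra.
  exists d1. split; trivial. intros d Hd. destruct (Q1 d Hd) as (I1 & I2 & A1 & A2 & A3).
  exists (k * I1)%C, (k * I2)%C. split. apply (is_CI_scal k f); trivial. split. apply (is_CI_scal k f); trivial.
  replace (k * I1 + k * I2 - k * u)%C with (k * (I1 + I2 - u))%C by ring. rewrite Cmod_mult.
  apply Rlt_div_r in A3; [|lra]. nra.
Qed.

Lemma is_pv_ext f g a u : 0 < a -> (forall t, 0 < Rabs t <= a -> f t = g t) -> is_pv f a u -> is_pv g a u.
Proof.
  intros Ha E H e He. destruct (H e He) as [d1 [P1 Q1]]. exists (Rmin d1 a). split. apply Rmin_pos; trivial.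
  assert (X1 := Rmin_l d1 a). assert (X2 := Rmin_r d1 a).
  intros d Hd. destruct (Q1 d ltac:(lra)) as (I1 & I2 & A1 & A2 & A3). exists I1, I2.
  split; [|split]; trivial.
  - apply (is_CI_ext f g (- a) (- d)); trivial. lra. intros t Ht. apply E. rewrite Rabs_left; lra.
  - apply (is_CI_ext f g d a); trivial. lra. intros t Ht. apply E. rewrite Rabs_pos_eq; lra.
Qed.

Lemma is_pv_unique f a u v : is_pv f a u -> is_pv f a v -> u = v.
Proof.
  intros H K. apply Cmod_lt_0_eq. intros e He.
  destruct (H (e / 2) ltac:(lra)) as [d1 [P1 Q1]]. destruct (K (e / 2) ltac:(lra)) as [d2 [P2 Q2]].
  set (d := Rmin d1 d2 / 2). assert (X0 : 0 < Rmin d1 d2) by (apply Rmin_pos; trivial).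
  assert (X1 := Rmin_l d1 d2). assert (X2 := Rmin_r d1 d2).
  destruct (Q1 d ltac:(unfold d; lra)) as (I1 & I2 & A1 & A2 & A3).
  destruct (Q2 d ltac:(unfold d; lra)) as (J1 & J2 & B1 & B2 & B3).
  apply is_CI_unique in A1, A2, B1, B2. subst I1 I2 J1 J2.
  match goal with _ : Cmod (?x - u) < _ |- _ => set (q := x) in * end.
  assert (T := Cmod_triangle3 u q v). rewrite (Cmod_minus_sym u q) in T. lra.
Qed.

(** Needed for the reflected rectangle, on which the segment of [Phi] is parametrized by -y. *)
Lemma is_pv_opp_arg f a u : 0 < a -> is_pv f a u -> is_pv (fun t => f (- t)) a u.
Proof.
  intros Ha H e He. destruct (H e He) as [d1 [P1 Q1]]. exists d1. split; trivial.
  intros d Hd. destruct (Q1 d Hd) as (I1 & I2 & A1 & A2 & A3). exists I2, I1.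
  assert (R : forall p q v, is_CI f p q v -> is_CI (fun t => f (- t)) (- q) (- p) v).
  { intros p q v I. apply is_CI_swap in I.
    replace q with (-1 * - q + 0) in I by ring. replace p with (-1 * - p + 0) in I by ring.
    apply is_CI_comp_lin in I. apply (is_CI_scal (- (1))) in I.
    replace (- (1) * - v)%C with v in I by ring.
    match type of I with is_CI ?F _ _ _ => replace (fun t => f (- t)) with F; trivial end.
    apply functional_extensionality. intros t. replace (-1 * t + 0) with (- t) by ring.
    apply injective_projections; simpl; ring. }
  split; [|split].
  - apply (R _ _ _) in A2. exact A2.
  - apply (R _ _ _) in A1. rewrite !Ropp_involutive in A1. exact A1.
  - rewrite Cplus_comm. exact A3.
Qed.

Lemma is_pv_cont f a : 0 < a -> (forall t, - a <= t <= a -> rcont f t) -> is_pv f a (CI f (- a) a).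
Proof.
  intros Ha Hc e He. destruct (rcont_bounded f (- a) a ltac:(lra) Hc) as [M HM].
  assert (M0 : 0 <= M). { eapply Rle_trans. 2: apply (HM 0); lra. apply Cmod_ge_0. }
  exists (Rmin a (e / (2 * M + 2))). split. apply Rmin_pos; trivial. apply Rdiv_lt_0_compat; lra.
  assert (X1 := Rmin_l a (e / (2 * M + 2))). assert (X2 := Rmin_r a (e / (2 * M + 2))).
  intros d Hd.
  destruct (ex_CI_cont f (- a) (- d) ltac:(lra) ltac:(intros; apply Hc; lra)) as [I1 H1].
  destruct (ex_CI_cont f (- d) d ltac:(lra) ltac:(intros; apply Hc; lra)) as [I0 H0].
  destruct (ex_CI_cont f d a ltac:(lra) ltac:(intros; apply Hc; lra)) as [I2 H2].
  exists I1, I2. split; trivial. split; trivial.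
  assert (H := is_CI_Chasles _ _ _ _ _ _ (is_CI_Chasles _ _ _ _ _ _ H1 H0) H2).
  rewrite (is_CI_unique _ _ _ _ H).
  replace (I1 + I2 - (I1 + I0 + I2))%C with (- I0)%C by ring. rewrite Cmod_opp.
  apply is_CI_bound with (M := M) in H0; [|lra|intros; apply HM; lra].
  assert (Y : d < e / (2 * M + 2)) by lra. apply Rlt_div_r in Y; nra.
Qed.

Lemma rcont_inv_im y : y <> 0 -> rcont (fun y => / (0, y))%C y.
Proof.
  intros H. apply (rcont_cder_ver Cinv 0 y). eexists. apply cdiff_inv. intros E. apply H. injection E; trivial.
Qed.

(** The integrand is 1 / y, which is odd, so the two halves cancel exactly for every delta. *)
Lemma is_pv_inv a : 0 < a -> is_pv (fun y => Ci * / (0, y))%C a 0.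
Proof.
  intros Ha e He. exists a. split; trivial. intros d Hd.
  set (f := fun y => (Ci * / (0, y))%C).
  assert (C0 : forall y, y <> 0 -> rcont f y).
  { intros y Hy. apply rcont_mult. apply rcont_const. apply rcont_inv_im; trivial. }
  destruct (ex_CI_cont f d a ltac:(lra) ltac:(intros; apply C0; lra)) as [I2 H2].
  exists (- I2)%C, I2. split; [|split]; trivial.
  - assert (I := is_CI_swap _ _ _ _ H2).
    replace d with (-1 * - d + 0) in I by ring. replace a with (-1 * - a + 0) in I by ring.
    apply is_CI_comp_lin in I.
    eapply is_CI_ext; [| |exact I]. lra. intros y Hy. unfold f. simpl.
    apply injective_projections; simpl; field; repeat split; lra.
  - replace (- I2 + I2 - 0)%C with (RtoC 0) by ring. rewrite Cmod_0. trivial.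
Qed.

(** Boundary of [0, T] x [-a, a] whose left side, through 0, is taken as a principal value; B, U, S,
    V belong to the bottom, top, right and left sides. *)
Definition half_contour (f : C -> C) (T a : R) (v : C) : Prop :=
  exists B U S V, is_CI (fun t => f (t, - a)) 0 T B /\ is_CI (fun t => f (t, a)) 0 T U /\
    is_CI (fun y => f (T, y)) (- a) a S /\ is_pv (fun y => Ci * f (0, y))%C a V /\
    (B + Ci * S - U - V = v)%C.

Lemma half_contour_plus f g T a u v : half_contour f T a u -> half_contour g T a v ->
  half_contour (fun z => f z + g z)%C T a (u + v).
Proof.
  intros (B & U & S & V & H1 & H2 & H3 & H4 & <-) (B' & U' & S' & V' & K1 & K2 & K3 & K4 & <-).
  exists (B + B')%C, (U + U')%C, (S + S')%C, (V + V')%C. split5.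
  apply (is_CI_plus _ _ _ _ _ _ H1 K1). apply (is_CI_plus _ _ _ _ _ _ H2 K2). apply (is_CI_plus _ _ _ _ _ _ H3 K3).
  assert (X := is_pv_plus _ _ _ _ _ H4 K4). simpl in X.
  match type of X with is_pv ?F _ _ => replace (fun y => Ci * (f (0, y) + g (0, y)))%C with F; trivial end.
  apply functional_extensionality. intros; ring. ring.
Qed.

Lemma half_contour_scal k f T a u : half_contour f T a u -> half_contour (fun z => k * f z)%C T a (k * u).
Proof.
  intros (B & U & S & V & H1 & H2 & H3 & H4 & <-).
  exists (k * B)%C, (k * U)%C, (k * S)%C, (k * V)%C. split5.
  apply (is_CI_scal k _ _ _ _ H1). apply (is_CI_scal k _ _ _ _ H2). apply (is_CI_scal k _ _ _ _ H3).
  assert (X := is_pv_scal k _ _ _ H4). simpl in X.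
  match type of X with is_pv ?F _ _ => replace (fun y => Ci * (k * f (0, y)))%C with F; trivial end.
  apply functional_extensionality. intros; ring. ring.
Qed.

(** The value at 0 is left out, as the principal value never evaluates there. *)
Lemma half_contour_ext f g T a u : 0 < T -> 0 < a ->
  (forall z, rbd 0 T (- a) a z -> z <> 0 -> f z = g z \/ z = (T, 0)) -> f (T, 0) = g (T, 0) ->
  half_contour f T a u -> half_contour g T a u.
Proof.
  intros HT Ha E0 ET (B & U & S & V & H1 & H2 & H3 & H4 & <-).
  assert (E : forall z, rbd 0 T (- a) a z -> z <> 0 -> f z = g z).
  { intros z Hz Nz. destruct (E0 z Hz Nz) as [X | ->]; trivial. }
  assert (NZ : forall x y : R, x <> 0 \/ y <> 0 -> (x, y) <> RtoC 0).
  { intros x y [N|N] X; injection X; intros; contradiction. }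
  exists B, U, S, V. split5.
  - apply (is_CI_ext (fun t => f (t, - a))); trivial. lra. intros t Ht. apply E.
    split. split; simpl; lra. simpl; lra. apply NZ. lra.
  - apply (is_CI_ext (fun t => f (t, a))); trivial. lra. intros t Ht. apply E.
    split. split; simpl; lra. simpl; lra. apply NZ. lra.
  - apply (is_CI_ext (fun t => f (T, t))); trivial. lra. intros t Ht. apply E.
    split. split; simpl; lra. simpl; lra. apply NZ. lra.
  - apply (is_pv_ext (fun y => Ci * f (0, y))%C); trivial. intros t [Ht1 Ht2]. rewrite E; trivial.
    assert (- a <= t <= a) by (apply Rabs_le_between; trivial).
    split. split; simpl; lra. simpl; lra. apply NZ. right. intros ->. rewrite Rabs_R0 in Ht1. lra.
  - reflexivity.
Qed.

Lemma half_contour_bcont f T a : 0 < T -> 0 < a -> bcont f 0 T (- a) a ->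
  half_contour f T a (rint f 0 T (- a) a).
Proof.
  intros HT Ha BC.
  destruct (rint_correct f 0 T (- a) a ltac:(lra) ltac:(lra) BC) as (v1 & v2 & v3 & v4 & H1 & H2 & H3 & H4 & ->).
  exists v1, v3, v2, (Ci * v4)%C. split5; trivial.
  - apply is_pv_scal. apply is_CI_unique in H4. rewrite <- H4. apply (is_pv_cont (fun y => f (0, y))); trivial.
    intros t Ht. apply (ccont_rcont f (fun t => (0, t))). apply BC. split; unfold rect; simpl; lra. apply rcont_ver.
Qed.

(** The horizontal sides give 2 i atan (T/a), the right side i times 2 atan (a/T), the left side 0.
    The two angles add up to pi/2, so the total is half of 2 pi i. *)
Lemma half_contour_inv_0 T a : 0 < T -> 0 < a -> half_contour (fun z => / z)%C T a (twopii / 2).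
Proof.
  intros HT Ha.
  assert (Q : forall z : C, z <> 0 -> cder Cinv z). { intros z Hz. eexists. apply cdiff_inv; trivial. }
  assert (NZ : forall x y : R, x <> 0 \/ y <> 0 -> (x, y) <> RtoC 0).
  { intros x y [N|N] X; injection X; intros; contradiction. }
  destruct (hedge_cont Cinv 0 T (- a) ltac:(lra)) as [B HB]. { intros t Ht. apply cder_ccont, Q, NZ. lra. }
  destruct (hedge_cont Cinv 0 T a ltac:(lra)) as [U HU]. { intros t Ht. apply cder_ccont, Q, NZ. lra. }
  destruct (vedge_cont Cinv T (- a) a ltac:(lra)) as [S HS]. { intros t Ht. apply cder_ccont, Q, NZ. lra. }
  exists B, U, S, (RtoC 0). split5; trivial. apply is_pv_inv; trivial.
  assert (E1 : (B - U = 2 * Ci * RtoC (atan (T / a)))%C).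
  { assert (X := is_CI_minus _ _ _ _ _ _ HB HU). apply is_CI_unique in X. rewrite <- X. apply is_CI_unique.
    assert (I := is_RInt_poisson a 0 0 T ltac:(lra)). rewrite !Rminus_0_r in I.
    replace (0 / a) with 0 in I by (field; lra). rewrite atan_0, Rminus_0_r in I.
    apply is_CI_real in I. apply (is_CI_scal (2 * Ci)) in I.
    eapply is_CI_ext; [| |exact I]. lra. intros t Ht. simpl.
    assert (N : forall u, u = (t - 0) * (t - 0) + a * a -> u <> 0).
    { intros u ->. assert (0 < a * a) by nra. assert (0 <= (t - 0) * (t - 0)) by apply Rle_0_sqr. lra. }
    apply injective_projections; simpl; field; repeat split; apply N; ring. }
  assert (E2 : (S = 2 * RtoC (atan (a / T)))%C).
  { apply is_CI_unique in HS. rewrite <- HS. apply is_CI_unique.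
    assert (I := is_RInt_poisson T 0 (- a) a ltac:(lra)). rewrite !Rminus_0_r in I.
    replace (- a / T) with (- (a / T)) in I by (field; lra). rewrite atan_opp in I.
    replace (atan (a / T) - - atan (a / T)) with (2 * atan (a / T)) in I by ring.
    (* The imaginary part is odd; its logarithmic primitive takes equal values at both ends. *)
    assert (I' : is_RInt (fun t => - t / (t * t + T * T)) (- a) a 0).
    { assert (P : forall t, 0 < t * t + T * T). { intros t. assert (0 < T * T) by nra. assert (0 <= t * t) by apply Rle_0_sqr. lra. }
      replace 0 with (@minus R_AbelianGroup (- / 2 * ln (a * a + T * T)) (- / 2 * ln (- a * - a + T * T))).
      apply (is_RInt_derive (V := R_CompleteNormedModule) (fun t => - / 2 * ln (t * t + T * T))).
      - intros x _. specialize (P x). auto_derive. trivial. field. lra.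
      - intros x _. apply (ex_derive_continuous (V := R_NormedModule)). auto_derive. specialize (P x). lra.
      - replace (- a * - a) with (a * a) by ring. unfold minus, plus, opp; simpl. ring. }
    assert (X := is_RInt_fct_extend_pair (U := R_NormedModule) (V := R_NormedModule)
      (fun t => (T / ((t - 0) * (t - 0) + T * T), - t / (t * t + T * T))) (- a) a _ _ I I').
    replace (2 * RtoC (atan (a / T)))%C with ((2 * atan (a / T))%R, 0%R) by (apply injective_projections; simpl; ring).
    eapply is_CI_ext; [| |exact X]. lra. intros t Ht. simpl.
    assert (N : forall u, u = t * t + T * T -> u <> 0).
    { intros u ->. assert (0 < T * T) by nra. assert (0 <= t * t) by apply Rle_0_sqr. lra. }
    apply injective_projections; simpl; field; repeat split; apply N; ring. }
  replace (B + Ci * S - U - 0)%C with ((B - U) + Ci * S)%C by ring. rewrite E1, E2.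
  replace (a / T) with (/ (T / a)) by (field; lra).
  rewrite atan_inv by (apply Rdiv_lt_0_compat; trivial).
  unfold twopii. apply injective_projections; simpl; field.
Qed.

(* A pole at 0 lies on the side where the principal value is taken and counts one half. *)
Definition contour_weight (T t : R) : R := if Rlt_dec t T then pos_weight t else 0.

Lemma half_contour_pole t T a : 0 < T -> 0 < a -> t <> T ->
  half_contour (fun z => / (z - RtoC t))%C T a (twopii * contour_weight T t).
Proof.
  intros HT Ha NT. unfold contour_weight.
  destruct (Rlt_dec t T) as [L|L]; [destruct (pos_weight_cases t) as [[Ht ->]|[[Ht ->]|[Ht ->]]]|].
  - replace (twopii * 0)%C with (rint (fun z => / (z - RtoC t))%C 0 T (- a) a).
    + apply half_contour_bcont; trivial. intros z [[Z1 Z2] _]. apply ccont_inv_minus. apply Cminus_neq_0. intros ->. simpl in *. lra.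
    + rewrite goursat; try lra. ring. intros z [Z1 Z2]. apply cder_inv. apply cder_minus_const. apply Cminus_neq_0. intros ->. simpl in *. lra.
  - subst t. replace (twopii * (1 / 2)%R)%C with (twopii / 2)%C.
    2: { apply injective_projections; simpl; field. }
    replace (fun z => / (z - 0))%C with (fun z => / z)%C. apply half_contour_inv_0; trivial.
    apply functional_extensionality. intros z. f_equal. ring.
  - replace (twopii * 1)%C with (rint (fun z => / (z - RtoC t))%C 0 T (- a) a).
    + apply half_contour_bcont; trivial. intros z Hz. apply ccont_inv_minus. apply Cminus_neq_0. intros ->.
      destruct Hz as [_ Hz]. simpl in Hz. lra.
    + rewrite rint_inv. ring. split; simpl; lra.
  - replace (twopii * 0)%C with (rint (fun z => / (z - RtoC t))%C 0 T (- a) a).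
    + apply half_contour_bcont; trivial. intros z [[Z1 Z2] _]. apply ccont_inv_minus. apply Cminus_neq_0. intros ->. simpl in *. lra.
    + rewrite goursat; try lra. ring. intros z [Z1 Z2]. apply cder_inv. apply cder_minus_const. apply Cminus_neq_0. intros ->. simpl in *. lra.
Qed.

Lemma half_contour_fin_sum (f : R -> C -> C) (v : R -> C) T a L : (forall t, In t L -> half_contour (f t) T a (v t)) ->
  half_contour (fun z => fin_sum (fun t => f t z) L) T a (fin_sum v L).
Proof.
  induction L as [|t L IH]; simpl; intros H.
  - exists 0, 0, 0, 0.
    assert (Z : forall p q, is_CI (fun _ => RtoC 0) p q 0).
    { intros p q. assert (X := is_CI_const 0 p q). replace (RtoC (q - p) * 0)%C with (RtoC 0) in X by ring. exact X. }
    split5; try apply Z.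
    intros e He. exists 1. split. lra. intros d Hd. exists 0, 0. 
    replace (fun _ : R => (Ci * 0)%C) with (fun _ : R => RtoC 0) by (apply functional_extensionality; intros; ring).
    split; [apply Z|split;[apply Z|]]. replace (0 + 0 - 0)%C with (RtoC 0) by ring. rewrite Cmod_0; trivial.
    ring.
  - apply half_contour_plus; auto.
Qed.

(** A point with zero coefficient may lie anywhere, even at T, its term being zero. This freedom
    admits abscissas at which the residue is only known to vanish. *)
Lemma half_contour_residues (Q H : C -> C) (c : R -> C) T a L : 0 < T -> 0 < a ->
  (forall z, rect 0 T (- a) a z -> cder H z) ->
  (forall t, In t L -> c t <> 0 -> t <> T) ->
  (forall z, rect 0 T (- a) a z -> z <> 0 -> (forall t, In t L -> c t <> 0 -> z <> RtoC t) ->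
     Q z = (fin_sum (fun t => c t / (z - t))%C L + H z)%C) ->
  half_contour Q T a (fin_sum (fun t => twopii * (contour_weight T t * c t))%C L).
Proof.
  intros HT Ha HH HL EQ.
  assert (A : half_contour (fun z => fin_sum (fun t => c t * / (z - RtoC t)) L + H z)%C T a
     (fin_sum (fun t => c t * (twopii * contour_weight T t)) L + 0)%C).
  { apply half_contour_plus.
    - apply (half_contour_fin_sum (fun t z => c t * / (z - RtoC t))%C (fun t => c t * (twopii * contour_weight T t))%C).
      intros t Ht. destruct (Ceq_dec (c t) 0) as [->|N].
      + assert (X := half_contour_scal 0 (fun z => RtoC 1) T a _ (half_contour_bcont (fun _ => RtoC 1) T a HT Ha ltac:(intros z _; apply cder_ccont, cder_const))).
        replace (0 * (twopii * contour_weight T t))%C with (0 * rint (fun _ => RtoC 1) 0 T (- a) a)%C by ring.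
        match type of X with half_contour ?F _ _ _ => replace (fun z => (0 * / (z - RtoC t))%C) with F; trivial end.
        apply functional_extensionality. intros; ring.
      + apply half_contour_scal. apply half_contour_pole; auto.
    - rewrite <- (goursat H 0 T (- a) a) by (trivial; lra). apply half_contour_bcont; trivial.
      apply cder_bcont; trivial. }
  replace (fin_sum (fun t => twopii * (contour_weight T t * c t))%C L) with
    (fin_sum (fun t => c t * (twopii * contour_weight T t)) L + 0)%C.
  2: { rewrite Cplus_0_r. apply fin_sum_ext. intros; ring. }
  assert (K : forall z, rbd 0 T (- a) a z -> z <> 0 ->
     (fin_sum (fun t => c t * / (z - RtoC t)) L + H z)%C = Q z).
  { intros z Hz Nz. symmetry. apply EQ. apply Hz. exact Nz. intros t Ht Nt ->. destruct Hz as [_ Hz]. simpl in Hz.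
    apply (HL t Ht Nt). destruct Hz as [Hz|[Hz|Hz]]; [|trivial|lra]. exfalso. apply Nz. congruence. }
  apply half_contour_ext with (5 := A); trivial.
  - intros z Hz Nz. left. apply K; trivial.
  - apply K. split; unfold rect; simpl; lra. intros X. injection X. lra.
Qed.

(** * The complex exponential: derivative and integral over a real interval *)

Lemma cdiff_eq f z l l' : l = l' -> cdiff f z l -> cdiff f z l'.
Proof. intros ->; trivial. Qed.

Lemma cdiff_ext f g z l : (forall y, f y = g y) -> cdiff f z l -> cdiff g z l.
Proof. intros E. apply (cdiff_local f g z l 1). lra. auto. Qed.

Lemma cdiff_cexp z : cdiff cexp z (cexp z).
Proof.
  apply cdiff_ext with (fun y => cexp z * cexp (y - z))%C.
  { intros y. rewrite <- cexp_plus. f_equal. ring. }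
  assert (A : cdiff (fun y => y - z)%C z (1 + 0)) by (apply (cdiff_plus (fun y => y)); [apply cdiff_id|apply (cdiff_const (- z)%C)]).
  assert (B : cdiff cexp (z - z)%C 1) by (replace (z - z)%C with (RtoC 0) by ring; apply cdiff_cexp_0).
  assert (X := cdiff_mult _ _ z _ _ (cdiff_const (cexp z) z) (cdiff_comp cexp (fun y => y - z)%C z _ _ A B)).
  eapply cdiff_eq; [|exact X]. simpl. ring.
Qed.

Lemma cdiff_is_derive G (t : R) l : cdiff G (RtoC t) l ->
  @is_derive R_AbsRing C_R_NormedModule (fun t : R => G (RtoC t)) t l.
Proof.
  intros H. split. apply is_linear_scal_l.
  intros x Hx. assert (E : t = x).
  { apply (is_filter_lim_locally_unique (K := R_AbsRing) (V := R_NormedModule) t x). exact Hx. }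
  subst x. intros [e He]. destruct (H e He) as [d [Hd HH]].
  exists (mkposreal d Hd). intros y Hy.
  rewrite norm_CR. simpl.
  specialize (HH (RtoC y)). rewrite <- RtoC_minus, Cmod_R in HH. specialize (HH Hy).
  change (norm (minus y t)) with (Rabs (y - t)).
  match goal with |- Cmod ?u <= _ => replace u with (G y - G t - l * RtoC (y - t))%C; trivial end.
  apply injective_projections; simpl; unfold minus, plus, opp, scal; simpl; unfold plus, opp, mult; simpl; unfold mult; simpl; ring.
Qed.

Lemma is_CI_exp (k m : C) a b : a <= b -> k <> 0 ->
  is_CI (fun t : R => cexp (k * t + m)) a b ((cexp (k * b + m) - cexp (k * a + m)) / k).
Proof.
  intros Hab Hk.
  set (G := fun z => (/ k * cexp (k * z + m))%C).
  assert (D : forall z, cdiff G z (cexp (k * z + m))).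
  { intros z.
    assert (A := cdiff_plus _ _ z _ _ (cdiff_mult _ _ z _ _ (cdiff_const k z) (cdiff_id z)) (cdiff_const m z)).
    assert (X := cdiff_mult _ _ z _ _ (cdiff_const (/ k) z) (cdiff_comp cexp _ z _ _ A (cdiff_cexp _))).
    eapply cdiff_eq; [|exact X]. simpl. field. trivial. }
  assert (X := is_RInt_derive (V := C_R_CompleteNormedModule) (fun t : R => G (RtoC t)) (fun t : R => cexp (k * t + m)) a b).
  replace ((cexp (k * b + m) - cexp (k * a + m)) / k)%C with (@minus C_R_NormedModule (G b) (G a)).
  - apply X.
    + intros t _. apply cdiff_is_derive. apply D.
    + intros t _. apply rcont_continuous. apply (rcont_cder_hor (fun z => cexp (k * z + m))%C 0 t).
      apply cder_cexp, cder_plus. apply cder_mult. apply cder_const. apply cder_id. apply cder_const.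
  - change (G b - G a = (cexp (k * b + m) - cexp (k * a + m)) / k)%C. unfold G. field. trivial.
Qed.

(** * The horizontal edges *)

Definition sgn1 (s : R) : Prop := s = 1 \/ s = -1.

Lemma sgn1_sq s : sgn1 s -> s * s = 1.
Proof. intros [-> | ->]; ring. Qed.

(** Integral of p(xi) e^(k t + m) over t from 0 to infinity, where k = sig 2 pi i (w - xi) and m =
    -2 pi s (w - xi): the contribution of one frequency to the horizontal ray at height s. *)
Definition edge_term (p : R -> C) (s sig : R) (w : C) (xi : R) : C :=
  (- (p xi) * cexp (- (2 * PI * s) * (w - xi)) / (sig * twopii * (w - xi)))%C.

Lemma im_ne_real (w : C) (xi : R) : snd w <> 0 -> (w - xi)%C <> 0.
Proof. intros H. apply Cminus_neq_0. intros ->. apply H. reflexivity. Qed.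

(** Every term decays along the ray like e^(-2 pi sig Im w t), at a rate independent of xi;
    truncation at T therefore costs one exponential factor for the whole series. *)
Lemma edge_integral (A : R -> Prop) (p : R -> C) (s sig : R) (w : C) :
  sgn1 sig -> 0 < sig * snd w -> summ A (fun xi => Cmod (p xi) * exp (2 * PI * s * xi)) ->
  exists C0 V, is_usum A (edge_term p s sig w) V /\ forall T, 0 < T -> exists X,
    is_CI (fun t => cexp (twopii * ((sig * t)%R, s) * w) * usum A (fun xi => p xi * cexp (- twopii * xi * ((sig * t)%R, s))))%C 0 T X /\
    Cmod (X - V) <= C0 * exp (- (2 * PI * (sig * snd w) * T)).
Proof.
  intros Hsig Hw HS. set (mu := sig * snd w) in *.
  assert (PP := PI_RGT_0). 
  assert (Nw : snd w <> 0). { intros E. unfold mu in Hw. rewrite E in Hw. lra. }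
  assert (Dw : forall xi : R, mu <= Cmod (w - xi)).
  { intros xi. destruct (Cmod_ge_max (w - xi)) as [_ X]. simpl in X.
    replace (snd w + - 0) with (snd w) in X by ring.
    assert (mu <= Rabs (snd w)); [|lra]. unfold mu. destruct Hsig as [-> | ->]. 
    assert (Y := Rle_abs (snd w)). lra. assert (Y := Rle_abs (- snd w)). rewrite Rabs_Ropp in Y. lra. }
  set (k := fun xi : R => (sig * twopii * (w - xi))%C).
  set (m := fun xi : R => (- (2 * PI * s) * (w - xi))%C).
  assert (Ck : forall xi, 2 * PI * mu <= Cmod (k xi)).
  { intros xi. unfold k. rewrite !Cmod_mult, Cmod_twopii, Cmod_R.
    replace (Rabs sig) with 1 by (destruct Hsig as [-> | ->]; [rewrite Rabs_R1|rewrite Rabs_left]; lra).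
    rewrite Rmult_1_l. apply Rmult_le_compat_l. lra. apply Dw. }
  assert (Nk : forall xi, k xi <> 0).
  { intros xi. apply Cmod_gt_0. eapply Rlt_le_trans; [|apply Ck]. apply Rmult_lt_0_compat; lra. }
  set (W := exp (- (2 * PI * s * fst w))). assert (W0 : 0 < W) by apply exp_pos.
  assert (Me : forall xi (t : R), Cmod (cexp (k xi * t + m xi)) = exp (- (2 * PI * mu * t)) * W * exp (2 * PI * s * xi)).
  { intros xi t. rewrite Cmod_cexp. unfold W. rewrite <- !exp_plus. f_equal.
    unfold k, m, mu, twopii. simpl. ring. }
  set (M := fun xi => Cmod (p xi) * exp (2 * PI * s * xi)).
  assert (Mt : forall xi (t : R), Cmod (p xi * cexp (k xi * t + m xi)) = exp (- (2 * PI * mu * t)) * W * M xi).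
  { intros xi t. rewrite Cmod_mult, Me. unfold M. ring. }
  assert (Em : forall xi, edge_term p s sig w xi = (- (p xi * cexp (k xi * 0 + m xi)) / k xi)%C).
  { intros xi. unfold edge_term. fold (m xi) (k xi). f_equal. replace (k xi * 0 + m xi)%C with (m xi) by ring. ring. }
  assert (MP : 0 < 2 * PI * mu) by (apply Rmult_lt_0_compat; lra).
  assert (M0 : forall xi, 0 <= M xi). { intros xi. apply Rmult_le_pos. apply Cmod_ge_0. left; apply exp_pos. }
  assert (SE : summ A (fun xi => W / (2 * PI * mu) * M xi)).
  { apply summ_scal; trivial. left. apply Rdiv_lt_0_compat; trivial. }
  assert (BE : forall t xi, Cmod (p xi * cexp (k xi * RtoC t + m xi) / k xi) <= exp (- (2 * PI * mu * t)) * (W / (2 * PI * mu) * M xi)).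
  { intros t xi. replace (exp (- (2 * PI * mu * t)) * (W / (2 * PI * mu) * M xi)) with
      (exp (- (2 * PI * mu * t)) * W * M xi / (2 * PI * mu)) by (field; lra).
    apply cmod_div_le; trivial. rewrite Mt. lra. }
  assert (AV : abs_summable A (edge_term p s sig w)).
  { apply summ_abs_summable with (1 := SE). intros xi _. rewrite Em.
    replace (- (p xi * cexp (k xi * 0 + m xi)) / k xi)%C with (- (p xi * cexp (k xi * 0 + m xi) / k xi))%C by (unfold Cdiv; ring).
    rewrite Cmod_opp. eapply Rle_trans. apply (BE 0). rewrite Rmult_0_r, Ropp_0, exp_0. lra. }
  assert (HV := usum_correct _ _ AV). set (V := usum A (edge_term p s sig w)) in *.
  destruct SE as [SE0 [B0 SE]].
  exists B0, V. split; trivial. intros T HT.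
  destruct (is_CI_usum A (fun xi => exp (2 * PI * mu * 1) * W * M xi) (fun xi t => p xi * cexp (k xi * t + m xi))%C
    (fun xi => (p xi * ((cexp (k xi * T + m xi) - cexp (k xi * 0 + m xi)) / k xi))%C) 0 T) as [X [HX IX]].
  - apply summ_scal. apply Rmult_le_pos; left; trivial; apply exp_pos. exact HS.
  - lra.
  - intros xi t _. apply rcont_mult. apply rcont_const.
    apply (rcont_cder_hor (fun z => cexp (k xi * z + m xi))%C 0 t).
    apply cder_cexp, cder_plus. apply cder_mult. apply cder_const. apply cder_id. apply cder_const.
  - intros xi t _ Ht. rewrite Mt. apply Rmult_le_compat_r; trivial. apply Rmult_le_compat_r. lra.
    assert (Q : - (2 * PI * mu * t) <= 2 * PI * mu * 1) by nra.
    apply exp_le; exact Q.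
  - intros xi _. apply is_CI_scal. apply is_CI_exp; trivial. lra.
  - exists X. split.
    + eapply is_CI_ext; [| |exact IX]. lra. intros t Ht. simpl.
      assert (U : is_usum A (fun xi => p xi * cexp (- twopii * xi * ((sig * t)%R, s)))%C
                 (usum A (fun xi => p xi * cexp (- twopii * xi * ((sig * t)%R, s)))%C)).
      { apply usum_correct. apply summ_abs_summable with (1 := HS). intros xi _.
        rewrite Cmod_mult, Cmod_cexp. apply Rmult_le_compat_l. apply Cmod_ge_0.
        right. f_equal. unfold twopii. simpl. ring. }
      apply (is_usum_scal _ (cexp (twopii * ((sig * t)%R, s) * w))) in U.
      rewrite <- (usum_unique _ _ _ U). apply usum_ext. intros xi _.
      replace (cexp (twopii * ((sig * t)%R, s) * w) * (p xi * cexp (- twopii * xi * ((sig * t)%R, s))))%C with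
        (p xi * (cexp (twopii * ((sig * t)%R, s) * w) * cexp (- twopii * xi * ((sig * t)%R, s))))%C by ring.
      rewrite <- cexp_plus. f_equal. f_equal. unfold k, m, twopii. apply injective_projections; simpl; ring.
    + assert (HD := is_usum_minus _ _ _ _ _ HX HV).
      assert (E0 := exp_pos (- (2 * PI * mu * T))).
      apply usum_bound with (M := fun xi => exp (- (2 * PI * mu * T)) * (W / (2 * PI * mu) * M xi)) (B := exp (- (2 * PI * mu * T)) * B0) in HD.
      * lra.
      * intros l Hl. rewrite rsum_scal. apply Rmult_le_compat_l. lra. apply SE; trivial.
      * intros xi _. rewrite Em.
        match goal with |- Cmod ?u <= _ => replace u with (p xi * cexp (k xi * T + m xi) / k xi)%C end.
        apply BE. unfold Cdiv. ring.
Qed.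

(** * The contour argument *)

Definition qterm (p : R -> C) (z : C) (xi : R) : C := (p xi * cexp (- twopii * xi * z))%C.

(** [lower] and [upper] refer to the sides Im z = -eta and Im z = eta of the rectangle; the halving
    at index 0 is carried by p. *)
Definition dual_lower (p : R -> C) (eta : R) (w : C) (xi : R) : C :=
  (p xi * (cexp (2 * PI * eta * (w - xi)) / (w - xi)))%C.

Definition dual_upper (p : R -> C) (eta : R) (w : C) (xi : R) : C :=
  (p xi * (cexp (- (2 * PI * eta) * (w - xi)) / (w - xi)))%C.

Definition res_term (rho : R -> C) (sig : R) (w : C) (t : R) : C :=
  (pos_weight (sig * t) * (rho t * cexp (twopii * t * w)))%C.

Definition pv_integrand (N : C -> C) (w : C) (y : R) : C :=
  (Ci * (cexp (twopii * (0, y) * w) * N (0, y)))%C.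

Lemma fin_sum_map f (g : R -> R) l : fin_sum f (map g l) = fin_sum (fun t => f (g t)) l.
Proof. induction l; simpl; congruence. Qed.

Lemma fin_sum_filter f (q : R -> bool) l : (forall t, In t l -> q t = false -> f t = RtoC 0) ->
  fin_sum f (filter q l) = fin_sum f l.
Proof.
  induction l; simpl; intros H; trivial. destruct (q a) eqn:E; simpl; rewrite IHl by auto; trivial.
  rewrite (H a); auto. ring.
Qed.

Lemma sig_mul (sig : R) (z : C) : (sig * z)%C = ((sig * fst z)%R, (sig * snd z)%R).
Proof. apply injective_projections; simpl; ring. Qed.

(** From e^x >= 1 + x, the threshold |C0| / (mu e) suffices. *)
Lemma exp_small (C0 mu : R) : 0 < mu -> forall e, 0 < e -> exists B, forall T, B < T -> C0 * exp (- (mu * T)) < e.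
Proof.
  intros Hmu e He. exists (Rabs C0 / (mu * e)). intros T HT.
  assert (Q := Rabs_pos C0). 
  assert (T0 : 0 < T). { eapply Rle_lt_trans; [|exact HT]. apply Rmult_le_pos; trivial. left; apply Rinv_0_lt_compat, Rmult_lt_0_compat; trivial. }
  apply Rle_lt_trans with (Rabs C0 * exp (- (mu * T))).
  { apply Rmult_le_compat_r. left; apply exp_pos. apply Rle_abs. }
  rewrite exp_Ropp. assert (X := exp_ineq1_le (mu * T)). 
  apply Rlt_div_l. apply exp_pos.
  apply Rlt_div_l in HT; [|apply Rmult_lt_0_compat; trivial]. nra.
Qed.

(* The abscissas T avoid the poles and may be taken arbitrarily large, as along the
   sequences of (e); a point of P with zero residue is harmless. *)
Lemma contour_identity P rho Ls hh eta (p : R -> C) sig (w : C) K c Ph :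
  pole_data P rho Ls hh eta -> sgn1 sig ->
  summ (nonpos_part Ls) (fun xi => Cmod (p xi) * exp (2 * PI * eta * xi)) ->
  summ (nonneg_part Ls) (fun xi => Cmod (p xi) * exp (2 * PI * - eta * xi)) ->
  (forall t, strip_fun P rho Ls hh eta (t, eta) = (- twopii * usum (nonpos_part Ls) (qterm p (t, eta)))%C) ->
  (forall t, strip_fun P rho Ls hh eta (t, - eta) = (twopii * usum (nonneg_part Ls) (qterm p (t, (- eta)%R)))%C) ->
  (forall B, exists T, B < T /\ (P (sig * T) -> rho (sig * T) = 0) /\
     forall y, Rabs y <= eta -> Cmod (strip_fun P rho Ls hh eta (sig * T, y)) <= K * exp (c * T)) ->
  0 < sig * snd w -> c < 2 * PI * (sig * snd w) ->
  abs_summable (fun t => P t /\ 0 <= sig * t) (res_term rho sig w) ->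
  is_pv (pv_integrand (strip_fun P rho Ls hh eta) w) eta Ph ->
  (usum (nonneg_part Ls) (dual_lower p eta w) + usum (nonpos_part Ls) (dual_upper p eta w) + Ph =
   sig * twopii * usum (fun t => P t /\ 0 <= sig * t) (res_term rho sig w))%C.
Proof.
  intros D Hsig SU SL HU HL HT Hw Hc HR HPh.
  assert (He : 0 < eta) by apply D. assert (PP := PI_RGT_0). assert (Sq := sgn1_sq _ Hsig).
  assert (SqC : (sig * sig = 1)%C) by (rewrite <- RtoC_mult, Sq; reflexivity).
  assert (SA : Rabs sig = 1) by (destruct Hsig as [-> | ->]; [rewrite Rabs_R1|rewrite Rabs_left]; lra).
  assert (Ns : RtoC sig <> 0). { intros E. rewrite E in SqC. apply (f_equal fst) in SqC. simpl in SqC. lra. }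
  set (N := strip_fun P rho Ls hh eta) in *.
  set (E := fun z => cexp (twopii * z * w)).
  assert (EE : entire_fun E).
  { intros z. apply cder_cexp. apply (cder_mult (fun z => twopii * z)%C). apply cder_mult. apply cder_const. apply cder_id. apply cder_const. }
  set (mu := 2 * PI * (sig * snd w)) in *. assert (Hmu : 0 < mu) by (apply Rmult_lt_0_compat; lra).
  assert (Nw : forall xi : R, (w - xi)%C <> 0). { intros xi. apply im_ne_real. intros Z. rewrite Z in Hw. lra. }
  destruct (edge_integral (nonneg_part Ls) p (- eta) sig w Hsig Hw SL) as (CL & VL & UL & IL).
  destruct (edge_integral (nonpos_part Ls) p eta sig w Hsig Hw SU) as (CU & VU & UU & IU).
  set (D1 := usum (nonneg_part Ls) (dual_lower p eta w)). set (D2 := usum (nonpos_part Ls) (dual_upper p eta w)).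
  (* Up to the factor -(sig 2 pi i), the limits of the horizontal sides are the dual sums. *)
  assert (ED1 : D1 = (- (sig * twopii) * VL)%C).
  { unfold D1. apply usum_unique. apply (is_usum_ext _ (fun xi => - (sig * twopii) * edge_term p (- eta) sig w xi)%C).
    2: apply is_usum_scal; trivial. intros xi _. unfold edge_term, dual_lower.
    replace (- (2 * PI * (- eta)%R) * (w - xi))%C with (2 * PI * eta * (w - xi))%C by (rewrite RtoC_opp; ring).
    field. repeat split; trivial. apply twopii_neq_0. }
  assert (ED2 : D2 = (- (sig * twopii) * VU)%C).
  { unfold D2. apply usum_unique. apply (is_usum_ext _ (fun xi => - (sig * twopii) * edge_term p eta sig w xi)%C).
    2: apply is_usum_scal; trivial. intros xi _. unfold edge_term, dual_upper.
    field. repeat split; trivial. apply twopii_neq_0. }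
  assert (HS := usum_correct _ _ HR). set (S := usum (fun t => P t /\ 0 <= sig * t) (res_term rho sig w)) in *.
  apply Cmod_lt_0_eq. intros e He0.
  (* Bound for the far side apart from its exponential in T: the length 2 eta, the constant K of
     (e), and the growth of e^(2 pi i z w) caused by Re w. Four errors of size e / 5 arise in
     all. *)
  set (G := 2 * eta * (K * exp (2 * PI * eta * Rabs (fst w)))).
  destruct (exp_small (2 * PI * CL) mu Hmu (e / 5) ltac:(lra)) as [B1 HB1].
  destruct (exp_small (2 * PI * CU) mu Hmu (e / 5) ltac:(lra)) as [B2 HB2].
  destruct (exp_small G (mu - c) ltac:(lra) (e / 5) ltac:(lra)) as [B3 HB3].
  destruct (HS (e / 5 / (2 * PI))) as [l0 [F0 HF0]]. { apply Rdiv_lt_0_compat; lra. }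
  (* The sum of the absolute values bounds every point of l0, so T > B4 brings all of l0 into the
     contour. *)
  set (B4 := rsum Rabs l0).
  assert (L0 : forall t, In t l0 -> Rabs t <= B4).
  { unfold B4. clear. induction l0; simpl. intros t []. intros t [<-|Ht].
    assert (0 <= rsum Rabs l0) by (apply rsum_pos; intros; apply Rabs_pos). lra.
    assert (X := IHl0 t Ht). assert (Y := Rabs_pos a). lra. }
  destruct (HT (Rabs B1 + Rabs B2 + Rabs B3 + Rabs B4)) as (T & HT1 & HT2 & HT3).
  assert (Q1 := Rle_abs B1). assert (Q2 := Rle_abs B2). assert (Q3 := Rle_abs B3). assert (Q4 := Rle_abs B4).
  assert (Q1' := Rabs_pos B1). assert (Q2' := Rabs_pos B2). assert (Q3' := Rabs_pos B3). assert (Q4' := Rabs_pos B4).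
  assert (T0 : 0 < T) by lra.
  specialize (HB1 T ltac:(lra)). specialize (HB2 T ltac:(lra)). specialize (HB3 T ltac:(lra)).
  destruct (strip_fun_decomposition P rho Ls hh eta (T + 1) E D EE) as (L & H & ND & HLst & HH & EQ). fold N in EQ.
  (* For sig = -1 the reflection z -> -z carries the left rectangle to the right one; a residue at t
     becomes sig times that residue at sig t. *)
  set (cf := fun s : R => (sig * - (rho (sig * s)%R * E (sig * s)%R))%C).
  set (L' := map (fun t => sig * t) L).
  set (Q := fun z => (E (sig * z) * N (sig * z))%C).
  assert (REG : forall z, rect 0 T (- eta) eta z -> region (T + 1) eta (sig * z)%C).
  { intros z [Z1 Z2]. rewrite sig_mul. split; simpl; rewrite Rabs_mult, SA, Rmult_1_l; apply Rabs_lt_between; lra. }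
  assert (SI : forall t, sig * (sig * t) = t) by (intros t; rewrite <- Rmult_assoc, Sq; ring).
  assert (SIC : forall z : C, (sig * (sig * z) = z)%C) by (intros z; rewrite Cmult_assoc, SqC; ring).
  assert (HC : half_contour Q T eta (fin_sum (fun t => twopii * (contour_weight T t * cf t))%C L')).
  { apply half_contour_residues with (H := fun z => H (sig * z)%C); trivial.
    - intros z Hz. apply (cder_comp H (fun z => sig * z)%C). apply cder_mult. apply cder_const. apply cder_id. apply HH, REG; trivial.
    - intros t Ht Nt Et. apply in_map_iff in Ht. destruct Ht as [u [Eu Hu]]. apply Nt. unfold cf.
      rewrite Et. rewrite HT2. ring. rewrite <- Et, <- Eu, SI. apply HLst in Hu. tauto.
    - intros z Hz _ Nz. unfold Q. rewrite EQ; [|apply REG; trivial|].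
      + f_equal. unfold L'. rewrite fin_sum_map. apply fin_sum_ext. intros t Ht. unfold cf. rewrite SI.
        destruct (Ceq_dec (rho t) 0) as [->|Nr]. { unfold Cdiv. ring. }
        destruct (Ceq_dec (E t) 0) as [Z|Ne]. { exfalso. revert Z. apply cexp_neq_0. }
        assert (X : z <> RtoC (sig * t)).
        { apply Nz. apply in_map; trivial. unfold cf. rewrite SI. apply Cmult_neq_0; trivial.
          intros Z. apply (Cmult_neq_0 (rho t) (E t)); trivial. replace (rho t * E t)%C with (- - (rho t * E t))%C by ring. rewrite Z. ring. }
        assert (X1 : (z - RtoC (sig * t))%C <> 0) by (apply Cminus_neq_0; trivial).
        assert (X2 : (sig * z - t = sig * (z - RtoC (sig * t)))%C).
        { rewrite RtoC_mult. replace (sig * (z - sig * t))%C with (sig * z - sig * (sig * t))%C by ring. rewrite SIC. ring. }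
        rewrite X2. set (u := (- (rho t * E t))%C). rewrite <- (SIC u) at 1. field. split; trivial.
      + intros t Ht Nr Z. apply (Nz (sig * t)). apply in_map; trivial.
        unfold cf. rewrite SI. apply Cmult_neq_0; trivial. intros Z'.
        apply (Cmult_neq_0 (rho t) (E t)); trivial. apply cexp_neq_0. replace (rho t * E t)%C with (- - (rho t * E t))%C by ring. rewrite Z'. ring.
        rewrite RtoC_mult, <- Z. rewrite SIC. reflexivity. }
  (* Only poles with 0 <= sig t < T have nonzero weight. The filtered list is a finite part of the
     index set of S and contains l0, so the residues come close to S. *)
  set (q := fun t => if Rle_dec 0 (sig * t) then if Rlt_dec (sig * t) T then true else false else false).
  assert (ER : fin_sum (fun t => twopii * (contour_weight T t * cf t))%C L' =
               (- (sig * twopii) * fin_sum (res_term rho sig w) (filter q L))%C).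
  { unfold L'. rewrite fin_sum_map, <- fin_sum_scal.
    rewrite <- (fin_sum_filter _ q L).
    - apply fin_sum_ext. intros t Ht. apply filter_In in Ht. destruct Ht as [_ Ht]. unfold q in Ht.
      destruct (Rle_dec 0 (sig * t)); [|discriminate]. destruct (Rlt_dec (sig * t) T) as [Lt|]; [|discriminate].
      unfold contour_weight, cf, res_term. rewrite SI. destruct (Rlt_dec (sig * t) T); [|contradiction]. unfold E. ring.
    - intros t _ Ht. unfold contour_weight. unfold q in Ht.
      destruct (Rle_dec 0 (sig * t)) as [Y|Y]. destruct (Rlt_dec (sig * t) T); [discriminate|]. ring.
      replace (pos_weight (sig * t)) with 0. destruct (Rlt_dec (sig * t) T); ring.
      destruct (pos_weight_cases (sig * t)) as [[W ->]|[[W ->]|[W ->]]]; lra. }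
  rewrite ER in HC.
  assert (FS : Cmod (fin_sum (res_term rho sig w) (filter q L) - S) < e / 5 / (2 * PI)).
  { apply HF0.
    - split. apply NoDup_filter; trivial. intros t Ht. apply filter_In in Ht. destruct Ht as [Ht1 Ht2].
      split. apply HLst, Ht1. unfold q in Ht2. destruct (Rle_dec 0 (sig * t)); trivial. discriminate.
    - intros t Ht. assert (X := L0 t Ht). apply F0 in Ht. destruct Ht as [Pt St].
      assert (Y : - B4 <= t <= B4) by (apply Rabs_le_between; trivial).
      apply filter_In. split. apply HLst. split; trivial. lra.
      unfold q. destruct (Rle_dec 0 (sig * t)); [|contradiction]. destruct (Rlt_dec (sig * t) T) as [|Z]; trivial.
      exfalso. apply Z. assert (Y2 := Rle_abs (sig * t)). rewrite Rabs_mult, SA in Y2. lra. }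
  destruct HC as (Bt & U & Sd & V & H1 & H2 & H3 & H4 & HEQ).
  assert (EV : V = Ph).
  { refine (is_pv_unique (fun y => Ci * Q (0, y))%C eta V Ph H4 _).
    destruct Hsig as [-> | ->].
    - refine (is_pv_ext (pv_integrand N w) _ eta Ph He _ HPh). intros t _. unfold pv_integrand, Q, E.
      replace (1 * (0, t))%C with ((0, t) : C) by (apply injective_projections; simpl; ring). reflexivity.
    - refine (is_pv_ext (fun y => pv_integrand N w (- y)) _ eta Ph He _ (is_pv_opp_arg _ _ _ He HPh)).
      intros t _. unfold pv_integrand, Q, E.
      replace ((-1)%R * (0, t))%C with ((0, - t) : C) by (apply injective_projections; simpl; ring). reflexivity. }
  subst V.
  destruct (IL T T0) as (XL & IXL & DXL). destruct (IU T T0) as (XU & IXU & DXU).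
  replace (- (2 * PI * (sig * snd w) * T)) with (- (mu * T)) in DXL, DXU by reflexivity.
  apply (is_CI_scal twopii) in IXL. apply (is_CI_scal (- twopii)) in IXU.
  (* Reflection exchanges bottom and top, on which the two series carry opposite signs; both cases
     thus lead to the same formula with sig. *)
  assert (EDG : (Bt - U = sig * twopii * (XL + XU))%C).
  { assert (KL : is_CI (fun t => E ((sig * t)%R, (- eta)%R) * N ((sig * t)%R, (- eta)%R))%C 0 T (twopii * XL)).
    { eapply is_CI_ext; [| |exact IXL]. lra. intros t _. simpl. rewrite HL. unfold E. 
      match goal with |- (twopii * (?a * ?b) = ?c * (twopii * ?d))%C => change (twopii * (a * b) = a * (twopii * b))%C end. ring. }
    assert (KU : is_CI (fun t => E ((sig * t)%R, eta) * N ((sig * t)%R, eta))%C 0 T (- twopii * XU)).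
    { eapply is_CI_ext; [| |exact IXU]. lra. intros t _. simpl. rewrite HU. unfold E. 
      match goal with |- (- twopii * (?a * ?b) = ?c * (- twopii * ?d))%C => change (- twopii * (a * b) = a * (- twopii * b))%C end. ring. }
    assert (QL : forall t s, Q (t, s) = (E ((sig * t)%R, (sig * s)%R) * N ((sig * t)%R, (sig * s)%R))%C).
    { intros t s. unfold Q. rewrite sig_mul. reflexivity. }
    destruct Hsig as [-> | ->].
    - assert (X1 : Bt = (twopii * XL)%C).
      { apply is_CI_unique in H1, KL. rewrite <- H1, <- KL. apply CI_ext. lra. intros t _. rewrite QL.
        replace (1 * - eta) with (- eta) by ring. reflexivity. }
      assert (X2 : U = (- twopii * XU)%C).
      { apply is_CI_unique in H2, KU. rewrite <- H2, <- KU. apply CI_ext. lra. intros t _. rewrite QL.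
        replace (1 * eta) with eta by ring. reflexivity. }
      rewrite X1, X2. ring.
    - assert (X1 : Bt = (- twopii * XU)%C).
      { apply is_CI_unique in H1, KU. rewrite <- H1, <- KU. apply CI_ext. lra. intros t _. rewrite QL.
        replace (-1 * - eta) with eta by ring. reflexivity. }
      assert (X2 : U = (twopii * XL)%C).
      { apply is_CI_unique in H2, KL. rewrite <- H2, <- KL. apply CI_ext. lra. intros t _. rewrite QL.
        replace (-1 * eta) with (- eta) by ring. reflexivity. }
      rewrite X1, X2. apply injective_projections; simpl; ring. }
  apply is_CI_bound with (M := K * exp (2 * PI * eta * Rabs (fst w)) * exp (- ((mu - c) * T))) in H3; [|lra|].
  2: { intros y Hy. unfold Q. rewrite sig_mul. simpl. rewrite Cmod_mult.
    assert (Sy : Rabs (sig * y) <= eta). { rewrite Rabs_mult, SA, Rmult_1_l. apply Rabs_le; lra. }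
    specialize (HT3 (sig * y) Sy). fold N in HT3.
    unfold E. rewrite Cmod_cexp.
    replace (K * exp (2 * PI * eta * Rabs (fst w)) * exp (- ((mu - c) * T))) with
      (exp (2 * PI * eta * Rabs (fst w) + - (mu * T)) * (K * exp (c * T))).
    2: { replace (- ((mu - c) * T)) with (- (mu * T) + c * T) by ring. rewrite !exp_plus. ring. }
    apply Rmult_le_compat; trivial. left; apply exp_pos. apply Cmod_ge_0.
    assert (X : Re (twopii * ((sig * T)%R, (sig * y)%R) * w) <= 2 * PI * eta * Rabs (fst w) + - (mu * T)).
    { replace (Re (twopii * ((sig * T)%R, (sig * y)%R) * w)) with (- (mu * T) + 2 * PI * - (sig * y * fst w)).
      2: { unfold mu, twopii. simpl. ring. }
      assert (Y : - (sig * y * fst w) <= eta * Rabs (fst w)).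
      { eapply Rle_trans. apply Rle_abs. rewrite Rabs_Ropp, Rabs_mult. apply Rmult_le_compat_r; trivial. apply Rabs_pos. }
      assert (2 * PI * - (sig * y * fst w) <= 2 * PI * (eta * Rabs (fst w))) by (apply Rmult_le_compat_l; lra). lra. }
    apply exp_le; exact X. }
  (* Exact bookkeeping: the error consists of the two truncated rays, the far side and the missing
     residues. *)
  assert (FIN : (D1 + D2 + Ph - sig * twopii * S =
     sig * twopii * ((XL - VL) + (XU - VU)) + (Ci * Sd + sig * twopii * (fin_sum (res_term rho sig w) (filter q L) - S)))%C).
  { rewrite ED1, ED2.
    replace Ph with (Bt - U + Ci * Sd - (- (sig * twopii) * fin_sum (res_term rho sig w) (filter q L)))%C by (rewrite <- HEQ; ring).
    rewrite EDG. ring. }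
  rewrite FIN.
  assert (CS : forall z, Cmod (sig * twopii * z) = 2 * PI * Cmod z).
  { intros z. rewrite !Cmod_mult, Cmod_R, SA, Cmod_twopii. ring. }
  eapply Rle_trans. apply Cmod_triangle. rewrite CS.
  assert (Y1 := Cmod_triangle (XL - VL) (XU - VU)).
  assert (Y2 := Cmod_triangle (Ci * Sd) (sig * twopii * (fin_sum (res_term rho sig w) (filter q L) - S))).
  rewrite CS, Cmod_mult, Cmod_Ci in Y2.
  apply Rlt_div_r in FS; [|lra].
  assert (Y3 : 2 * PI * Cmod (XL - VL + (XU - VU)) <= 2 * PI * (CL * exp (- (mu * T)) + CU * exp (- (mu * T)))).
  { apply Rmult_le_compat_l; lra. }
  replace (2 * PI * CL * exp (- (mu * T))) with (2 * PI * (CL * exp (- (mu * T)))) in HB1 by ring.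
  replace (2 * PI * CU * exp (- (mu * T))) with (2 * PI * (CU * exp (- (mu * T)))) in HB2 by ring.
  unfold G in HB3. lra.
Qed.

(** * Analyticity in w *)

(** Existence comes from a rectangle so narrow that 0 is its only possible pole: [half_contour]
    supplies the principal value on its left side. *)
Lemma strip_fun_pv P rho Ls hh eta E : pole_data P rho Ls hh eta -> entire_fun E ->
  exists v, is_pv (fun y => Ci * (E (0, y) * strip_fun P rho Ls hh eta (0, y)))%C eta v.
Proof.
  intros D HE. assert (He : 0 < eta) by apply D.
  destruct (strip_fun_decomposition P rho Ls hh eta 1 E D HE) as (L & H & ND & HL & HH & EQ).
  destruct (list_avoid L 0) as (r & Hr & AV).
  set (T := Rmin (r / 2) (1 / 2)). assert (HT : 0 < T) by (apply Rmin_pos; lra).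
  assert (T1 : T <= r / 2) by apply Rmin_l. assert (T2 : T <= 1 / 2) by apply Rmin_r.
  assert (REG : forall z, rect 0 T (- eta) eta z -> region 1 eta z).
  { intros z [Z1 Z2]. split; apply Rabs_lt_between; lra. }
  assert (HC := half_contour_residues (fun z => E z * strip_fun P rho Ls hh eta z)%C H (fun t => - (rho t * E t))%C T eta L HT He).
  destruct HC as (B & U & S & V & _ & _ & _ & HV & _).
  - intros z Hz. apply HH, REG; trivial.
  - intros t Ht _ ->. assert (X := AV T Ht). assert (Y : RtoC T <> 0). { intros Z. injection Z. lra. }
    specialize (X Y). replace (T - 0)%C with (RtoC T) in X by ring. rewrite Cmod_R, Rabs_pos_eq in X; lra.
  - intros z Hz N0 _. apply EQ. apply REG; trivial. intros t Ht _ ->.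
    assert (X := AV t Ht N0). replace (t - 0)%C with (RtoC t) in X by ring.
    destruct Hz as [Hz _]. simpl in Hz. rewrite Cmod_R, Rabs_pos_eq in X; lra.
  - exists V. exact HV.
Qed.

Lemma is_pv_bound f a v M : 0 < a -> (forall t, 0 < Rabs t <= a -> Cmod (f t) <= M) -> is_pv f a v ->
  Cmod v <= 2 * a * M.
Proof.
  intros Ha HM H. apply Rnot_lt_le. intros N.
  assert (M0 : 0 <= M). { eapply Rle_trans. 2: apply (HM a); rewrite Rabs_pos_eq; lra. apply Cmod_ge_0. }
  destruct (H (Cmod v - 2 * a * M) ltac:(lra)) as (d & Hd & K).
  assert (X1 := Rmin_l d a). assert (X2 := Rmin_r d a). assert (X0 : 0 < Rmin d a) by (apply Rmin_pos; trivial).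
  destruct (K (Rmin d a / 2) ltac:(lra)) as (I1 & I2 & A1 & A2 & A3).
  assert (B1 : Cmod I1 <= (- (Rmin d a / 2) - - a) * M).
  { apply (is_CI_bound f (- a) (- (Rmin d a / 2)) I1 M); [lra| |exact A1]. intros t Ht. apply HM. rewrite Rabs_left; lra. }
  assert (B2 : Cmod I2 <= (a - Rmin d a / 2) * M).
  { apply (is_CI_bound f (Rmin d a / 2) a I2 M); [lra| |exact A2]. intros t Ht. apply HM. rewrite Rabs_pos_eq; lra. }
  assert (T1 := Cmod_triangle I1 I2). assert (T2 := Cmod_triangle_rev v (I1 + I2)). rewrite Cmod_minus_sym in T2.
  nra.
Qed.

(** At most a simple pole lies on the segment, at 0, and the factor |y| absorbs it. *)
Lemma strip_fun_segment_bound P rho Ls hh eta : pole_data P rho Ls hh eta -> exists B, 0 <= B /\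
  forall y, 0 < Rabs y <= eta -> Rabs y * Cmod (strip_fun P rho Ls hh eta (0, y)) <= B.
Proof.
  intros D. assert (He : 0 < eta) by apply D.
  destruct (strip_fun_decomposition P rho Ls hh eta 1 (fun _ => RtoC 1) D ltac:(intros z; apply cder_const)) as (L & H & ND & HL & HH & EQ).
  assert (REG : forall y, - eta <= y <= eta -> region 1 eta (0, y)).
  { intros y Hy. split; simpl. rewrite Rabs_R0; lra. apply Rabs_lt_between; lra. }
  destruct (rcont_bounded (fun y => H (0, y)) (- eta) eta ltac:(lra)) as [M HM].
  { intros t Ht. apply (rcont_cder_ver H 0 t). apply HH, REG; trivial. }
  set (B := rsum (fun t => Cmod (rho t)) L). assert (B0 : 0 <= B) by (apply rsum_pos; intros; apply Cmod_ge_0).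
  exists (B + eta * M). split.
  { assert (0 <= M). { eapply Rle_trans. 2: apply (HM 0); lra. apply Cmod_ge_0. } nra. }
  intros y [Hy0 Hy]. assert (Hy' : - eta <= y <= eta) by (apply Rabs_le_between; trivial).
  assert (Ny : y <> 0). { intros ->. rewrite Rabs_R0 in Hy0. lra. }
  replace (strip_fun P rho Ls hh eta (0, y)) with (1 * strip_fun P rho Ls hh eta (0, y))%C by ring.
  rewrite EQ; [|apply REG; trivial|intros t _ _ Z; injection Z; intros; contradiction].
  rewrite <- (Cmod_R y), <- Cmod_mult.
  rewrite Cmult_plus_distr_l, <- fin_sum_scal.
  eapply Rle_trans. apply Cmod_triangle. apply Rplus_le_compat.
  - apply Cmod_fin_sum. intros t _.
    assert (X : Rabs y <= Cmod ((0, y) - t)).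
    { destruct (Cmod_ge_max ((0, y) - t)) as [_ X]. simpl in X. replace (y + - 0) with y in X by ring. exact X. }
    replace (y * (- (rho t * 1) / ((0, y) - t)))%C with (y * - rho t / ((0, y) - t))%C by (unfold Cdiv; ring).
    replace (Cmod (rho t)) with (Rabs y * Cmod (rho t) / Rabs y) by (field; lra).
    apply cmod_div_le; trivial. rewrite Cmod_mult, Cmod_opp, Cmod_R. lra.
  - rewrite Cmod_mult, Cmod_R. apply Rmult_le_compat; trivial; try lra. apply Cmod_ge_0. apply HM; trivial.
Qed.

(** The kernel e^(2 pi i z w) is expanded to first order in w. Its remainder is small compared with
    |z| |y - w|, and the factor |z| cancels the pole at 0, so the estimate is uniform on the
    segment. *)
Lemma pv_cder P rho Ls hh eta (F : C -> C) : pole_data P rho Ls hh eta ->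
  (forall w, is_pv (pv_integrand (strip_fun P rho Ls hh eta) w) eta (F w)) -> forall w, cder F w.
Proof.
  intros D HF w. assert (He : 0 < eta) by apply D. assert (PP := PI_RGT_0).
  set (N := strip_fun P rho Ls hh eta) in *.
  (* The candidate for the derivative: the kernel differentiated in w, whose factor 2 pi i z removes
     the pole of the integrand. *)
  destruct (strip_fun_pv P rho Ls hh eta (fun z => twopii * z * cexp (twopii * z * w))%C D) as [l Hl].
  { intros z. assert (cder (fun z => twopii * z)%C z) by (apply cder_mult; [apply cder_const|apply cder_id]).
    apply cder_mult; trivial. apply cder_cexp. apply cder_mult; trivial. apply cder_const. }
  fold N in Hl.
  destruct (strip_fun_segment_bound P rho Ls hh eta D) as (B & B0 & HB). fold N in HB.
  set (W := exp (2 * PI * eta * Rabs (fst w))). assert (W0 : 0 < W) by apply exp_pos.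
  set (K := 2 * eta * (W * (2 * PI * B))). assert (K0 : 0 <= K).
  { unfold K. apply Rmult_le_pos. lra. apply Rmult_le_pos. lra. apply Rmult_le_pos; lra. }
  exists l. intros e Hepos.
  assert (EK : 0 < e / (K + 1)) by (apply Rdiv_lt_0_compat; lra).
  destruct (cdiff_cexp_0 _ EK) as [d [Hd HD]].
  exists (d / (2 * PI * eta)). assert (Q : 0 < 2 * PI * eta) by (apply Rmult_lt_0_compat; lra).
  split. apply Rdiv_lt_0_compat; trivial.
  intros y Hy. set (v := (y - w)%C) in *.
  assert (I := is_pv_plus _ _ _ _ _ (is_pv_plus _ _ _ _ _ (HF y) (is_pv_scal (- (1)) _ _ _ (HF w))) (is_pv_scal (- v) _ _ _ Hl)).
  apply is_pv_bound with (M := W * (e / (K + 1) * (2 * PI * Cmod v)) * B) in I; trivial.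
  - replace (F y - F w - l * v)%C with (F y + - (1) * F w + - v * l)%C by ring.
    eapply Rle_trans. exact I.
    replace (2 * eta * (W * (e / (K + 1) * (2 * PI * Cmod v)) * B)) with (e * Cmod v * (K / (K + 1))).
    2: { transitivity (e * Cmod v * ((2 * eta * (W * (2 * PI * B))) / (K + 1))). reflexivity. field. lra. }
    rewrite <- (Rmult_1_r (e * Cmod v)) at 2. apply Rmult_le_compat_l.
    apply Rmult_le_pos. lra. apply Cmod_ge_0. apply Rle_div_l; lra.
  - intros t Ht. unfold pv_integrand.
    set (u := (twopii * (0, t) * v)%C).
    match goal with |- Cmod ?x <= _ => replace x with (Ci * (cexp (twopii * (0, t) * w) * ((cexp u - 1 - u) * N (0, t))))%C end.
    2: { replace (twopii * (0, t) * y)%C with (twopii * (0, t) * w + u)%C by (unfold u, v; ring).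
         rewrite cexp_plus. unfold u. ring. }
    assert (Cu : Cmod u = 2 * PI * Rabs t * Cmod v).
    { unfold u. rewrite !Cmod_mult, Cmod_twopii. f_equal. f_equal.
      replace ((0, t) : C) with (Ci * t)%C by (apply injective_projections; simpl; ring).
      rewrite Cmod_mult, Cmod_Ci, Cmod_R. ring. }
    assert (V0 := Cmod_ge_0 v).
    rewrite !Cmod_mult, Cmod_Ci, Cmod_cexp, Rmult_1_l.
    apply Rlt_div_r in Hy; trivial.
    assert (Du : Cmod (u - 0) < d).
    { replace (u - 0)%C with u by ring. rewrite Cu. eapply Rle_lt_trans; [|exact Hy].
      fold v. rewrite (Rmult_comm (Cmod v)). apply Rmult_le_compat_r; trivial. apply Rmult_le_compat_l; lra. }
    specialize (HD u Du). rewrite cexp_0 in HD.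
    replace (cexp u - 1 - 1 * (u - 0))%C with (cexp u - 1 - u)%C in HD by ring.
    replace (u - 0)%C with u in HD by ring. rewrite Cu in HD.
    assert (E1 : exp (Re (twopii * (0, t) * w)) <= W).
    { unfold W. assert (X : Re (twopii * (0, t) * w) <= 2 * PI * eta * Rabs (fst w)).
      { replace (Re (twopii * (0, t) * w)) with (2 * PI * - (t * fst w)) by (unfold twopii; simpl; ring).
        rewrite (Rmult_assoc (2 * PI)). apply Rmult_le_compat_l. lra.
        eapply Rle_trans. apply Rle_abs. rewrite Rabs_Ropp, Rabs_mult. apply Rmult_le_compat_r. apply Rabs_pos. lra. }
      apply exp_le; exact X. }
    rewrite Rmult_assoc. apply Rmult_le_compat; trivial. left; apply exp_pos.
    { apply Rmult_le_pos; apply Cmod_ge_0. }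
    apply Rle_trans with (e / (K + 1) * (2 * PI * Rabs t * Cmod v) * Cmod (N (0, t))).
    { apply Rmult_le_compat_r. apply Cmod_ge_0. exact HD. }
    replace (e / (K + 1) * (2 * PI * Rabs t * Cmod v) * Cmod (N (0, t))) with
      (e / (K + 1) * (2 * PI * Cmod v) * (Rabs t * Cmod (N (0, t)))) by ring.
    apply Rmult_le_compat_l. 2: apply HB; trivial.
    apply Rmult_le_pos. left; apply Rdiv_lt_0_compat; lra. apply Rmult_le_pos; lra.
Qed.

(** * The sum over the nodes of the transform side *)

(** Merges the two sums over the nodes: one exponential for each sign of xi and their mean at xi =
    0. It equals 1 at v = 0, so the quotient by w - xi has residue h(xi). *)
Definition dual_kernel (eta xi : R) (v : C) : C :=
  (pos_weight xi * cexp (2 * PI * eta * v) + neg_weight xi * cexp (- (2 * PI * eta) * v))%C.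

Definition dual_term (hh : R -> C) (eta : R) (w : C) (xi : R) : C :=
  (hh xi * (dual_kernel eta xi (w - xi) / (w - xi)))%C.

Lemma dual_kernel_bound eta xi w : 0 < eta ->
  Cmod (dual_kernel eta xi (w - xi)) <= exp (2 * PI * eta * Rabs (fst w)) * exp (- (2 * PI * eta * Rabs xi)).
Proof.
  intros He. unfold dual_kernel. assert (PP := PI_RGT_0).
  assert (Q : 0 < 2 * PI * eta) by (apply Rmult_lt_0_compat; lra).
  eapply Rle_trans. apply Cmod_triangle. rewrite !Cmod_mult, !Cmod_R, !Cmod_cexp.
  rewrite <- exp_plus.
  replace (Re (2 * PI * eta * (w - xi))) with (2 * PI * eta * (fst w - xi)) by (simpl; ring).
  replace (Re (- (2 * PI * eta) * (w - xi))) with (2 * PI * eta * (xi - fst w)) by (simpl; ring).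
  replace (2 * PI * eta * Rabs (fst w) + - (2 * PI * eta * Rabs xi)) with (2 * PI * eta * (Rabs (fst w) - Rabs xi)) by ring.
  assert (M : forall a b, a <= b -> exp (2 * PI * eta * a) <= exp (2 * PI * eta * b)).
  { intros a b [L | ->]. left. apply exp_increasing. apply Rmult_lt_compat_l; trivial. lra. }
  assert (W1 := Rle_abs (fst w)). assert (W2 := Rle_abs (- fst w)). rewrite Rabs_Ropp in W2.
  unfold neg_weight. destruct (pos_weight_cases xi) as [[H ->]|[[H ->]|[H ->]]].
  - rewrite Rminus_0_r, Rabs_R0, Rabs_R1. rewrite (Rabs_left xi) by lra.
    assert (X := M (xi - fst w) (Rabs (fst w) - - xi) ltac:(lra)). lra.
  - subst xi. rewrite Rabs_R0. rewrite !Rabs_pos_eq by lra.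
    assert (X := M (0 - fst w) (Rabs (fst w) - 0) ltac:(lra)). assert (Y := M (fst w - 0) (Rabs (fst w) - 0) ltac:(lra)). lra.
  - replace (1 - 1) with 0 by ring. rewrite Rabs_R0, Rabs_R1. rewrite (Rabs_pos_eq xi) by lra.
    assert (X := M (fst w - xi) (Rabs (fst w) - xi) ltac:(lra)). lra.
Qed.

Lemma dual_kernel_cder eta xi v : cder (dual_kernel eta xi) v.
Proof.
  apply cder_plus; apply cder_mult; try apply cder_const; apply cder_cexp;
  apply cder_mult; try apply cder_const; apply cder_id.
Qed.

Lemma dual_kernel_0 eta xi : dual_kernel eta xi 0 = 1.
Proof.
  unfold dual_kernel, neg_weight. rewrite !Cmult_0_r, cexp_0, RtoC_minus. ring.
Qed.

Lemma dual_numerator_cder hh eta xi w : cder (fun w => hh xi * dual_kernel eta xi (w - xi))%C w.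
Proof.
  apply cder_mult. apply cder_const. apply (cder_comp (dual_kernel eta xi) (fun w => w - xi)%C).
  apply cder_minus_const. apply dual_kernel_cder.
Qed.

(** Nodes within 2 of Re w0 are split off; for |w - w0| < 1 the others keep distance above 1, and
    [dual_kernel_bound] dominates them uniformly. *)
Lemma dual_sum_split Ls hh eta w0 : 0 < eta -> loc_fin Ls ->
  summ Ls (fun xi => Cmod (hh xi) * exp (- (2 * PI * eta * Rabs xi))) -> exists L T,
  NoDup L /\ (forall t, In t L -> Ls t) /\ (forall t, Ls t -> w0 = RtoC t -> In t L) /\
  (forall w, Cmod (w - w0) < 1 -> cder T w) /\
  (forall w, Cmod (w - w0) < 1 -> abs_summable Ls (dual_term hh eta w) /\
     usum Ls (dual_term hh eta w) = (fin_sum (dual_term hh eta w) L + T w)%C).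
Proof.
  intros He HP HS. destruct (HP (fst w0 - 2) (fst w0 + 2)) as [L [ND HL]].
  set (P' := fun t => Ls t /\ ~ In t L).
  assert (PP := PI_RGT_0).
  assert (far : forall t w, P' t -> Cmod (w - w0) < 1 -> 1 < Cmod (w - t)).
  { intros t w [A B] Hw. assert (X := real_dist w t). refine (Rlt_le_trans _ _ _ _ X).
    destruct (Cmod_ge_max (w - w0)) as [Y _]. simpl in Y. apply Rle_lt_trans with (2 := Hw) in Y.
    apply Rabs_lt_between in Y. rewrite HL in B.
    destruct (Rlt_le_dec t (fst w0 - 2)) as [Q|Q]. rewrite Rabs_pos_eq; lra.
    destruct (Rlt_le_dec (fst w0 + 2) t) as [Q'|Q']. rewrite Rabs_left; lra. exfalso. apply B. split; trivial; lra. }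
  set (k := exp (2 * PI * eta * (Rabs (fst w0) + 1))).
  set (M := fun xi => k * (Cmod (hh xi) * exp (- (2 * PI * eta * Rabs xi)))).
  assert (SM : summ P' M).
  { apply summ_subset with Ls. unfold P'; tauto. apply summ_scal; trivial. left; apply exp_pos. }
  assert (BD : forall w t, P' t -> Cmod (w - w0) < 1 -> Cmod (dual_term hh eta w t) <= M t).
  { intros w t Ht Hw. assert (X := far t w Ht Hw). unfold dual_term, M.
    replace (hh t * (dual_kernel eta t (w - t) / (w - t)))%C with (hh t * dual_kernel eta t (w - t) / (w - t))%C by (unfold Cdiv; ring).
    rewrite <- (Rdiv_1_r (k * _)). apply cmod_div_le; try lra. rewrite Cmod_mult.
    assert (Y := dual_kernel_bound eta t w He).
    replace (k * (Cmod (hh t) * exp (- (2 * PI * eta * Rabs t)))) with (Cmod (hh t) * (k * exp (- (2 * PI * eta * Rabs t)))) by ring.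
    apply Rmult_le_compat_l. apply Cmod_ge_0. eapply Rle_trans. exact Y. apply Rmult_le_compat_r. left; apply exp_pos.
    unfold k. left. apply exp_increasing. apply Rmult_lt_compat_l. apply Rmult_lt_0_compat; lra.
    destruct (Cmod_ge_max (w - w0)) as [Z _]. simpl in Z.
    assert (T := Rabs_triang (fst w0) (fst w + - fst w0)). replace (fst w0 + (fst w + - fst w0)) with (fst w) in T by ring. lra. }
  exists L, (fun w => usum P' (dual_term hh eta w)).
  split; trivial. split. intros t Ht; apply HL, Ht. split.
  { intros t Ht ->. apply HL. simpl. split; trivial. lra. }
  split.
  - intros w Hw. apply (usum_cder P' M (fun t w => dual_term hh eta w t) w (1 - Cmod (w - w0))); trivial. lra.
    intros t z Ht Hz. assert (Dz : Cmod (z - w0) < 1). { assert (T := Cmod_triangle3 z w w0). lra. }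
    split. 2: apply BD; trivial. unfold dual_term.
    apply cder_ext with (fun w => (hh t * dual_kernel eta t (w - t)) / (w - t))%C. intros; unfold Cdiv; ring.
    apply cder_div. apply dual_numerator_cder. apply cder_minus_const. apply Cmod_gt_0. assert (X := far t z Ht Dz). lra.
  - intros w Hw.
    assert (AS : abs_summable P' (dual_term hh eta w)).
    { apply summ_abs_summable with (1 := SM). intros t Ht. apply BD; trivial. }
    assert (U := usum_correct _ _ AS).
    assert (FP : finite_part Ls L) by (split; trivial; intros t Ht; apply HL, Ht).
    apply is_usum_remove in U; trivial.
    split. 2: { apply usum_unique in U. rewrite U. ring. }
    destruct AS as [B HB]. exists (rsum (fun t => Cmod (dual_term hh eta w t)) L + B). intros l Hl.
    rewrite fin_sum_mod_rsum.
    assert (X1 : rsum (fun t => Cmod (dual_term hh eta w t)) (ldiff l L) <= B).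
    { apply HB. split. apply NoDup_filter, Hl. intros t Ht. apply in_ldiff in Ht. split. apply Hl, Ht. apply Ht. }
    set (F := fun t => Cmod (dual_term hh eta w t)) in *.
    assert (F0 : forall t, 0 <= F t) by (intros; apply Cmod_ge_0).
    assert (X2 : rsum F l <= rsum F (L ++ ldiff l L)).
    { rewrite (rsum_perm F l (filter (memb L) l ++ ldiff l L)).
      - rewrite !rsum_app. apply Rplus_le_compat_r.
        assert (P2 : Permutation L (filter (memb L) l ++ ldiff L (filter (memb L) l))).
        { apply perm_ldiff; trivial. apply NoDup_filter, Hl. intros t Ht. apply filter_In in Ht. destruct Ht as [_ Ht].
          unfold memb in Ht. destruct (in_dec Req_EM_T t L); trivial. discriminate. }
        rewrite (rsum_perm F _ _ P2), rsum_app.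
        assert (0 <= rsum F (ldiff L (filter (memb L) l))) by (apply rsum_pos; auto). lra.
      - unfold ldiff. clear. induction l; simpl. constructor. destruct (memb L a); simpl.
        constructor; trivial. apply Permutation_cons_app; trivial. }
    rewrite rsum_app in X2. lra.
Qed.

(** A node with nonzero coefficient is a simple pole, one with zero coefficient is no singularity.
    R0 stands for the entire part of the final formula, the Heaviside term and Phi. *)
Lemma dual_sum_meromorphic Ls hh eta R0 : 0 < eta -> loc_fin Ls ->
  summ Ls (fun xi => Cmod (hh xi) * exp (- (2 * PI * eta * Rabs xi))) -> entire_fun R0 ->
  meromorphic (fun w => usum Ls (dual_term hh eta w) + R0 w)%C /\
  forall w, (forall xi, Ls xi -> w <> RtoC xi) -> cder (fun w => usum Ls (dual_term hh eta w) + R0 w)%C w.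
Proof.
  intros He HP HS HR.
  assert (MAIN : forall w0, (exists (xi : R) (phi : C -> C) (r : R), Ls xi /\ w0 = RtoC xi /\ 0 < r /\ hh xi <> 0 /\ phi w0 <> 0 /\
       (forall w, Cmod (w - w0) < r -> cder phi w) /\
       forall w, 0 < Cmod (w - w0) < r -> (usum Ls (dual_term hh eta w) + R0 w)%C = (phi w / (w - w0))%C) \/
     holo_at (fun w => usum Ls (dual_term hh eta w) + R0 w)%C w0).
  { intros w0. destruct (dual_sum_split Ls hh eta w0 He HP HS) as (L & T & ND & H1 & H2 & H3 & H4).
    destruct (list_avoid L w0) as (r0 & Hr0 & AV).
    set (r := Rmin r0 1). assert (Hr : 0 < r) by (apply Rmin_pos; lra).
    assert (R1 : r <= r0) by apply Rmin_l. assert (R2 : r <= 1) by apply Rmin_r.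
    assert (TD : forall t w, RtoC t <> w0 -> In t L -> Cmod (w - w0) < r -> cder (fun w => dual_term hh eta w t) w).
    { intros t w Nt Ht Hw. unfold dual_term.
      apply cder_ext with (fun w => (hh t * dual_kernel eta t (w - t)) / (w - t))%C. intros; unfold Cdiv; ring.
      apply cder_div. apply dual_numerator_cder. apply cder_minus_const. apply Cminus_neq_0. intros ->.
      assert (X := AV t Ht Nt). lra. }
    destruct (classic (exists xi, In xi L /\ w0 = RtoC xi /\ hh xi <> 0)) as [(xi & X1 & X2 & X3)|N].
    - left. exists xi, (fun w => hh xi * dual_kernel eta xi (w - xi) + (w - xi) * (fin_sum (dual_term hh eta w) (ldiff L [xi]) + T w + R0 w))%C, r.
      split; auto. split; trivial. split; trivial. split; trivial. split; [|split].
      + subst w0. replace (xi - xi)%C with (RtoC 0) by ring. rewrite dual_kernel_0.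
        intros Z. apply X3. rewrite <- Z. ring.
      + intros w Hw. apply cder_plus. apply dual_numerator_cder. apply cder_mult. apply cder_minus_const.
        apply cder_plus; [|apply HR]. apply cder_plus. 2: apply H3; lra.
        apply (cder_fin_sum (fun t w => dual_term hh eta w t)). intros t Ht. apply in_ldiff in Ht. apply TD; trivial.
        intros Z. apply Ht. left. apply RtoC_inj. congruence. apply Ht.
      + intros w [Hw0 Hw]. rewrite (proj2 (H4 w ltac:(lra))). rewrite (fin_sum_ldiff _ L [xi]); trivial.
        2: constructor; [intros []|constructor]. 2: intros t [<-|[]]; trivial.
        simpl. unfold dual_term at 1. subst w0. field. apply Cmod_gt_0; trivial.
    - right. exists r. split; trivial. intros w Hw.
      apply cder_plus; [|apply HR].
      apply cder_local with (f := fun w => (fin_sum (dual_term hh eta w) L + T w)%C) (r := 1 - Cmod (w - w0)). lra.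
      { intros y Hy. symmetry. apply H4. assert (X := Cmod_triangle3 y w w0). lra. }
      apply cder_plus. 2: apply H3; lra.
      apply (cder_fin_sum (fun t w => dual_term hh eta w t)). intros t Ht.
      destruct (Ceq_dec t w0) as [Z|Z]. 2: apply TD; trivial.
      destruct (Ceq_dec (hh t) 0) as [Z'|Z'].
      + apply cder_ext with (fun _ => RtoC 0). intros y. unfold dual_term. rewrite Z'. ring. apply cder_const.
      + exfalso. apply N. exists t. auto. }
  split.
  - intros w0. destruct (MAIN w0) as [(xi & phi & r & X1 & X2 & X3 & X4 & X5 & X6 & X7)|X].
    + right. exists 1%nat, phi, r. split. lia. split. apply holomorphic_at_holo. exists r; auto.
      split; trivial. split; trivial. intros w Hw. rewrite X7 by trivial. f_equal. simpl. ring.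
    + left. apply holomorphic_at_holo; trivial.
  - intros w Hw. destruct (MAIN w) as [(xi & phi & r & X1 & X2 & _)|[r [Hr X]]].
    + exfalso. apply (Hw xi); trivial.
    + apply X. rewrite Cmod_self; trivial.
Qed.

(** * The data of an interpolation formula *)

Lemma summ_singleton a (M : R -> R) : 0 <= M a -> summ (fun t => t = a) M.
Proof.
  intros H. split. intros t ->; trivial. exists (M a). intros l [ND Hl].
  destruct l as [|t [|u l]]; simpl; trivial.
  - rewrite (Hl t) by (left; trivial). lra.
  - exfalso. rewrite (Hl t), (Hl u) in ND by (simpl; auto). inversion ND. apply H2. left; trivial.
Qed.

Lemma is_usum_zero A (f : R -> C) : (forall t, A t -> f t = RtoC 0) -> is_usum A f 0.
Proof.
  intros H e He. exists []. split. apply fp_nil. intros l Hl _.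
  replace (fin_sum f l) with (RtoC 0). rewrite Cmod_self; trivial.
  destruct Hl as [_ Hl]. induction l; simpl; trivial. rewrite (H a), <- IHl. ring.
  intros; apply Hl; right; trivial. apply Hl. left; trivial.
Qed.

Lemma set_ext (A B : R -> Prop) : (forall t, A t <-> B t) -> A = B.
Proof.
  intros H. apply functional_extensionality. intros t. apply propositional_extensionality. trivial.
Qed.

Lemma prime_term_mult a b t : prime_term (fun l => a l * b l)%C t = (prime_term a t * b t)%C.
Proof. unfold prime_term. destruct (Req_EM_T t 0); trivial. unfold Cdiv. ring. Qed.

Lemma prime_term_0 a : prime_term a 0 = (a 0 / 2)%C.
Proof. unfold prime_term. destruct (Req_EM_T 0 0); tauto. Qed.

Lemma prime_term_ne a t : t <> 0 -> prime_term a t = a t.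
Proof. intros H. unfold prime_term. destruct (Req_EM_T t 0); tauto. Qed.

Lemma Cmod_prime_le a t : Cmod (a t) <= 2 * Cmod (prime_term a t).
Proof.
  destruct (Req_EM_T t 0) as [->|N].
  - rewrite prime_term_0, Cmod_div by (intros Z; injection Z; lra). rewrite Cmod_R, Rabs_pos_eq; lra.
  - rewrite prime_term_ne by trivial. assert (X := Cmod_ge_0 (a t)). lra.
Qed.

Definition is_one (x t : R) : C := if Req_EM_T t x then 1 else 0.

(** Encodes (c) with f(x) moved to the side of the sums: x becomes a node with coefficient -1, added
    to g_x(x) if x lies in La. *)
Definition rho_of (La : R -> Prop) (gx : R -> C) (x t : R) : C := (ext0 La gx t - is_one x t)%C.

Lemma is_one_eq x : is_one x x = 1.
Proof. unfold is_one. destruct (Req_EM_T x x); tauto. Qed.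
Lemma is_one_ne x t : t <> x -> is_one x t = 0.
Proof. intros H. unfold is_one. destruct (Req_EM_T t x); tauto. Qed.

Lemma rho_ne La gx x t : La t -> t <> x -> rho_of La gx x t = gx t.
Proof. intros H N. unfold rho_of. rewrite ext0_in, is_one_ne by trivial. ring. Qed.

(** A single index never affects summability; applied to the node x and to the halved index 0. *)
Lemma summ_add_point (A A' : R -> Prop) (M M' : R -> R) x : summ A M -> 0 <= M' x ->
  (forall t, A' t -> t <> x -> A t) -> (forall t, A t -> t <> x -> 0 <= M' t <= M t) -> summ A' M'.
Proof.
  intros HA Hx S HM. apply summ_subset with (fun t => (A t /\ t <> x) \/ t = x).
  - intros t Ht. destruct (Req_dec t x); auto.
  - apply summ_union. 2: apply summ_singleton; trivial.
    apply summ_le with M. apply summ_subset with A; trivial. tauto. intros t [H1 H2]; auto.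
Qed.

(** From (|t| - pi nu)^2 >= 0. It turns the absolute convergence in (d) into summability against a
    Gaussian. *)
Lemma gauss_vs_exp nu t : exp (- (t * t)) <= exp (PI * nu * (PI * nu)) * exp (- (2 * PI * nu * Rabs t)).
Proof.
  rewrite <- exp_plus.
  assert (X : - (t * t) <= PI * nu * (PI * nu) + - (2 * PI * nu * Rabs t)).
  { assert (Y := Rle_0_sqr (Rabs t - PI * nu)). unfold Rsqr in Y.
    assert (Z : Rabs t * Rabs t = t * t) by (rewrite <- Rabs_mult; apply Rabs_pos_eq, Rle_0_sqr). nra. }
  apply exp_le; exact X.
Qed.

Lemma summ_two_sided A (a : R -> C) (k : R) :
  summ (nonneg_part A) (fun t => Cmod (prime_term a t) * exp (- (k * t))) ->
  summ (nonpos_part A) (fun t => Cmod (prime_term a t) * exp (k * t)) ->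
  summ A (fun t => Cmod (a t) * exp (- (k * Rabs t))).
Proof.
  intros H1 H2. set (M := fun t => 2 * (Cmod (prime_term a t) * exp (- (k * Rabs t)))).
  apply summ_le with M.
  - apply summ_subset with (fun t => nonneg_part A t \/ nonpos_part A t).
    + intros t Ht. unfold nonneg_part, nonpos_part. destruct (Rle_lt_dec 0 t); [left|right]; split; trivial; lra.
    + apply summ_scal. lra. apply summ_union.
      * apply summ_le with (1 := H1). intros t [Ht T0]. rewrite Rabs_pos_eq by trivial. split. 
        apply Rmult_le_pos. apply Cmod_ge_0. left; apply exp_pos. lra.
      * apply summ_le with (1 := H2). intros t [Ht T0]. rewrite Rabs_left1 by trivial.
        replace (- (k * - t)) with (k * t) by ring. split.
        apply Rmult_le_pos. apply Cmod_ge_0. left; apply exp_pos. lra.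
  - intros t Ht. unfold M. assert (E := exp_pos (- (k * Rabs t))). split.
    apply Rmult_le_pos. apply Cmod_ge_0. lra. rewrite <- Rmult_assoc. apply Rmult_le_compat_r. lra. apply Cmod_prime_le.
Qed.

Lemma Cmod_cexp_real_imag (t : R) (w : C) : Cmod (cexp (twopii * t * w)) = exp (- (2 * PI * t * snd w)).
Proof. rewrite Cmod_cexp. f_equal. unfold twopii. simpl. ring. Qed.

Lemma Estar_term_eq g x w t : Estar_term g x w t = (prime_term (fun l => g l x) t * cexp (twopii * t * w))%C.
Proof. unfold Estar_term. apply (prime_term_mult (fun l => g l x) (fun l => cexp (twopii * l * w))). Qed.

Lemma E_term_eq h x z t : E_term h x z t = qterm (prime_term (fun l => h l x)) z t.
Proof. unfold E_term, qterm. apply (prime_term_mult (fun l => h l x) (fun l => cexp (- twopii * l * z))). Qed.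

(** Covers both sides of the real axis. Replacing each Fourier transform in (c) by its shifted
    version adds exactly the terms of e^(-z^2) E_+ above and of -e^(-z^2) E_- below; everything else
    cancels by (c). *)
Lemma interpolation_upper La Ls (g h : R -> R -> C) eta x z :
  pole_data (fun t => La t \/ t = x) (rho_of La (fun l => g l x) x) Ls (fun l => h l x) eta ->
  eta <= Rabs (snd z) < 3 / 2 * eta ->
  summ (nonpos_part Ls) (fun t => Cmod (prime_term (fun l => h l x) t) * exp (2 * PI * eta * t)) ->
  summ (nonneg_part Ls) (fun t => Cmod (prime_term (fun l => h l x) t) * exp (2 * PI * - eta * t)) ->
  (exists s t : C, is_usum La (fun l => f_eps 1 z l * g l x)%C s /\
        is_usum Ls (fun l => fourier (f_eps 1 z) l * h l x)%C t /\
        f_eps 1 z x = (s + t)%C) ->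
  strip_fun (fun t => La t \/ t = x) (rho_of La (fun l => g l x) x) Ls (fun l => h l x) eta z =
  (if Rlt_dec 0 (snd z) then - E_plus Ls h x z else E_minus Ls h x z)%C.
Proof.
  intros D Hz SU SL (s & t & Hs & Ht & EQ). assert (He : 0 < eta) by apply D.
  set (P := fun t => La t \/ t = x). set (rho := rho_of La (fun l => g l x) x). set (hh := fun l => h l x).
  assert (PP := PI_RGT_0).
  assert (Nz : forall l : R, (z - l)%C <> 0).
  { intros l. apply im_ne_real. intros Z. rewrite Z, Rabs_R0 in Hz. lra. }
  assert (FE : forall l, f_eps 1 z l = (exp (- (l * l)) / (z - l))%C).
  { intros l. unfold f_eps. replace (- (1) * l ^ 2)%R with (- (l * l)) by ring. reflexivity. }
  assert (A1 : is_usum P (fun t => pole_term rho t z) (s - f_eps 1 z x)).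
  { apply (is_usum_ext0 La P) in Hs. 2: intros; left; trivial.
    assert (H1 := is_usum_single P (fun t => (is_one x t * f_eps 1 z t)%C) x (or_intror eq_refl)).
    cbv beta in H1. rewrite is_one_eq in H1. replace (1 * f_eps 1 z x)%C with (f_eps 1 z x) in H1 by ring.
    assert (H2 := is_usum_minus _ _ _ _ _ Hs (H1 ltac:(intros u _ Nu; rewrite is_one_ne by trivial; ring))).
    eapply is_usum_ext; [|exact H2]. intros u Hu. simpl. unfold pole_term, rho, rho_of.
    rewrite FE. destruct (classic (La u)) as [L|L].
    rewrite !ext0_in by trivial. rewrite FE. field; auto. rewrite !ext0_out by trivial. field; auto. }
  set (p := prime_term hh).
  set (G := cexp (- (z * z))).
  assert (GE : forall xi : R, gauss_char xi z = (G * cexp (- twopii * xi * z))%C).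
  { intros xi. unfold gauss_char, G. rewrite <- cexp_plus. f_equal. ring. }
  assert (GI : (cexp (z * z) * G)%C = 1).
  { unfold G. rewrite <- cexp_plus. replace (z * z + - (z * z))%C with (RtoC 0) by ring. apply cexp_0. }
  assert (WP : forall xi, Ls xi -> (pos_weight xi * (hh xi * cexp (- twopii * xi * z)))%C = ext0 (nonneg_part Ls) (qterm p z) xi).
  { intros xi Hxi. unfold qterm. destruct (pos_weight_cases xi) as [[C1 ->]|[[C1 ->]|[C1 ->]]].
    - rewrite ext0_out. ring. intros [_ X]. lra.
    - subst xi. rewrite ext0_in by (split; trivial; lra). unfold p. rewrite prime_term_0. rewrite RtoC_div by lra. field.
    - rewrite ext0_in by (split; trivial; lra). unfold p. rewrite prime_term_ne by lra. ring. }
  assert (WN : forall xi, Ls xi -> (neg_weight xi * (hh xi * cexp (- twopii * xi * z)))%C = ext0 (nonpos_part Ls) (qterm p z) xi).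
  { intros xi Hxi. unfold qterm, neg_weight. destruct (pos_weight_cases xi) as [[C1 ->]|[[C1 ->]|[C1 ->]]].
    - rewrite ext0_in by (split; trivial; lra). unfold p. rewrite prime_term_ne by lra. rewrite RtoC_minus. ring.
    - subst xi. rewrite ext0_in by (split; trivial; lra). unfold p. rewrite prime_term_0. rewrite RtoC_minus, RtoC_div by lra. field.
    - rewrite ext0_out. rewrite RtoC_minus. ring. intros [_ X]. lra. }
  assert (QB : forall xi, Cmod (qterm p z xi) = Cmod (p xi) * exp (2 * PI * snd z * xi)).
  { intros xi. unfold qterm. rewrite Cmod_mult, Cmod_cexp. f_equal. f_equal. unfold twopii; simpl; ring. }
  (* The pole terms contribute s - f(x) and the shifted transforms t + Fs, so (c) leaves Fs
     alone. *)
  assert (FIN : forall Fs : C, is_usum Ls (fun xi => hh xi * shifted_fourier eta xi z)%C (t + Fs)%C ->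
      strip_fun P rho Ls hh eta z = (- cexp (z * z) * Fs)%C).
  { intros Fs HF. unfold strip_fun. f_equal. unfold strip_sum.
    rewrite (usum_unique _ _ _ A1), (usum_unique _ _ _ HF), EQ. ring. }
  destruct (Rlt_dec 0 (snd z)) as [Pz|Pz].
  - rewrite (Rabs_pos_eq (snd z)) in Hz by lra.
    assert (AS : abs_summable (nonpos_part Ls) (qterm p z)).
    { apply summ_abs_summable with (1 := SU). intros xi [_ Hxi]. rewrite QB. apply Rmult_le_compat_l. apply Cmod_ge_0.
      assert (X : 2 * PI * snd z * xi <= 2 * PI * eta * xi)
        by (rewrite !(Rmult_assoc (2 * PI)); apply Rmult_le_compat_l; nra).
      apply exp_le; exact X. }
    assert (U := usum_correct _ _ AS).
    rewrite (FIN (twopii * G * usum (nonpos_part Ls) (qterm p z))%C).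
    + unfold E_plus. replace (usum (nonpos_part Ls) (E_term h x z)) with (usum (nonpos_part Ls) (qterm p z)).
      set (S := usum (nonpos_part Ls) (qterm p z)).
      replace (- cexp (z * z) * (twopii * G * S))%C with (- (cexp (z * z) * G) * (twopii * S))%C by ring. rewrite GI. ring.
      apply usum_ext. intros xi _. rewrite E_term_eq. reflexivity.
    + apply (is_usum_ext0 _ Ls) in U. 2: unfold nonpos_part; tauto.
      assert (H2 := is_usum_plus _ _ _ _ _ Ht (is_usum_scal _ (twopii * G) _ _ U)).
      eapply is_usum_ext; [|exact H2]. intros xi Hxi. simpl. rewrite <- WN by trivial.
      rewrite (fourier_upper eta xi z He Hz), GE. unfold hh. ring.
  - rewrite (Rabs_left1 (snd z)) in Hz by lra.
    assert (AS : abs_summable (nonneg_part Ls) (qterm p z)).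
    { apply summ_abs_summable with (1 := SL). intros xi [_ Hxi]. rewrite QB. apply Rmult_le_compat_l. apply Cmod_ge_0.
      assert (X : 2 * PI * snd z * xi <= 2 * PI * - eta * xi)
        by (rewrite !(Rmult_assoc (2 * PI)); apply Rmult_le_compat_l; nra).
      apply exp_le; exact X. }
    assert (U := usum_correct _ _ AS).
    rewrite (FIN (- (twopii * G) * usum (nonneg_part Ls) (qterm p z))%C).
    + unfold E_minus. replace (usum (nonneg_part Ls) (E_term h x z)) with (usum (nonneg_part Ls) (qterm p z)).
      set (S := usum (nonneg_part Ls) (qterm p z)).
      replace (- cexp (z * z) * (- (twopii * G) * S))%C with ((cexp (z * z) * G) * (twopii * S))%C by ring. rewrite GI. ring.
      apply usum_ext. intros xi _. rewrite E_term_eq. reflexivity.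
    + apply (is_usum_ext0 _ Ls) in U. 2: unfold nonneg_part; tauto.
      assert (H2 := is_usum_plus _ _ _ _ _ Ht (is_usum_scal _ (- (twopii * G)) _ _ U)).
      eapply is_usum_ext; [|exact H2]. intros xi Hxi. simpl. rewrite <- WP by trivial.
      rewrite (fourier_lower eta xi z He), GE by lra. unfold hh. ring.
Qed.

(** At index 0 each half contributes h(0)/2 with its own exponential, which is the mean built into
    [dual_kernel]. *)
Lemma dual_sum_parts Ls hh eta w : abs_summable Ls (dual_term hh eta w) ->
  abs_summable (nonneg_part Ls) (dual_lower (prime_term hh) eta w) /\
  abs_summable (nonpos_part Ls) (dual_upper (prime_term hh) eta w) /\
  usum Ls (dual_term hh eta w) =
    (usum (nonneg_part Ls) (dual_lower (prime_term hh) eta w) + usum (nonpos_part Ls) (dual_upper (prime_term hh) eta w))%C.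
Proof.
  intros AS. assert (S := abs_summable_summ _ _ AS).
  assert (P1 : forall xi, 0 < xi -> dual_lower (prime_term hh) eta w xi = dual_term hh eta w xi).
  { intros xi H. unfold dual_lower, dual_term, dual_kernel, neg_weight.
    destruct (pos_weight_cases xi) as [[C1 ->]|[[C1 ->]|[C1 ->]]]; try lra.
    rewrite prime_term_ne by lra. rewrite RtoC_minus. f_equal. unfold Cdiv. ring. }
  assert (P2 : forall xi, xi < 0 -> dual_upper (prime_term hh) eta w xi = dual_term hh eta w xi).
  { intros xi H. unfold dual_upper, dual_term, dual_kernel, neg_weight.
    destruct (pos_weight_cases xi) as [[C1 ->]|[[C1 ->]|[C1 ->]]]; try lra.
    rewrite prime_term_ne by lra. rewrite RtoC_minus. f_equal. unfold Cdiv. ring. }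
  assert (A1 : abs_summable (nonneg_part Ls) (dual_lower (prime_term hh) eta w)).
  { apply summ_abs_summable with (fun t => Cmod (dual_lower (prime_term hh) eta w t)); [|intros; lra].
    apply summ_add_point with (fun t => Ls t /\ 0 < t) (fun t => Cmod (dual_term hh eta w t)) 0.
    - apply summ_subset with Ls; trivial. tauto.
    - apply Cmod_ge_0.
    - intros t [H T0] N. split; trivial. lra.
    - intros t [_ Ht] _. rewrite P1 by trivial. split. apply Cmod_ge_0. lra. }
  assert (A2 : abs_summable (nonpos_part Ls) (dual_upper (prime_term hh) eta w)).
  { apply summ_abs_summable with (fun t => Cmod (dual_upper (prime_term hh) eta w t)); [|intros; lra].
    apply summ_add_point with (fun t => Ls t /\ t < 0) (fun t => Cmod (dual_term hh eta w t)) 0.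
    - apply summ_subset with Ls; trivial. tauto.
    - apply Cmod_ge_0.
    - intros t [H T0] N. split; trivial. lra.
    - intros t [_ Ht] _. rewrite P2 by trivial. split. apply Cmod_ge_0. lra. }
  split; trivial. split; trivial.
  assert (U1 := usum_correct _ _ A1). assert (U2 := usum_correct _ _ A2).
  apply (is_usum_ext0 _ Ls) in U1. 2: unfold nonneg_part; tauto.
  apply (is_usum_ext0 _ Ls) in U2. 2: unfold nonpos_part; tauto.
  apply usum_unique. eapply is_usum_ext; [|exact (is_usum_plus _ _ _ _ _ U1 U2)].
  intros xi Hxi. simpl. destruct (Rlt_le_dec xi 0) as [N|N]; [|destruct (Req_dec xi 0) as [->|N0]].
  - rewrite ext0_out, ext0_in, P2; trivial. ring. split; trivial; lra. intros [_ X]; lra.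
  - rewrite !ext0_in by (split; trivial; lra). unfold dual_lower, dual_upper, dual_term, dual_kernel, neg_weight.
    destruct (pos_weight_cases 0) as [[C1 ->]|[[C1 ->]|[C1 ->]]]; try lra.
    rewrite prime_term_0. rewrite RtoC_minus, RtoC_div by lra. unfold Cdiv.
    set (a := cexp (2 * PI * eta * (w - 0))). set (b := cexp (- (2 * PI * eta) * (w - 0))). set (c := (/ (w - 0))%C).
    field.
  - rewrite ext0_in, ext0_out, P1; trivial. ring. lra. intros [_ X]; lra. split; trivial; lra.
Qed.

Lemma half_set_pos (A : R -> Prop) : (fun t => A t /\ 0 <= 1 * t) = nonneg_part A.
Proof. apply set_ext. intros t. unfold nonneg_part. rewrite Rmult_1_l. tauto. Qed.

Lemma half_set_neg (A : R -> Prop) : (fun t => A t /\ 0 <= -1 * t) = nonpos_part A.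
Proof. apply set_ext. intros t. unfold nonpos_part. split; intros [H K]; split; trivial; lra. Qed.

(** The additional residue -1 at x enters with the weight of sig x and becomes the Heaviside term,
    in the same way whether or not x lies in La. *)
Lemma residue_sum La (g : R -> R -> C) x sig w : sgn1 sig ->
  abs_summable (fun t => La t /\ 0 <= sig * t) (Estar_term g x w) ->
  abs_summable (fun t => (La t \/ t = x) /\ 0 <= sig * t) (res_term (rho_of La (fun l => g l x) x) sig w) /\
  usum (fun t => (La t \/ t = x) /\ 0 <= sig * t) (res_term (rho_of La (fun l => g l x) x) sig w) =
  (usum (fun t => La t /\ 0 <= sig * t) (Estar_term g x w) - pos_weight (sig * x) * cexp (twopii * x * w))%C.
Proof.
  intros Hsig AS. set (A := fun t => La t /\ 0 <= sig * t). set (B := fun t => (La t \/ t = x) /\ 0 <= sig * t).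
  set (gx := fun l => g l x). set (rho := rho_of La gx x).
  assert (Ns : forall t, sig * t = 0 -> t = 0). { intros t. destruct Hsig as [-> | ->]; lra. }
  assert (ET : forall t, 0 <= sig * t -> Estar_term g x w t = (pos_weight (sig * t) * (gx t * cexp (twopii * t * w)))%C).
  { intros t Ht. rewrite Estar_term_eq. fold gx. destruct (pos_weight_cases (sig * t)) as [[C1 E]|[[C1 E]|[C1 E]]]; rewrite E.
    - lra.
    - apply Ns in C1. subst t. rewrite prime_term_0, RtoC_div by lra. field.
    - rewrite prime_term_ne. ring. intros ->. lra. }
  assert (S1 : abs_summable B (res_term rho sig w)).
  { apply summ_abs_summable with (fun t => Cmod (res_term rho sig w t)); [|intros; lra].
    apply summ_add_point with A (fun t => Cmod (Estar_term g x w t)) x.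
    - apply abs_summable_summ; trivial.
    - apply Cmod_ge_0.
    - intros t [[H|H] K] N; [split; trivial|contradiction].
    - intros t [H K] N. split. apply Cmod_ge_0. right. rewrite ET by trivial. unfold res_term, rho. rewrite rho_ne; trivial. }
  split; trivial. apply usum_unique.
  assert (U := usum_correct _ _ AS). fold A in U. apply (is_usum_ext0 A B) in U. 2: unfold A, B; tauto.
  assert (V : is_usum B (fun t => is_one x t * (pos_weight (sig * t) * cexp (twopii * t * w)))%C (pos_weight (sig * x) * cexp (twopii * x * w))%C).
  { destruct (Rle_lt_dec 0 (sig * x)) as [H|H].
    - assert (X := is_usum_single B (fun t => is_one x t * (pos_weight (sig * t) * cexp (twopii * t * w)))%C x).
      cbv beta in X. rewrite is_one_eq, Cmult_1_l in X. apply X. split; auto.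
      intros t _ Nt. rewrite is_one_ne by trivial. ring.
    - replace (pos_weight (sig * x)) with 0.
      2: { destruct (pos_weight_cases (sig * x)) as [[C1 E]|[[C1 E]|[C1 E]]]; lra. }
      rewrite Cmult_0_l. apply is_usum_zero. intros t [_ Ht]. rewrite is_one_ne. ring. intros ->. lra. }
  eapply is_usum_ext; [|exact (is_usum_minus _ _ _ _ _ U V)].
  intros t [Ht Ht']. simpl. unfold res_term, rho, rho_of.
  destruct (classic (La t)) as [H|H].
  - rewrite (ext0_in A) by (split; trivial). rewrite (ext0_in La) by trivial. rewrite ET by trivial. ring.
  - rewrite (ext0_out A) by (intros [X _]; contradiction). rewrite (ext0_out La) by trivial. ring.
Qed.

(** * Passing from a smaller half-plane to the half-plane of convergence *)

Lemma Estar_summ La (g : R -> R -> C) x sig nu : sgn1 sig ->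
  abs_summable (fun t => La t /\ 0 <= sig * t) (Estar_term g x (0, sig * nu)) ->
  summ (fun t => La t /\ 0 <= sig * t) (fun t => Cmod (prime_term (fun l => g l x) t) * exp (- (2 * PI * nu * Rabs t))).
Proof.
  intros Hsig AS. apply summ_le with (1 := abs_summable_summ _ _ AS). intros t [_ Ht].
  split. apply Rmult_le_pos. apply Cmod_ge_0. left; apply exp_pos.
  rewrite Estar_term_eq, Cmod_mult, Cmod_cexp_real_imag. simpl. right. f_equal. f_equal. f_equal.
  replace (Rabs t) with (sig * t). ring.
  destruct Hsig as [-> | ->]. rewrite Rabs_pos_eq; lra. rewrite Rabs_left1; lra.
Qed.

(** Identity theorem on the open half-plane, then continuity up to its boundary line: F is
    continuous there, and finite sums approximate the series uniformly on the closed half-plane. *)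
Lemma Estar_half_plane La (g : R -> R -> C) x sig nu (F : C -> C) : sgn1 sig -> 0 < nu ->
  abs_summable (fun t => La t /\ 0 <= sig * t) (Estar_term g x (0, sig * nu)) ->
  (forall w, 0 < sig * snd w -> cder F w) ->
  (exists B, forall w, B < sig * snd w -> F w = (twopii * usum (fun t => La t /\ 0 <= sig * t)%R (Estar_term g x w))%C) ->
  forall w, nu <= sig * snd w -> F w = (twopii * usum (fun t => La t /\ 0 <= sig * t)%R (Estar_term g x w))%C.
Proof.
  intros Hsig Hnu AS HF [B HB]. set (A := fun t => La t /\ 0 <= sig * t) in *.
  assert (PP := PI_RGT_0). assert (Sq := sgn1_sq _ Hsig).
  assert (SA : Rabs sig = 1) by (destruct Hsig as [-> | ->]; [rewrite Rabs_R1|rewrite Rabs_left]; lra).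
  assert (SM := Estar_summ La g x sig nu Hsig AS). fold A in SM.
  set (M := fun t => Cmod (prime_term (fun l => g l x) t) * exp (- (2 * PI * nu * Rabs t))) in *.
  assert (BD : forall t w, A t -> nu <= sig * snd w -> Cmod (Estar_term g x w t) <= M t).
  { intros t w [_ Ht] Hw. rewrite Estar_term_eq, Cmod_mult, Cmod_cexp_real_imag. apply Rmult_le_compat_l. apply Cmod_ge_0.
    assert (X : - (2 * PI * t * snd w) <= - (2 * PI * nu * Rabs t)).
    { replace (Rabs t) with (sig * t).
      2: { destruct Hsig as [-> | ->]. rewrite Rabs_pos_eq; lra. rewrite Rabs_left1; lra. }
      apply Ropp_le_contravar. rewrite !(Rmult_assoc (2 * PI)). apply Rmult_le_compat_l. lra.
      replace (t * snd w) with ((sig * snd w) * (sig * t)) by (replace (sig * snd w * (sig * t)) with (sig * sig * (t * snd w)) by ring; rewrite Sq; ring).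
      apply Rmult_le_compat_r; trivial. }
    apply exp_le; exact X. }
  set (S := fun w => (twopii * usum A (Estar_term g x w))%C).
  assert (TD : forall t w, cder (fun w => Estar_term g x w t) w).
  { intros t w. apply cder_ext with (fun w => prime_term (fun l => g l x) t * cexp (twopii * t * w))%C.
    intros; rewrite Estar_term_eq; trivial. apply cder_mult. apply cder_const. apply cder_cexp. apply cder_mult. apply cder_const. apply cder_id. }
  assert (sigd : forall y w : C, sig * snd w - Cmod (y - w) <= sig * snd y).
  { intros y w. destruct (Cmod_ge_max (y - w)) as [_ X]. simpl in X.
    assert (Y := Rle_abs (- (sig * (snd y + - snd w)))). rewrite Rabs_Ropp, Rabs_mult, SA in Y. lra. }
  assert (SD : forall w, nu < sig * snd w -> cder S w).
  { intros w Hw. apply cder_mult. apply cder_const.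
    apply (usum_cder A M (fun t w => Estar_term g x w t) w (sig * snd w - nu)); trivial. lra.
    intros t z Ht Hz. split. apply TD. apply BD; trivial. assert (X := sigd z w). lra. }
  assert (IN : forall w, nu < sig * snd w -> F w = S w).
  { intros w Hw. set (B' := Rabs B + nu + 1). assert (Q := Rle_abs B). assert (Q' := Rabs_pos B).
    assert (N : null_near (fun w => F w - S w)%C w).
    { apply identity_segment with ((0, sig * B') : C).
      - intros s Hs. apply holo_mero.
        set (p := ((0, (sig * B')%R) + s * (w - (0, (sig * B')%R)))%C).
        assert (Hp : nu < sig * snd p).
        { unfold p. simpl. replace (sig * (sig * B' + (s * (snd w + - (sig * B')) + 0 * (fst w + - 0)))) with
            ((1 - s) * (sig * sig * B') + s * (sig * snd w)) by ring. rewrite Sq.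
          assert (HB' : nu < B') by (unfold B'; lra). set (b := sig * snd w) in *.
          assert (Z1 : 0 <= (1 - s) * (B' - nu)) by (apply Rmult_le_pos; lra).
          destruct (Req_dec s 0) as [->|Ns]. lra.
          assert (Z2 : 0 < s * (b - nu)) by (apply Rmult_lt_0_compat; lra). lra. }
        exists (sig * snd p - nu). split. lra. intros z Hz. assert (X := sigd z p).
        apply cder_minus. apply HF. lra. apply SD. lra.
      - exists 1. split. lra. intros z [_ Hz]. rewrite HB. unfold S. ring.
        assert (X := sigd z (0, sig * B')). simpl in X. replace (sig * (sig * B')) with B' in X by (rewrite <- Rmult_assoc, Sq; ring).
        unfold B' in *. lra. }
    assert (Z := null_near_ccont (fun w => F w - S w)%C w).
    replace (F w) with (F w - S w + S w)%C by ring. rewrite Z; trivial. ring.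
    apply cder_ccont, cder_minus. apply HF. lra. apply SD; trivial. }
  intros w Hw. change (F w = S w). apply Cmod_lt_0_eq. intros e He.
  assert (E8 : 0 < e / 8 / (2 * PI)) by (apply Rdiv_lt_0_compat; lra).
  destruct (usum_dominated A M SM _ E8) as [l0 [F0 K]].
  assert (KS : forall w : C, nu <= sig * snd w -> Cmod (S w - twopii * fin_sum (Estar_term g x w) l0) <= e / 8).
  { intros y Hy. unfold S. replace (twopii * usum A (Estar_term g x y) - twopii * fin_sum (Estar_term g x y) l0)%C with
      (twopii * (usum A (Estar_term g x y) - fin_sum (Estar_term g x y) l0))%C by ring.
    rewrite Cmod_mult, Cmod_twopii.
    assert (Y := K (Estar_term g x y) (usum A (Estar_term g x y)) l0 (fun t Ht => BD t y Ht Hy)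
      (usum_correct _ _ (summ_abs_summable _ _ _ SM (fun t Ht => BD t y Ht Hy))) F0 (incl_refl l0)).
    apply Rle_div_r in Y; lra. }
  assert (C1 : ccont F w) by (apply cder_ccont, HF; lra).
  assert (C2 : ccont (fun w => twopii * fin_sum (Estar_term g x w) l0)%C w).
  { apply cder_ccont, cder_mult. apply cder_const. apply (cder_fin_sum (fun t w => Estar_term g x w t)). auto. }
  destruct (C1 (e / 4) ltac:(lra)) as [d1 [D1 H1]]. destruct (C2 (e / 4) ltac:(lra)) as [d2 [D2 H2]].
  set (d := Rmin d1 d2 / 2). assert (X0 : 0 < Rmin d1 d2) by (apply Rmin_pos; trivial).
  assert (X1 := Rmin_l d1 d2). assert (X2 := Rmin_r d1 d2).
  (* The point w is approached vertically from inside the open half-plane, where F and S agree. *)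
  set (y := (w + Ci * (sig * d)%R)%C).
  assert (Dy : Cmod (y - w) = d).
  { unfold y. replace (w + Ci * (sig * d)%R - w)%C with (Ci * (sig * d)%R)%C by ring.
    rewrite Cmod_mult, Cmod_Ci, Cmod_R, Rabs_mult, SA, Rabs_pos_eq; unfold d; lra. }
  assert (Hy : nu < sig * snd y).
  { unfold y. simpl. replace (sig * (snd w + (0 * 0 + 1 * (sig * d)))) with (sig * snd w + sig * sig * d) by ring.
    rewrite Sq. unfold d. lra. }
  specialize (H1 y ltac:(rewrite Dy; unfold d; lra)). specialize (H2 y ltac:(rewrite Dy; unfold d; lra)).
  rewrite (IN y Hy) in H1.
  assert (K1 := KS y ltac:(lra)). assert (K2 := KS w Hw).
  set (fy := (twopii * fin_sum (Estar_term g x y) l0)%C) in *. set (fw := (twopii * fin_sum (Estar_term g x w) l0)%C) in *.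
  replace (F w - S w)%C with (- (S y - F w) + ((S y - fy) + ((fy - fw) + - (S w - fw))))%C by ring.
  eapply Rle_trans. apply Cmod_triangle. rewrite Cmod_opp.
  assert (T1 := Cmod_triangle (S y - fy) (fy - fw + - (S w - fw))).
  assert (T2 := Cmod_triangle (fy - fw) (- (S w - fw))). rewrite Cmod_opp in T2. lra.
Qed.

(** * Vanishing residues, poles of differences, and the data extracted from (a) and (d) *)

(** Just above p, at a regular point, f equals c/(z - p) + H(z); boundedness along the segment gives
    |c| <= y (B + M) for all small y > 0. The value at p itself tells nothing, being arbitrary at a
    pole. *)
Lemma residue_zero P rho Ls hh eta (f : C -> C) (p B : R) : pole_data P rho Ls hh eta ->
  meromorphic f -> (forall z : C, Rabs (snd z) < 3 / 2 * eta -> null_near (fun z => f z - strip_fun P rho Ls hh eta z)%C z) ->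
  (forall y, Rabs y <= eta -> Cmod (f (p, y)) <= B) -> P p -> rho p = 0.
Proof.
  intros D Hf HN HB Pp. assert (He : 0 < eta) by apply D.
  assert (Hp : Rabs (snd (RtoC p)) < 3 / 2 * eta). { simpl. rewrite Rabs_R0. lra. }
  destruct (strip_fun_residue P rho Ls hh eta (RtoC p) D Hp) as (c & H & r & Hr & H1 & H2 & H3 & _).
  assert (Ec := H3 p eq_refl Pp).
  assert (CH : ccont H (RtoC p)). { apply cder_ccont, H1. rewrite Cmod_self; trivial. }
  destruct (ccont_bounded _ _ CH) as [d [Hd HH]]. set (M := Cmod (H (RtoC p)) + 1) in *.
  assert (M0 : 0 < M) by (assert (X := Cmod_ge_0 (H (RtoC p))); unfold M; lra).
  assert (B0 : 0 <= B). { eapply Rle_trans. 2: apply (HB 0); rewrite Rabs_R0; lra. apply Cmod_ge_0. }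
  assert (C0 : c = 0).
  { apply Cmod_lt_0_eq. intros e Hepos. replace (c - 0)%C with c by ring.
    set (y := Rmin (Rmin r d) (Rmin eta (e / (B + M))) / 2).
    assert (Q : 0 < e / (B + M)) by (apply Rdiv_lt_0_compat; lra).
    assert (X0 : 0 < Rmin (Rmin r d) (Rmin eta (e / (B + M)))) by (repeat apply Rmin_pos; trivial).
    assert (X1 := Rmin_l (Rmin r d) (Rmin eta (e / (B + M)))). assert (X2 := Rmin_r (Rmin r d) (Rmin eta (e / (B + M)))).
    assert (X3 := Rmin_l r d). assert (X4 := Rmin_r r d). assert (X5 := Rmin_l eta (e / (B + M))). assert (X6 := Rmin_r eta (e / (B + M))).
    assert (Y0 : 0 < y) by (unfold y; lra).
    set (z := (p, y) : C).
    assert (Ez : (z - p = Ci * y)%C) by (apply injective_projections; simpl; ring).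
    assert (Dz : Cmod (z - p) = y) by (rewrite Ez, Cmod_mult, Cmod_Ci, Cmod_R, Rabs_pos_eq; lra).
    assert (Hz : Rabs (snd z) < 3 / 2 * eta). { simpl. rewrite Rabs_pos_eq; unfold y; lra. }
    assert (V : f z = strip_fun P rho Ls hh eta z).
    { apply meromorphic_value; trivial. apply cder_ccont, strip_fun_regular; trivial.
      intros t _ _ Z. injection Z. intros; lra. apply HN; trivial. }
    assert (Bz := HB y ltac:(rewrite Rabs_pos_eq; unfold y; lra)). fold z in Bz. rewrite V, H2 in Bz by (rewrite Dz; unfold y; lra).
    assert (Hz' := HH z ltac:(rewrite Dz; unfold y; lra)).
    assert (Nz : (z - p)%C <> 0) by (apply Cmod_gt_0; lra).
    replace c with ((z - p) * ((c / (z - p) + H z) - H z))%C by (field; trivial).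
    rewrite Cmod_mult, Dz.
    assert (T := Cmod_triangle_minus (c / (z - p) + H z) (H z)).
    assert (y <= e / (B + M)) by (unfold y; lra). apply Rle_div_r in H0; [|lra].
    apply Rle_trans with (y * (B + M)). apply Rmult_le_compat_l; lra. lra. }
  rewrite C0 in Ec. replace (rho p) with (- - rho p)%C by ring. rewrite <- Ec. ring.
Qed.

(** Over the common denominator (z - z0)^n the numerator takes the nonzero value -phi(z0), so a pole
    persists and none becomes removable. *)
Lemma meromorphic_entire_minus E F : entire_fun E -> meromorphic F -> meromorphic (fun z => E z - F z)%C.
Proof.
  intros HE HF z0. destruct (HF z0) as [H|(n & phi & r & Hn & H1 & H2 & Hr & H3)].
  - left. apply holomorphic_at_holo in H. apply holomorphic_at_holo. destruct H as [r [Hr H]].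
    exists r. split; trivial. intros z Hz. apply cder_minus; auto.
  - right. apply holomorphic_at_holo in H1. destruct H1 as [r1 [Hr1 H1]].
    exists n, (fun z => E z * (z - z0) ^ n - phi z)%C, r. split; trivial. split; [|split; [|split; trivial]].
    + apply holomorphic_at_holo. exists r1. split; trivial. intros z Hz. apply cder_minus; auto.
      apply cder_mult; auto. apply (cder_pow (fun z => z - z0)%C). apply cder_minus_const.
    + replace (z0 - z0)%C with (RtoC 0) by ring. destruct n. lia. simpl. intros Z. apply H2.
      replace (phi z0) with (- (E z0 * (0 * 0 ^ n) - phi z0))%C by ring. rewrite Z. ring.
    + intros z Hz. rewrite H3 by trivial. field. apply Cpow_nz, Cmod_gt_0, Hz.
Qed.

Lemma entire_cexp_lin (a : C) : entire_fun (fun w => cexp (a * w)).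
Proof. intros w. apply cder_cexp, cder_mult. apply cder_const. apply cder_id. Qed.

Lemma pos_weight_opp x : pos_weight (- x) = 1 - pos_weight x.
Proof.
  destruct (pos_weight_cases x) as [[C1 ->]|[[C1 ->]|[C1 ->]]];
  destruct (pos_weight_cases (- x)) as [[C2 ->]|[[C2 ->]|[C2 ->]]]; lra.
Qed.

Lemma summ_ext A M N : (forall t, A t -> M t = N t) -> summ A M -> summ A N.
Proof.
  intros E H. apply summ_le with (1 := H). intros t Ht. rewrite <- E by trivial. split. apply H; trivial. lra.
Qed.

(** Absolute convergence is used at one point of each half-plane, at heights +-eta and +-nu. The
    modulus of the exponential there is the weight required of h, and up to a constant it dominates
    the Gaussian weight required of g. *)
Lemma formula_pole_data La Ls (g h : R -> R -> C) eta nu x : 0 < eta -> 0 < nu ->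
  locally_finite La -> locally_finite Ls ->
  abs_summable (nonpos_part Ls) (E_term h x (0, eta)) ->
  abs_summable (nonneg_part Ls) (E_term h x (0, - eta)) ->
  abs_summable (nonneg_part La) (Estar_term g x (0, nu)) ->
  abs_summable (nonpos_part La) (Estar_term g x (0, - nu)) ->
  summ (nonpos_part Ls) (fun t => Cmod (prime_term (fun l => h l x) t) * exp (2 * PI * eta * t)) /\
  summ (nonneg_part Ls) (fun t => Cmod (prime_term (fun l => h l x) t) * exp (2 * PI * - eta * t)) /\
  pole_data (fun t => La t \/ t = x) (rho_of La (fun l => g l x) x) Ls (fun l => h l x) eta.
Proof.
  intros He Hn HLa HLs H1 H2 H3 H4.
  assert (QB : forall y t, Cmod (E_term h x (0, y) t) = Cmod (prime_term (fun l => h l x) t) * exp (2 * PI * y * t)).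
  { intros y t. rewrite E_term_eq. unfold qterm. rewrite Cmod_mult, Cmod_cexp. f_equal. f_equal. unfold twopii; simpl; ring. }
  assert (SU := summ_ext _ _ _ (fun t _ => QB eta t) (abs_summable_summ _ _ H1)).
  assert (SL := summ_ext _ _ _ (fun t _ => QB (- eta) t) (abs_summable_summ _ _ H2)).
  split; trivial. split; trivial. split; trivial. split; [|split].
  - apply locally_finite_loc_fin. intros a b. destruct (HLa a b) as [l Hl]. exists (x :: l).
    intros t [Ht| ->] Hab; [right; auto|left; trivial].
  - assert (SLa : summ La (fun t => Cmod (g t x) * exp (- (2 * PI * nu * Rabs t)))).
    { apply (summ_two_sided La (fun l => g l x) (2 * PI * nu)).
      - apply summ_ext with (2 := abs_summable_summ _ _ H3). intros t _. rewrite Estar_term_eq, Cmod_mult, Cmod_cexp_real_imag.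
        f_equal. f_equal. simpl. ring.
      - apply summ_ext with (2 := abs_summable_summ _ _ H4). intros t _. rewrite Estar_term_eq, Cmod_mult, Cmod_cexp_real_imag.
        f_equal. f_equal. simpl. ring. }
    apply summ_add_point with La (fun t => exp (PI * nu * (PI * nu)) * (Cmod (g t x) * exp (- (2 * PI * nu * Rabs t)))) x.
    + apply summ_scal; trivial. left; apply exp_pos.
    + apply Rmult_le_pos. apply Cmod_ge_0. left; apply exp_pos.
    + intros t [H|H] N; [trivial|contradiction].
    + intros t H N. rewrite rho_ne by trivial. split. apply Rmult_le_pos. apply Cmod_ge_0. left; apply exp_pos.
      rewrite <- Rmult_assoc, (Rmult_comm _ (Cmod (g t x))), Rmult_assoc. apply Rmult_le_compat_l. apply Cmod_ge_0.
      apply gauss_vs_exp.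
  - apply (summ_two_sided Ls (fun l => h l x) (2 * PI * eta)).
    + apply summ_ext with (2 := SL). intros t _. f_equal. f_equal. ring.
    + exact SU.
Qed.

(** * The two formulas as identities between meromorphic functions of w *)

Theorem theorem3
  (La Ls : R -> Prop) (g h : R -> R -> C) (eta0 nu0 : R)
  (HG : exists (G : C -> C) (c : R),
      entire G /\ (exists z, G z <> RtoC 0) /\
      (forall l, La l -> G (RtoC l) = RtoC 0) /\
      0 < c /\
      forall eta : R, exists K : R, forall x y : R,
        Rabs y <= eta -> Cmod (G (x, y)) <= K * exp (c * x ^ 2))
  (HLs : locally_finite Ls)
  (* (a) *)
  (Heta0 : 0 < eta0)
  (Ha_plus : forall (x : R) (z : C), eta0 <= Im z ->
      abs_summable (nonpos_part Ls) (E_term h x z))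
  (Ha_minus : forall (x : R) (z : C), Im z <= - eta0 ->
      abs_summable (nonneg_part Ls) (E_term h x z))
  (* (b) *)
  (Hb : forall eps x : R, 0 < eps ->
      forall delta : R, 0 < delta ->
      exists M : R, forall l, La l -> M < Rabs l ->
        Cmod (g l x * RtoC (exp (- eps * l ^ 2))) < delta)
  (* (c) *)
  (Hc : forall (eps : R) (z : C), 0 < eps -> eta0 <= Rabs (Im z) ->
      forall x : R, exists s t : C,
        is_usum La (fun l => f_eps eps z l * g l x)%C s /\
        is_usum Ls (fun l => fourier (f_eps eps z) l * h l x)%C t /\
        f_eps eps z x = (s + t)%C)
  (* (d) *)
  (Hnu0 : 0 < nu0)
  (Hd_plus : forall (x : R) (w : C), nu0 <= Im w ->
      abs_summable (nonneg_part La) (Estar_term g x w))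
  (Hd_minus : forall (x : R) (w : C), Im w <= - nu0 ->
      abs_summable (nonpos_part La) (Estar_term g x w))
  (* the meromorphic continuations of z |-> E_plus, E_minus *)
  (Ep Em : R -> C -> C)
  (HEp : forall x, is_mero_ext (fun z => eta0 <= Im z) (E_plus Ls h x) (Ep x))
  (HEm : forall x, is_mero_ext (fun z => Im z <= - eta0) (E_minus Ls h x) (Em x))
  (* (e) *)
  (He : forall x : R, exists (c K : R) (tp tm : nat -> R),
      0 < c /\ is_lim_seq tp p_infty /\ is_lim_seq tm m_infty /\
      forall (n : nat) (eta : R), Rabs eta <= eta0 ->
        Cmod (Ep x (tp n, eta)) <= K * exp (c * Rabs (tp n)) /\
        Cmod (Ep x (tm n, eta)) <= K * exp (c * Rabs (tm n)) /\
        Cmod (Em x (tp n, eta)) <= K * exp (c * Rabs (tp n)) /\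
        Cmod (Em x (tm n, eta)) <= K * exp (c * Rabs (tm n))) :
  forall x : R, exists Esp Esm : C -> C,
    is_mero_ext (fun w => nu0 <= Im w) (Estar_plus La g x) Esp /\
    is_mero_ext (fun w => Im w <= - nu0) (Estar_minus La g x) Esm /\
    forall w : C, (forall l, Ls l -> w <> RtoC l) ->
      abs_summable (nonneg_part Ls) (dual_term_nonneg eta0 h x w) /\
      abs_summable (nonpos_part Ls) (dual_term_nonpos eta0 h x w) /\
      ex_Phi eta0 (Em x) w /\
      Esp w = (twopii * cexp (twopii * x * w) * heaviside x
               + usum (nonneg_part Ls) (dual_term_nonneg eta0 h x w)
               + usum (nonpos_part Ls) (dual_term_nonpos eta0 h x w)
               + Phi eta0 (Em x) w)%C /\
      Esm w = (twopii * cexp (twopii * x * w) - Esp w)%C.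
Proof.
  intros x.
  assert (LLa : locally_finite La).
  { destruct HG as (G & c & HG1 & HG2 & HG3 & _).
    assert (HGc : forall z, cder G z).
    { intros z. destruct (proj1 (holomorphic_at_holo G z) (HG1 z)) as [r [Hr H]]. apply H.
      rewrite Cmod_self; trivial. }
    intros a b. destruct (entire_zeros_locally_finite G HGc HG2 a b) as [l Hl].
    exists l. intros t Ht Hab. apply Hl; auto. }
  destruct (formula_pole_data La Ls g h eta0 nu0 x Heta0 Hnu0 LLa HLs) as (SU & SL & D).
  { apply Ha_plus. simpl. lra. } { apply Ha_minus. simpl. lra. }
  { apply Hd_plus. simpl. lra. } { apply Hd_minus. simpl. lra. }
  set (P := fun t => La t \/ t = x) in *. set (hh := fun l => h l x) in *.
  set (rho := rho_of La (fun l => g l x) x) in *. set (p := prime_term hh) in *.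
  set (N := strip_fun P rho Ls hh eta0).
  assert (NV : forall z : C, eta0 <= Rabs (snd z) < 3 / 2 * eta0 ->
     N z = (if Rlt_dec 0 (snd z) then - E_plus Ls h x z else E_minus Ls h x z)%C).
  { intros z Hz. apply interpolation_upper; trivial. apply Hc. lra. apply Hz. }
  destruct (HEm x) as [MEm VEm].
  assert (HN : forall z : C, Rabs (snd z) < 3 / 2 * eta0 -> null_near (fun z => Em x z - N z)%C z).
  { apply strip_fun_identity; trivial. intros z Hz. rewrite VEm by (unfold Im; lra). unfold N in NV. rewrite NV.
    destruct (Rlt_dec 0 (snd z)); trivial. lra. rewrite Rabs_left; lra. }
  assert (EmN : forall z : C, Rabs (snd z) < 3 / 2 * eta0 -> (forall t, P t -> rho t <> 0 -> z <> RtoC t) -> Em x z = N z).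
  { intros z Hz Nz. apply meromorphic_value; trivial. apply cder_ccont, strip_fun_regular; trivial. apply HN; trivial. }
  (* Off 0 the segment contains no real point, so [Em x] and N agree there and have the same
     principal value; this also shows that Phi exists. *)
  assert (PHI : forall w, is_pv (pv_integrand N w) eta0 (Phi eta0 (Em x) w) /\ ex_Phi eta0 (Em x) w).
  { intros w.
    destruct (strip_fun_pv P rho Ls hh eta0 (fun z => cexp (twopii * z * w)) D) as [v Hv].
    { intros z. apply cder_cexp. apply (cder_mult (fun z => twopii * z)%C). apply cder_mult. apply cder_const. apply cder_id. apply cder_const. }
    fold N in Hv.
    assert (Hv' : is_pv (Phi_integrand (Em x) w) eta0 v).
    { apply (is_pv_ext (fun y => Ci * (cexp (twopii * (0, y) * w) * N (0, y)))%C _ eta0 v Heta0); [|exact Hv].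
      intros y [Hy0 Hy]. unfold Phi_integrand.
      replace (Ci * y)%C with ((0, y) : C) by (apply injective_projections; simpl; ring).
      rewrite EmN. ring. simpl; lra. intros t _ _ Z. injection Z. intros Zy _. rewrite Zy, Rabs_R0 in Hy0. lra. }
    assert (EP : Phi eta0 (Em x) w = v).
    { unfold Phi. apply (iota_unique (V := C_R_CompleteNormedModule)); [|exact Hv'].
      intros u Hu. exact (is_pv_unique _ _ _ _ Hu Hv'). }
    split. rewrite EP. exact Hv. exists v. exact Hv'. }
  set (X := fun w => cexp (twopii * x * w)).
  set (R0 := fun w => (twopii * X w * heaviside x + Phi eta0 (Em x) w)%C).
  assert (EX : entire_fun X) by apply entire_cexp_lin.
  assert (ER0 : entire_fun R0).
  { intros w. apply cder_plus. apply cder_mult. apply cder_mult. apply cder_const. apply EX. apply cder_const.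
    apply (pv_cder P rho Ls hh eta0 (Phi eta0 (Em x)) D). intros; apply PHI. }
  assert (LFs := locally_finite_loc_fin _ HLs).
  assert (SS : summ Ls (fun xi => Cmod (hh xi) * exp (- (2 * PI * eta0 * Rabs xi)))) by apply D.
  destruct (dual_sum_meromorphic Ls hh eta0 R0 Heta0 LFs SS ER0) as [MEsp CEsp].
  (* The continuations are defined by the right-hand sides, so the two identities hold by
     construction up to regrouping; the task left is to show that they extend the series. *)
  set (Esp := fun w => (usum Ls (dual_term hh eta0 w) + R0 w)%C) in *.
  set (Esm := fun w => (twopii * X w - Esp w)%C).
  assert (EtX : entire_fun (fun w => twopii * X w)%C) by (intros w; apply cder_mult; [apply cder_const|apply EX]).
  assert (MEsm : meromorphic Esm) by (apply meromorphic_entire_minus; trivial).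
  assert (PARTS : forall w, abs_summable (nonneg_part Ls) (dual_lower p eta0 w) /\
     abs_summable (nonpos_part Ls) (dual_upper p eta0 w) /\
     usum Ls (dual_term hh eta0 w) = (usum (nonneg_part Ls) (dual_lower p eta0 w) + usum (nonpos_part Ls) (dual_upper p eta0 w))%C).
  { intros w. apply dual_sum_parts. destruct (dual_sum_split Ls hh eta0 w Heta0 LFs SS) as (L & T & _ & _ & _ & _ & H).
    apply H. rewrite Cmod_self; lra. }
  destruct (He x) as (c & K & tp & tm & Hcpos & Htp & Htm & HB).
  (* T is a term of [tp], or minus a term of [tm]. The residue at sig T vanishes by [residue_zero],
     so the bound of (e) passes from [Em x] to N on the whole segment, its real point included. *)
  assert (SIDE : forall sig, sgn1 sig -> forall B, exists T, B < T /\ (P (sig * T) -> rho (sig * T) = 0) /\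
     forall y, Rabs y <= eta0 -> Cmod (N (sig * T, y)) <= K * exp (c * T)).
  { intros sig Hsig B.
    assert (EXT : exists T, B < T /\ forall y, Rabs y <= eta0 -> Cmod (Em x (sig * T, y)) <= K * exp (c * T)).
    { assert (Q := Rle_abs B). assert (Q' := Rabs_pos B). destruct Hsig as [-> | ->].
      - apply is_lim_seq_spec in Htp. destruct (Htp (Rabs B)) as [n Hn]. specialize (Hn n (Nat.le_refl n)).
        exists (tp n). split. lra. intros y Hy. destruct (HB n y Hy) as (_ & _ & H & _).
        rewrite Rmult_1_l. rewrite (Rabs_pos_eq (tp n)) in H by lra. exact H.
      - apply is_lim_seq_spec in Htm. destruct (Htm (- Rabs B)) as [n Hn]. specialize (Hn n (Nat.le_refl n)).
        exists (- tm n). split. lra. intros y Hy. destruct (HB n y Hy) as (_ & _ & _ & H).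
        replace (-1 * - tm n) with (tm n) by ring. rewrite (Rabs_left (tm n)) in H by lra. exact H. }
    destruct EXT as [T [HT HE]]. exists T. split; trivial.
    assert (RZ : P (sig * T) -> rho (sig * T) = 0).
    { apply (residue_zero P rho Ls hh eta0 (Em x) (sig * T) (K * exp (c * T)) D MEm HN HE). }
    split; trivial. intros y Hy. rewrite <- EmN. apply HE; trivial. simpl; lra.
    intros t Pt Nt Z. injection Z. intros _ Et. rewrite Et in RZ. apply Nt, RZ, Pt. }
  assert (SIG : forall sig, sgn1 sig -> forall w, nu0 <= sig * snd w -> abs_summable (fun t => La t /\ 0 <= sig * t) (Estar_term g x w)).
  { intros sig [-> | ->] w Hw. rewrite half_set_pos. apply Hd_plus. unfold Im. lra.
    rewrite half_set_neg. apply Hd_minus. unfold Im. lra. }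
  assert (MAIN : forall sig, sgn1 sig -> forall w, Rmax nu0 c < sig * snd w ->
     (usum Ls (dual_term hh eta0 w) + Phi eta0 (Em x) w =
      sig * (twopii * usum (fun t => La t /\ 0 <= sig * t)%R (Estar_term g x w) - twopii * (pos_weight (sig * x) * X w)))%C).
  { intros sig Hsig w Hw. assert (Q1 := Rmax_l nu0 c). assert (Q2 := Rmax_r nu0 c).
    destruct (residue_sum La g x sig w Hsig (SIG sig Hsig w ltac:(lra))) as [RS1 RS2]. fold P rho in RS1, RS2.
    (* Since 1 < pi / 2, the inequality c < sig Im w implies the condition c < 2 pi (sig Im w) of
       the contour identity. *)
    assert (P2 := PI2_1).
    assert (CI' := contour_identity P rho Ls hh eta0 p sig w K c (Phi eta0 (Em x) w) D Hsig SU SL).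
    rewrite (proj2 (proj2 (PARTS w))). rewrite CI'; clear CI'.
    - etransitivity. apply (f_equal (fun u => sig * twopii * u)%C RS2). unfold X. ring.
    - intros t. fold N. rewrite NV. simpl. destruct (Rlt_dec 0 eta0); [|lra].
      unfold E_plus. rewrite (usum_ext _ _ _ (fun l _ => E_term_eq h x (t, eta0) l)).
      change (- (twopii * usum (nonpos_part Ls) (qterm p (t, eta0))) = - twopii * usum (nonpos_part Ls) (qterm p (t, eta0)))%C. ring.
      simpl. rewrite Rabs_pos_eq; lra.
    - intros t. fold N. rewrite NV. simpl. destruct (Rlt_dec 0 (- eta0)); [lra|].
      unfold E_minus. rewrite (usum_ext _ _ _ (fun l _ => E_term_eq h x (t, - eta0) l)). reflexivity.
      simpl. rewrite Rabs_left; lra.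
    - apply SIDE; trivial.
    - lra.
    - nra.
    - exact RS1.
    - apply PHI. }
  assert (Npos : forall sig w, sgn1 sig -> 0 < sig * snd w -> forall xi, Ls xi -> w <> RtoC xi).
  { intros sig w _ Hw xi _ ->. simpl in Hw. lra. }
  exists Esp, Esm. split; [|split].
  - split; trivial. intros w Hw. unfold Estar_plus. rewrite <- half_set_pos.
    apply (Estar_half_plane La g x 1 nu0); trivial. left; trivial.
    + apply SIG. left; trivial. simpl. lra.
    + intros y Hy. apply CEsp. apply (Npos 1); trivial. left; trivial.
    + exists (Rmax nu0 c). intros y Hy. unfold Esp, R0.
      assert (M := MAIN 1 (or_introl eq_refl) y Hy).
      replace (usum Ls (dual_term hh eta0 y) + (twopii * X y * heaviside x + Phi eta0 (Em x) y))%C with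
       ((usum Ls (dual_term hh eta0 y) + Phi eta0 (Em x) y) + twopii * X y * heaviside x)%C by ring.
      rewrite M. rewrite Rmult_1_l. change (heaviside x) with (pos_weight x). ring.
    + unfold Im in Hw. lra.
  - split; trivial. intros w Hw. unfold Estar_minus. rewrite <- half_set_neg.
    apply (Estar_half_plane La g x (-1) nu0); trivial. right; trivial.
    + apply SIG. right; trivial. simpl. lra.
    + intros y Hy. apply cder_minus. apply EtX. apply CEsp. apply (Npos (-1)); trivial. right; trivial.
    + exists (Rmax nu0 c). intros y Hy. unfold Esm, Esp, R0.
      assert (M := MAIN (-1) (or_intror eq_refl) y Hy).
      replace (usum Ls (dual_term hh eta0 y) + (twopii * X y * heaviside x + Phi eta0 (Em x) y))%C with
       ((usum Ls (dual_term hh eta0 y) + Phi eta0 (Em x) y) + twopii * X y * heaviside x)%C by ring.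
      (* The relation H(-x) = 1 - H(x), valid at 0 thanks to the value 1/2, produces the term 2 pi i
         e^(2 pi i x w) of the second identity. *)
      rewrite M. replace (-1 * x) with (- x) by ring. rewrite pos_weight_opp. change (heaviside x) with (pos_weight x).
      rewrite RtoC_minus. replace (RtoC (-1)) with (- (1))%C by (apply injective_projections; simpl; ring). ring.
    + unfold Im in Hw. lra.
  - intros w _. destruct (PARTS w) as (A1 & A2 & A3).
    assert (E1 : dual_term_nonneg eta0 h x w = dual_lower p eta0 w).
    { apply functional_extensionality. intros t. apply (prime_term_mult hh). }
    assert (E2 : dual_term_nonpos eta0 h x w = dual_upper p eta0 w).
    { apply functional_extensionality. intros t. apply (prime_term_mult hh). }
    rewrite E1, E2. split; trivial. split; trivial. split. apply PHI. split; trivial.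
    unfold Esp, R0. rewrite A3. unfold X. ring.
Qed.
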